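(* Let $X$ be a nonempty set, let $s$ be a normalized complete Pick kernel on $X$, and let $\ell=g s$ where $g$ is a positive semi-definite kernel on $X$ (assume $\ell_z\neq 0$ for all $z\in X$). Then a sequence $\{\lambda_i\}\subset X$ is interpolating for $\mathrm{Mult}(\mathcal{H}_s,\mathcal{H}_\ell)$ if and only if it satisfies the Carleson measure condition for $\mathcal{H}_s$ and is $n$-weakly separated by $\ell$ for every $n\ge 2$.
   Context: A kernel on a nonempty set $X$ is a positive semi-definite function $k:X\times X\to\mathbb{C}$; $\mathcal{H}_k$ is its reproducing kernel Hilbert space, $k_w=k(\cdot,w)$ (so $\langle k_w,k_z\rangle=k(z,w)$ and $\|k_w\|^2=k(w,w)$), and $\hat k_w=k_w/\|k_w\|$ when $k_w\ne 0$. A normalized complete Pick kernel is a kernel of the form $s(z,w)=\frac{1}{1-\langle b(z),b(w)\rangle_{\mathcal K}}$, where $b$ maps $X$ into the open unit ball of an auxiliary Hilbert space $\mathcal K$ and $b(w_0)=0$ for some $w_0\in X$. For kernels $k,\ell$ on $X$, $\mathrm{Mult}(\mathcal{H}_k,\mathcal{H}_\ell)$ is the set of functions $\phi:X\to\mathbb{C}$ such that $f\mapsto\phi f$ is a bounded operator $\mathcal{H}_k\to\mathcal{H}_\ell$, normed by the operator norm. A sequence $\{\lambda_i\}\subset X$ is interpolating for $\mathrm{Mult}(\mathcal{H}_k,\mathcal{H}_\ell)$ if for every bounded sequence $\{w_i\}$ of complex numbers there is $\phi\in\mathrm{Mult}(\mathcal{H}_k,\mathcal{H}_\ell)$ with $\phi(\lambda_i)=w_i\frac{\|\ell_{\lambda_i}\|}{\|k_{\lambda_i}\|}$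 for all $i$. A sequence $\{\lambda_i\}$ satisfies the Carleson measure condition for $\mathcal{H}_k$ if there is $C>0$ with $\sum_i \frac{|f(\lambda_i)|^2}{\|k_{\lambda_i}\|^2}\le C\|f\|^2_{\mathcal{H}_k}$ for all $f\in\mathcal{H}_k$. For $n\ge 2$, a sequence $\{\lambda_i\}$ (of distinct points) is $n$-weakly separated by $k$ if there is $\epsilon>0$ such that for every $n$-point subset $\{\mu_1,\dots,\mu_n\}$ of $\{\lambda_i\}$, $\mathrm{dist}\big(\hat k_{\mu_1},\mathrm{span}\{\hat k_{\mu_2},\dots,\hat k_{\mu_n}\}\big)\ge\epsilon$ (distance in $\mathcal{H}_k$). *)

(* Defs.v *)
(* R : realType (any model of the real numbers),
   complex numbers C := R[i] from mathcomp-real-closed. *)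
From HB Require Import structures.
From mathcomp Require Import all_boot all_order all_algebra.
From mathcomp Require Import complex.
From mathcomp Require Import classical_sets reals.
Set Implicit Arguments. Unset Strict Implicit. Unset Printing Implicit Defensive.
Import Order.TTheory GRing.Theory Num.Theory.
Local Open Scope ring_scope.

Section RKHS.
Variable R : realType.
Local Notation C := R[i].

(* modulus of a complex number, as a real number *)
Definition cabs (z : C) : R := complex.Re `|z|.

(* For a finite family x_0..x_{n-1} in X and coefficients c, the quantity
   || sum_i c_i k_{x_i} ||^2 = sum_{i,j} conj(c_i) c_j k(x_i, x_j),
   using the convention <k_w, k_z> = k(z, w). *)
Definition kform (X : Type) (k : X -> X -> C) (n : nat) (x : 'I_n -> X)
    (c : 'I_n -> C) : C :=
  \sum_(i < n) \sum_(j < n) (c i)^* * c j * k (x i) (x j).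

(* k is a kernel: positive semi-definite *)
Definition is_kernel (X : Type) (k : X -> X -> C) : Prop :=
  forall (n : nat) (x : 'I_n -> X) (c : 'I_n -> C), 0 <= kform k x c.

(* Reproducing kernel Hilbert space H_k, as a space of functions X -> C
   (Aronszajn): f in H_k with ||f|| <= M iff for every finite combination
   g = sum_i c_i k_{x_i},  |<f, g>| = |sum_i conj(c_i) f(x_i)| <= M ||g||. *)
Definition rkhs_bound (X : Type) (k : X -> X -> C) (f : X -> C) (M : R) : Prop :=
  forall (n : nat) (x : 'I_n -> X) (c : 'I_n -> C),
    `| \sum_(i < n) (c i)^* * f (x i) | ^+ 2 <= ((M ^+ 2)%:C)%C * kform k x c.

Definition in_rkhs (X : Type) (k : X -> X -> C) (f : X -> C) : Prop :=
  exists M : R, rkhs_bound k f M.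

(* the norm of f in H_k *)
Definition rkhs_norm (X : Type) (k : X -> X -> C) (f : X -> C) : R :=
  inf [set M : R | 0 <= M /\ rkhs_bound k f M].

(* ||k_w|| *)
Definition knorm (X : Type) (k : X -> X -> C) (w : X) : R :=
  rkhs_norm k (fun z => k z w).

(* normalized kernel function \hat k_w = k_w / ||k_w|| *)
Definition khat (X : Type) (k : X -> X -> C) (w : X) : X -> C :=
  fun z => k z w / ((knorm k w)%:C)%C.

(* phi in Mult(H_k, H_l): f |-> phi f is a bounded operator H_k -> H_l *)
Definition is_multiplier (X : Type) (k l : X -> X -> C) (phi : X -> C) : Prop :=
  exists Cst : R, forall f : X -> C, in_rkhs k f ->
    in_rkhs l (fun z => phi z * f z) /\
    rkhs_norm l (fun z => phi z * f z) <= Cst * rkhs_norm k f.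

(* {lam_i} is interpolating for Mult(H_k, H_l) *)
Definition interpolating (X : Type) (k l : X -> X -> C) (lam : nat -> X) : Prop :=
  forall w : nat -> C, (exists B : R, forall i, cabs (w i) <= B) ->
    exists phi : X -> C, is_multiplier k l phi /\
      forall i, phi (lam i) = w i * ((knorm l (lam i) / knorm k (lam i))%:C)%C.

(* Carleson measure condition for H_k (the series of nonnegative terms is
   bounded by C ||f||^2 iff all its partial sums are) *)
Definition carleson (X : Type) (k : X -> X -> C) (lam : nat -> X) : Prop :=
  exists Cst : R, 0 < Cst /\ forall f : X -> C, in_rkhs k f ->
    forall N : nat,
      \sum_(i < N) cabs (f (lam i)) ^+ 2 / knorm k (lam i) ^+ 2
        <= Cst * rkhs_norm k f ^+ 2.

(* distance in H_k from f to span{ g j | P j } *)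
Definition rkhs_dist (X : Type) (k : X -> X -> C) (f : X -> C) (m : nat)
    (g : 'I_m -> X -> C) (P : pred 'I_m) : R :=
  inf [set d : R | exists c : 'I_m -> C,
         d = rkhs_norm k (fun z => f z - \sum_(j < m | P j) c j * g j z)].

(* {lam_i} is n-weakly separated by k: for every n-point subset
   {mu_1, ..., mu_n} of {lam_i} (mu_{i0} playing the role of mu_1),
   dist(\hat k_{mu_{i0}}, span{\hat k_{mu_j} : j <> i0}) >= eps. *)
Definition weakly_separated (X : Type) (k : X -> X -> C) (lam : nat -> X)
    (n : nat) : Prop :=
  exists eps : R, 0 < eps /\
    forall mu : 'I_n -> X, injective mu -> (forall i, exists m, mu i = lam m) ->
      forall i0 : 'I_n,
        eps <= rkhs_dist k (khat k (mu i0)) (fun j => khat k (mu j))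
                 (fun j => j != i0).

(* ip is an inner product on the complex vector space V
   (linear in the first argument) *)
Definition is_inner_product (V : lmodType C) (ip : V -> V -> C) : Prop :=
  [/\ (forall (a : C) (x y z : V), ip (a *: x + y) z = a * ip x z + ip y z),
      (forall x y : V, ip y x = (ip x y)^*),
      (forall x : V, 0 <= ip x x) &
      (forall x : V, ip x x = 0 -> x = 0)].

(* completeness for the norm ||x|| = sqrt(ip x x) *)
Definition ip_complete (V : lmodType C) (ip : V -> V -> C) : Prop :=
  forall u : nat -> V,
    (forall e : R, 0 < e -> exists N, forall m n, (N <= m)%N -> (N <= n)%N ->
       cabs (ip (u m - u n) (u m - u n)) < e) ->
    exists x : V, forall e : R, 0 < e -> exists N, forall n, (N <= n)%N ->
       cabs (ip (u n - x) (u n - x)) < e.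

(* s is a normalized complete Pick kernel:
   s(z,w) = 1 / (1 - <b(z), b(w)>_K) with b : X -> open unit ball of a
   Hilbert space K and b(w0) = 0 for some w0. *)
Definition normalized_complete_pick (X : Type) (s : X -> X -> C) : Prop :=
  exists (K : lmodType C) (ip : K -> K -> C) (b : X -> K),
    [/\ is_inner_product ip, ip_complete ip,
        (forall z, ip (b z) (b z) < 1),
        (exists w0, b w0 = 0) &
        (forall z w, s z w = (1 - ip (b z) (b w))^-1)].

End RKHS.

(* Main.v *)
Require Import Defs.
From HB Require Import structures.
From mathcomp Require Import all_boot all_order all_algebra.
From mathcomp Require Import complex ring lra zify.
From mathcomp Require Import spectral sesquilinear.
From mathcomp Require Import boolp classical_sets reals.
From mathcomp Require sequences exp.
Set Implicit Arguments. Unset Strict Implicit. Unset Printing Implicit Defensive.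
Import Order.TTheory GRing.Theory Num.Theory.
Local Open Scope ring_scope.

(** The Fock space inequality is the core. Pairing each product of [phi e] and [f e'] with the
    reversal of the product of [phi e'] and [f e] proves it up to an error [|A'|^2], where [A'] is
    the part of [sum_e L_(f e)^* (phi e)] off the empty word. To absorb the error, add
    [k * sum_e |phi e|^2] to the difference of the two sides. At the pair formed by [phi] and the
    left multiples of [A'] by the [f e], the resulting sesquilinear form is at least [k * |A'|^2],
    by a commutation identity. If the form is nonnegative, Cauchy-Schwarz then bounds [|A'|^2] by
    its value at [phi]; this gives coercivity, hence room to decrease [k], down to [0]. The identity
    needs the [f e] to be symmetric, which combinations of kernels are. The [phi e] come from a
    transfer function and are not symmetric, so the full Fock space is required. All identities are
    stated for finitely supported functions and sums over words of bounded length; the transfer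
    function is truncated only at the end. *)

(** Necessity. A gliding hump argument makes the interpolation constant uniform
    over all sequences bounded by 1. Signs can be chosen so that the squared
    norm of a signed sum of vectors is at least, or at most, the sum of the
    squared norms. Inserting such signs gives a lower Riesz bound for the
    normalized kernels of l, hence all separation conditions, and a Bessel bound
    for the normalized kernels of s, which is dual to the Carleson condition.

    Sufficiency. The Carleson condition bounds the number of points near a given
    one, and the far points are killed by a product of contractive multipliers;
    so the weak separation conditions give a uniform strong separation. Together
    with the Carleson condition, this is a bound for a column of multipliers. A
    column-row inequality with constant one turns it into a lower Riesz bound
    for the normalized kernels of l. That inequality is reduced, through a
    realization on the full Fock space, to
      |sum_e L_(phi e)^* (f e)|^2 <= sum_(e, e') |phi e (x) f e'|^2
    for symmetric [f e]. The Riesz and Carleson bounds give the positivity of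
    the Pick matrices of the interpolation problem; by the complete Pick
    property of s, a solution extends to one more point by a Hahn-Banach step,
    and to all of X by Zorn's lemma. *)

(** * Positive semi-definite forms on finite sets *)

Section FinitePSD.
Variable C : numClosedFieldType.

Lemma sum_delta (I : finType) (i : I) (F : I -> C) :
  \sum_k (k == i)%:R * F k = F i.
Proof.
rewrite (bigD1 i) //= eqxx mul1r big1 ?addr0 // => k /negPf ->.
by rewrite mul0r.
Qed.

Lemma psd2_det (x z w : C) :
  (forall a b : C, 0 <= a * a^* * x + a * b^* * w + a^* * b * w^* + b * b^* * z) ->
  w * w^* <= x * z.
Proof.
move=> h.
have x0 : 0 <= x by have := h 1 0; rewrite !(conjC1, conjC0); rewrite !(mul1r, mul0r, mulr0, addr0).
have z0 : 0 <= z by have := h 0 1; rewrite !(conjC1, conjC0); rewrite !(mul1r, mul0r, mulr0, add0r).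
have zr : z^* = z by apply/CrealP; exact: ger0_real.
case: (eqVneq z 0) => [z00|zn0].
  have w0 : w = 0.
    apply/eqP; apply/negP => /negP wn0.
    have nw : w * w^* \is a GRing.unit by rewrite unitfE mulf_neq0 ?conjC_eq0.
    have ww0 : 0 < w * w^* by rewrite lt0r mul_conjC_ge0 mulf_neq0 ?conjC_eq0.
    (* Large enough to make the form negative: with [z = 0] its value at [(1, - (t * w))] is
       [- x - 2]. *)
    pose t := (x + 1) / (w * w^*).
    have t0 : 0 <= t by rewrite divr_ge0 ?addr_ge0 ?ler01 // ltW.
    have tr : t^* = t by apply/CrealP; exact: ger0_real.
    have := h 1 (- (t * w)).
    rewrite conjC1 rmorphN rmorphM /= tr z00 !(mulr0, addr0, mul1r).
    have -> : x + - (t * w^*) * w + - (t * w) * w^* = - x - 2.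
      have -> : x + - (t * w^*) * w + - (t * w) * w^* = x - t * (w * w^*) *+ 2 by ring.
      by rewrite /t mulrVK //; ring.
    move=> h1; have : 0 <= - x - 2 + x by rewrite addr_ge0.
    have -> : - x - 2 + x = - (2 : C) by ring.
    by rewrite oppr_ge0 lt_geF ?ltr0n.
  by rewrite w0 mul0r mulr_ge0.
have zp : 0 < z by rewrite lt0r zn0.
have := h z (- w); rewrite zr rmorphN /=.
have -> : z * z * x + z * - w^* * w + z * - w * w^* + - w * - w^* * z = z * (x * z - w * w^*) by ring.
by rewrite pmulr_rge0 // subr_ge0.
Qed.

Definition psd (I : finType) (K : I -> I -> C) :=
  forall c : I -> C, 0 <= \sum_i \sum_j (c i)^* * c j * K i j.

Lemma psd_pair (I : finType) (K : I -> I -> C) i j (a b : C) : psd K ->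
  0 <= a * a^* * K i i + a^* * b * K i j + b^* * a * K j i + b * b^* * K j j.
Proof.
move=> /(_ (fun k => (k == i)%:R * a + (k == j)%:R * b)).
congr (0 <= _).
transitivity (\sum_k ((k == i)%:R * a + (k == j)%:R * b)^* * (a * K k i + b * K k j)).
  apply: eq_bigr => k _.
  transitivity (\sum_l (((l == i)%:R * ((((k == i)%:R * a + (k == j)%:R * b)^*) * a * K k l))
     + ((l == j)%:R * ((((k == i)%:R * a + (k == j)%:R * b)^*) * b * K k l)))).
    by apply: eq_bigr => l _; ring.
  by rewrite big_split /= !sum_delta; ring.
transitivity (\sum_k ((k == i)%:R * (a^* * (a * K k i + b * K k j)) +
    (k == j)%:R * (b^* * (a * K k i + b * K k j)))).
  by apply: eq_bigr => k _; rewrite rmorphD !rmorphM /= !conjC_nat; ring.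
by rewrite big_split /= !sum_delta; ring.
Qed.

Lemma psd_diag_ge0 (I : finType) (K : I -> I -> C) i : psd K -> 0 <= K i i.
Proof.
move=> /(psd_pair i i 1 0); rewrite !(conjC1, conjC0).
by rewrite !(mul1r, mul0r, mulr0, addr0).
Qed.

(** [psd] speaks of nonnegative values only; over complex scalars, the form being real at [(1, 1)]
    and [(1, 'i)] forces Hermitian symmetry. *)
Lemma psd_herm (I : finType) (K : I -> I -> C) i j : psd K -> K j i = (K i j)^*.
Proof.
move=> pK.
have ri : (K i i)^* = K i i by apply/CrealP/ger0_real/psd_diag_ge0.
have rj : (K j j)^* = K j j by apply/CrealP/ger0_real/psd_diag_ge0.
have h1 := psd_pair i j 1 1 pK; have h2 := psd_pair i j 1 'i pK.
move: h1 h2 => /ger0_real /CrealP h1 /ger0_real /CrealP h2.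
move: h1 h2; rewrite !rmorphD !rmorphM /= !conjCK !conjC1 ri rj !conjCi.
rewrite !(mul1r, mulr1) => h1 h2.
have e1 : (K i j)^* + (K j i)^* = K i j + K j i.
  by apply: (addrI (K i i)); apply: (addIr (K j j)); rewrite !addrA.
have e2 : (K i j)^* - (K j i)^* = K j i - K i j.
  have : - 'i * ((K i j)^* - (K j i)^*) = - 'i * (K j i - K i j) :> C.
    apply: (addrI (K i i)); apply: (addIr (- 'i * 'i * K j j)).
    move: h2; set A := (K i j)^*; set B := (K j i)^* => h2.
    transitivity (K i i + - 'i * A + 'i * B + - 'i * 'i * K j j); first by ring.
    rewrite h2; ring.
  by move/mulfI; apply; rewrite oppr_eq0 neq0Ci.
have : (K i j)^* *+ 2 = K j i *+ 2.
  have -> : (K i j)^* *+ 2 = ((K i j)^* + (K j i)^*) + ((K i j)^* - (K j i)^*) by ring.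
  by rewrite e1 e2; ring.
by move/eqP; rewrite eqrMn2r /= => /eqP ->.
Qed.

Lemma gram_psd (I J : finType) (v : I -> J -> C) :
  psd (fun i j => \sum_r v i r * (v j r)^*).
Proof.
move=> c.
have -> : \sum_i \sum_j (c i)^* * c j * (\sum_r v i r * (v j r)^*) =
   \sum_r (\sum_i (c i)^* * v i r) * (\sum_i (c i)^* * v i r)^*.
  transitivity (\sum_i \sum_r \sum_j ((c i)^* * v i r) * (c j * (v j r)^*)).
    apply: eq_bigr => i _; rewrite exchange_big /=; apply: eq_bigr => j _.
    by rewrite mulr_sumr; apply: eq_bigr => r _; ring.
  rewrite exchange_big /=; apply: eq_bigr => r _.
  rewrite mulr_suml; apply: eq_bigr => i _.
  rewrite rmorph_sum mulr_sumr; apply: eq_bigr => j _.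
  by rewrite rmorphM /= conjCK.
by apply: sumr_ge0 => r _; rewrite mul_conjC_ge0.
Qed.

Local Open Scope sesquilinear_scope.

Lemma psd_spectral n (A : 'M[C]_n) : psd (fun i j => A i j) ->
  exists (U : 'M[C]_n) (d : 'rV[C]_n), [/\ U *m U^t* = 1%:M, U^t* *m U = 1%:M,
    A = U^t* *m diag_mx d *m U & forall i, 0 <= d 0 i].
Proof.
move=> pA; pose U := spectralmx A; pose d := spectral_diag A.
have hA : A \is hermsymmx.
  apply/is_hermitianmxP; rewrite expr0 scale1r; apply/matrixP => i j.
  by rewrite !mxE; exact: (psd_herm j i pA).
have uU : U \is unitarymx by exact: spectral_unitarymx.
have E : A = U^t* *m diag_mx d *m U.
  by rewrite -(invmx_unitary uU); exact/orthomx_spectralP/hermitian_normalmx.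
have UU : U *m U^t* = 1%:M by exact/unitarymxP.
have UU' : U^t* *m U = 1%:M by rewrite -(invmx_unitary uU) mulVmx ?unitarymx_unit.
exists U, d; split => // r.
have -> : d 0 r = (U *m A *m U^t*) r r.
  rewrite E !mulmxA UU mul1mx -[diag_mx d *m U *m _]mulmxA UU mulmx1.
  by rewrite mxE eqxx mulr1n.
have := pA (fun q => (U r q)^*).
congr (0 <= _); rewrite mxE exchange_big /=; apply: eq_bigr => j _.
rewrite !mxE mulr_suml; apply: eq_bigr => i _.
by rewrite conjCK; ring.
Qed.

Lemma reindex_enum_val (I : finType) (F : I -> C) :
  \sum_(i : I) F i = \sum_(p < #|I|) F (enum_val p).
Proof. by rewrite (reindex _ (onW_bij _ (enum_val_bij I))). Qed.

Lemma psd_enum (I : finType) (K : I -> I -> C) : psd K ->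
  psd (fun p q : 'I_#|I| => K (enum_val p) (enum_val q)).
Proof.
move=> pK c; have := pK (fun i => c (enum_rank i)); congr (0 <= _).
rewrite [LHS]reindex_enum_val; apply: eq_bigr => p _.
rewrite [LHS]reindex_enum_val; apply: eq_bigr => q _.
by rewrite !enum_valK.
Qed.

Lemma psd_gram (I : finType) (K : I -> I -> C) : psd K ->
  exists v : I -> I -> C, forall i j, K i j = \sum_r v i r * (v j r)^*.
Proof.
move=> pK; pose A := \matrix_(p < #|I|, q < #|I|) K (enum_val p) (enum_val q).
have [|U [d [_ _ E d0]]] := @psd_spectral _ A.
  move=> c; have := psd_enum pK c; congr (0 <= _).
  by apply: eq_bigr => p _; apply: eq_bigr => q _; rewrite mxE.
exists (fun i r => (U (enum_rank r) (enum_rank i))^* * sqrtC (d 0 (enum_rank r))) => i j.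
have := congr1 (fun M : 'M_(_) => M (enum_rank i) (enum_rank j)) E.
rewrite /= !mxE !enum_rankK => ->.
rewrite [RHS]reindex_enum_val; apply: eq_bigr => p _.
rewrite !enum_valK !mxE (bigD1 p) //= big1 ?addr0; last first.
  by move=> k kp; rewrite !mxE (negPf kp) mulr0n mulr0.
rewrite !mxE eqxx mulr1n rmorphM /= conjCK.
have /CrealP -> : sqrtC (d 0 p) \is Num.real by rewrite ger0_real // sqrtC_ge0.
rewrite -[in LHS](sqrtCK (d 0 p)); ring.
Qed.

(** Schur product theorem: a Gram factorization of [L] turns the form into a sum of forms of [K] at
    rescaled coefficients. *)
Lemma psdM (I : finType) (K L : I -> I -> C) :
  psd K -> psd L -> psd (fun i j => K i j * L i j).
Proof.
move=> pK /psd_gram[v Lv] c.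
have -> : \sum_i \sum_j (c i)^* * c j * (K i j * L i j) =
  \sum_r \sum_i \sum_j (c i * (v i r)^*)^* * (c j * (v j r)^*) * K i j.
  rewrite [RHS]exchange_big /=; apply: eq_bigr => i _.
  rewrite [RHS]exchange_big /=; apply: eq_bigr => j _.
  rewrite Lv mulr_sumr mulr_sumr; apply: eq_bigr => r _.
  by rewrite rmorphM /= conjCK; ring.
by apply: sumr_ge0 => r _; apply: pK.
Qed.

Lemma trmxC_mul m n p (A : 'M[C]_(m, n)) (B : 'M[C]_(n, p)) :
  (A *m B)^t* = B^t* *m A^t*.
Proof. by rewrite trmx_mul map_mxM. Qed.

Lemma mulmx_trC_eq0 m n (X : 'M[C]_(m, n)) : X *m X^t* = 0 -> X = 0.
Proof.
move=> h; apply/matrixP => i j; rewrite [RHS]mxE.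
have /eqP : (X *m X^t*) i i = 0 by rewrite h mxE.
rewrite mxE psumr_eq0; last by move=> k _; rewrite !mxE mul_conjC_ge0.
move=> /allP /(_ j); rewrite mem_index_enum => /(_ isT) /=.
by rewrite !mxE mul_conjC_eq0 => /eqP.
Qed.

(** The partial isometry is [V = D^* K^+ R], with [K^+] the pseudo-inverse of the common Gram
    matrix. [V^* V] is a projection and [W] the complementary one, so that contractivity is recorded
    as an identity. *)
Lemma gram_contraction_mx n a b (D : 'M[C]_(n, a)) (R : 'M[C]_(n, b)) :
  D *m D^t* = R *m R^t* ->
  exists2 V : 'M[C]_(a, b), D *m V = R &
    exists W : 'M[C]_b, V^t* *m V + W^t* *m W = 1%:M.
Proof.
move=> DR; set K := D *m D^t* in DR.
have [|U [d [UU UU' E d0]]] := @psd_spectral _ K.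
  move=> c; have := @gram_psd _ _ (fun i r => D i r) c.
  congr (0 <= _); apply: eq_bigr => i _; apply: eq_bigr => j _.
  by rewrite !mxE; congr (_ * _); apply: eq_bigr => r _; rewrite !mxE.
(* As [0^-1 = 0], this inverts the nonzero eigenvalues only, and [Kp] is the pseudo-inverse of
   [K]. *)
pose e : 'rV[C]_n := \row_i (d 0 i)^-1.
pose Kp := U^t* *m diag_mx e *m U.
have dr i : (d 0 i)^* = d 0 i by apply/CrealP/ger0_real.
have Kph : Kp^t* = Kp.
  rewrite /Kp !trmxC_mul trmxCK mulmxA; congr (_ *m _ *m _).
  apply/matrixP => i j; rewrite !mxE eq_sym; case: eqP => [->|] //.
  - by rewrite !mulr1n fmorphV /= dr.
  - by rewrite !mulr0n conjC0.
have UC (X Y : 'M[C]_n) : (U^t* *m X *m U) *m (U^t* *m Y *m U) = U^t* *m (X *m Y) *m U.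
  by rewrite !mulmxA -[_ *m U *m U^t*]mulmxA UU mulmx1.
have KKpK : K *m Kp *m K = K.
  rewrite E /Kp !UC; congr (_ *m _ *m _).
  apply/matrixP => i j; rewrite !mulmx_diag !mxE.
  case: eqP => [->|]; last by rewrite !mulr0n.
  rewrite !mulr1n; case: (eqVneq (d 0 j) 0) => [->|dj]; first by rewrite !mulr0.
  by rewrite divff // mul1r.
have KpKKp : Kp *m K *m Kp = Kp.
  rewrite E /Kp !UC; congr (_ *m _ *m _).
  apply/matrixP => i j; rewrite !mulmx_diag !mxE.
  case: eqP => [->|]; last by rewrite !mulr0n.
  rewrite !mulr1n; case: (eqVneq (d 0 j) 0) => [->|dj]; first by rewrite invr0 !mulr0.
  by rewrite mulVf // mul1r.
have KE : D *m D^t* = K by [].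
clearbody Kp K.
pose V := D^t* *m (Kp *m R).
have DV : D *m V = R.
  apply/eqP; rewrite -subr_eq0; apply/eqP; apply: mulmx_trC_eq0.
  have -> : D *m V - R = (K *m Kp - 1%:M) *m R by rewrite mulmxBl mul1mx /V !mulmxA KE.
  rewrite trmxC_mul mulmxA -[_ *m R *m _]mulmxA -DR mulmxBl mul1mx KKpK subrr.
  by rewrite mul0mx.
exists V => //; pose Q := V^t* *m V; exists (1%:M - Q).
have QE : Q = R^t* *m (Kp *m R).
  rewrite /Q /V 2!trmxC_mul trmxCK Kph -!mulmxA; congr (_ *m _).
  by rewrite [D *m (D^t* *m _)]mulmxA KE !mulmxA KpKKp.
have QQ : Q *m Q = Q.
  rewrite QE -!mulmxA; congr (_ *m _).
  by rewrite [R *m (R^t* *m _)]mulmxA -DR !mulmxA KpKKp.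
have Qh : Q^t* = Q by rewrite /Q trmxC_mul trmxCK.
have -> : (1%:M - Q)^t* = 1%:M - Q.
  rewrite -[in RHS]Qh; apply/matrixP => i j; rewrite !mxE rmorphB /= eq_sym.
  by rewrite conjC_nat.
rewrite mulmxBl mul1mx mulmxBr mulmx1 QQ subrr subr0.
by rewrite -/Q addrC subrK.
Qed.

Lemma gram_contraction (P A B : finType) (D : P -> A -> C) (R : P -> B -> C) :
  (forall p q, \sum_a D p a * (D q a)^* = \sum_b R p b * (R q b)^*) ->
  exists2 V : A -> B -> C, (forall p b, \sum_a D p a * V a b = R p b) &
    forall x : B -> C, \sum_a (\sum_b V a b * x b) * (\sum_b V a b * x b)^*
       <= \sum_b x b * (x b)^*.
Proof.
move=> h.
pose D' := \matrix_(p < #|P|, a < #|A|) D (enum_val p) (enum_val a).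
pose R' := \matrix_(p < #|P|, b < #|B|) R (enum_val p) (enum_val b).
have [|V DV [W VW]] := @gram_contraction_mx _ _ _ D' R'.
  apply/matrixP => p q; rewrite !mxE.
  have := h (enum_val p) (enum_val q).
  rewrite [LHS]reindex_enum_val [RHS]reindex_enum_val => e.
  transitivity (\sum_(a < #|A|) D (enum_val p) (enum_val a) * (D (enum_val q) (enum_val a))^*).
    by apply: eq_bigr => a _; rewrite !mxE.
  by rewrite e; apply: eq_bigr => a _; rewrite !mxE.
exists (fun a b => V (enum_rank a) (enum_rank b)).
  move=> p b; have := congr1 (fun M : 'M_(_,_) => M (enum_rank p) (enum_rank b)) DV.
  rewrite /= !mxE !enum_rankK => <-; rewrite [LHS]reindex_enum_val.
  by apply: eq_bigr => a _; rewrite !mxE enum_valK enum_rankK.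
move=> x; pose x' := \col_(b < #|B|) x (enum_val b).
have nrm k (Y : 'M[C]_(k, #|B|)) : (x'^t* *m (Y^t* *m Y) *m x') 0 0 =
    \sum_a (\sum_b Y a b * x' b 0) * (\sum_b Y a b * x' b 0)^*.
  rewrite mulmxA -mulmxA -trmxC_mul mxE; apply: eq_bigr => a _.
  by rewrite !mxE mulrC.
have := congr1 (fun M : 'M_(_) => (x'^t* *m M *m x') 0 0) VW.
rewrite /= mulmxDr mulmxDl mxE !nrm mulmx1 => e.
have -> : \sum_b x b * (x b)^* = (x'^t* *m x') 0 0.
  by rewrite mxE [LHS]reindex_enum_val; apply: eq_bigr => b _; rewrite !mxE mulrC.
rewrite -e.
have -> : \sum_a (\sum_b V (enum_rank a) (enum_rank b) * x b) *
   (\sum_b V (enum_rank a) (enum_rank b) * x b)^* =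
   \sum_a (\sum_b V a b * x' b 0) * (\sum_b V a b * x' b 0)^*.
  rewrite [LHS]reindex_enum_val; apply: eq_bigr => a _.
  have -> : \sum_b V (enum_rank (enum_val a)) (enum_rank b) * x b = \sum_b V a b * x' b 0.
    by rewrite [LHS]reindex_enum_val; apply: eq_bigr => b _; rewrite !enum_valK mxE.
  by [].
by rewrite lerDl; apply: sumr_ge0 => a _; rewrite mul_conjC_ge0.
Qed.

End FinitePSD.

(** * The full Fock space, indexed by words *)

Section Words.
Variables (C : numClosedFieldType) (I : finType).
Local Notation W := (seq I).
Implicit Types (F G : W -> C) (N n m : nat).

(* The sum of [F] over the words of length at most [N]. *)
Fixpoint wsum N F : C :=
  if N is N'.+1 then F [::] + \sum_i wsum N' (fun w => F (i :: w)) else F [::].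

Lemma eq_SW_in N F G : (forall w, (size w <= N)%N -> F w = G w) -> wsum N F = wsum N G.
Proof.
elim: N F G => [|N IH] F G h /=; first exact: h.
rewrite h //; congr (_ + _); apply: eq_bigr => i _; apply: IH => w hw.
exact: h.
Qed.

Lemma eq_SW N F G : F =1 G -> wsum N F = wsum N G.
Proof. by move=> h; apply: eq_SW_in => w _. Qed.

Lemma SWD N F G : wsum N (fun w => F w + G w) = wsum N F + wsum N G.
Proof.
elim: N F G => //= N IH F G.
under eq_bigr do rewrite IH.
by rewrite big_split /=; ring.
Qed.

Lemma SWZl N (a : C) F : wsum N (fun w => a * F w) = a * wsum N F.
Proof.
elim: N F => //= N IH F.
under eq_bigr do rewrite IH.
by rewrite -mulr_sumr mulrDr.
Qed.

Lemma SWZr N (a : C) F : wsum N (fun w => F w * a) = wsum N F * a.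
Proof. by rewrite mulrC -SWZl; apply: eq_SW => w; rewrite mulrC. Qed.

Lemma SW0 N : wsum N (fun=> 0) = 0.
Proof. by elim: N => //= N ->; rewrite big1 ?addr0. Qed.

Lemma SWN N F : wsum N (fun w => - F w) = - wsum N F.
Proof. by rewrite -mulN1r -SWZl; apply: eq_SW => w; rewrite mulN1r. Qed.

Lemma SWB N F G : wsum N (fun w => F w - G w) = wsum N F - wsum N G.
Proof. by rewrite SWD SWN. Qed.

Lemma SW_sum N (J : finType) (F : J -> W -> C) :
  wsum N (fun w => \sum_j F j w) = \sum_j wsum N (F j).
Proof.
elim: N F => //= N IH F.
have -> : \sum_i wsum N (fun w => \sum_j F j (i :: w)) =
    \sum_i \sum_j wsum N (fun w => F j (i :: w)).
  by apply: eq_bigr => i _; rewrite -(IH (fun j w => F j (i :: w))).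
by rewrite exchange_big -big_split.
Qed.

Lemma SW_exch N M (F : W -> W -> C) :
  wsum N (fun v => wsum M (F v)) = wsum M (fun w => wsum N (fun v => F v w)).
Proof.
elim: N F => //= N IH F.
under eq_bigr do rewrite IH.
by rewrite SWD SW_sum.
Qed.

Lemma SW_conj N F : (wsum N F)^* = wsum N (fun w => (F w)^*).
Proof.
elim: N F => //= N IH F; rewrite rmorphD rmorph_sum /=.
by congr (_ + _); apply: eq_bigr => i _; rewrite IH.
Qed.

Lemma SW_ge0 N F : (forall w, 0 <= F w) -> 0 <= wsum N F.
Proof.
elim: N F => //= N IH F h; rewrite addr_ge0 //; apply: sumr_ge0 => i _.
by apply: IH => w.
Qed.

Lemma SW_le N F G : (forall w, F w <= G w) -> wsum N F <= wsum N G.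
Proof.
by move=> h; rewrite -subr_ge0 -SWB; apply: SW_ge0 => w; rewrite subr_ge0.
Qed.

Definition wsupp n F := forall w, (n < size w)%N -> F w = 0.

Lemma SW_supp n N F : wsupp n F -> (n <= N)%N -> wsum N F = wsum n F.
Proof.
elim: n N F => [|n IH] [|N] F h //= le_n.
  rewrite big1 ?addr0 // => i _; rewrite (@eq_SW _ _ (fun=> 0)) ?SW0 // => w.
  exact: h.
by congr (_ + _); apply: eq_bigr => i _; apply: IH => // w hw; apply: h.
Qed.

Lemma SW_rcons N F : wsum N.+1 F = F [::] + \sum_i wsum N (fun w => F (rcons w i)).
Proof.
elim: N F => [//|N IH] F.
have -> : wsum N.+2 F = F [::] + \sum_i wsum N.+1 (fun w => F (i :: w)) by [].
congr (_ + _); under eq_bigr do rewrite IH; rewrite /= !big_split /=.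
by congr (_ + _); rewrite exchange_big.
Qed.

Lemma SW_rev N F : wsum N (fun w => F (rev w)) = wsum N F.
Proof.
elim: N F => [//|N IH] F; rewrite SW_rcons /=; congr (_ + _).
apply: eq_bigr => i _; rewrite -(IH (fun w => F (i :: w))); apply: eq_SW => w.
by rewrite rev_rcons.
Qed.

Lemma SW_delta N F (F1 : C) : F [::] = F1 -> (forall w, w != [::] -> F w = 0) -> wsum N F = F1.
Proof.
move=> <- h; rewrite (@SW_supp 0) // => w; case: w => // i w _; exact: h.
Qed.

(* The sum of [F v w] over the factorizations [z = v ++ w]. *)
Fixpoint wsplit (F : W -> W -> C) (z : W) : C :=
  if z is i :: z' then F [::] z + wsplit (fun v w => F (i :: v) w) z' else F [::] [::].

Lemma eq_spl (F G : W -> W -> C) z :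
  (forall v w, v ++ w = z -> F v w = G v w) -> wsplit F z = wsplit G z.
Proof.
elim: z F G => [|i z IH] F G h /=; first exact: h.
by rewrite h //; congr (_ + _); apply: IH => v w E; apply: h; rewrite /= E.
Qed.

Lemma splD (F G : W -> W -> C) z :
  wsplit (fun v w => F v w + G v w) z = wsplit F z + wsplit G z.
Proof.
by elim: z F G => //= i z IH F G; rewrite IH; ring.
Qed.

Lemma splZ (a : C) (F : W -> W -> C) z :
  wsplit (fun v w => a * F v w) z = a * wsplit F z.
Proof. by elim: z F => //= i z IH F; rewrite IH mulrDr. Qed.

Lemma spl0 z : wsplit (fun _ _ => 0) z = 0.
Proof. by elim: z => //= i z ->; rewrite addr0. Qed.

Lemma spl_conj (F : W -> W -> C) z : (wsplit F z)^* = wsplit (fun v w => (F v w)^*) z.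
Proof. by elim: z F => //= i z IH F; rewrite rmorphD /= IH. Qed.

Lemma spl_SW N (F : W -> W -> W -> C) z :
  wsum N (fun x => wsplit (F x) z) = wsplit (fun v w => wsum N (fun x => F x v w)) z.
Proof. by elim: z F => //= i z IH F; rewrite SWD IH. Qed.

Lemma spl_sum (J : finType) (F : J -> W -> W -> C) z :
  \sum_j wsplit (F j) z = wsplit (fun v w => \sum_j F j v w) z.
Proof. by elim: z F => //= i z IH F; rewrite big_split /= IH. Qed.

(** The cut falls in [x] or in [w]; the one between them is counted twice, hence the subtraction. *)
Lemma spl_cat (F : W -> W -> C) x w :
  wsplit F (x ++ w) = wsplit (fun a b => F a (b ++ w)) x
    + wsplit (fun a b => F (x ++ a) b) w - F x w.
Proof.
elim: x F => [|i x IH] F /=; first by rewrite addrAC subrr add0r.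
by rewrite IH; ring.
Qed.

Lemma spl_rev (F : W -> W -> C) z :
  wsplit F (rev z) = wsplit (fun a b => F (rev b) (rev a)) z.
Proof.
elim: z F => [//|i z IH] F; rewrite rev_cons -cats1 spl_cat /= cats0.
have e (a b c : C) : a + (b + c) - b = c + a by ring.
rewrite e IH cats1 rev_cons; congr (_ + _).
by apply: eq_spl => a b _; rewrite rev_cons cats1.
Qed.

Lemma SW_spl_sub N (F : W -> W -> C) :
  wsum N (wsplit F) = wsum N (fun v => wsum (N - size v) (F v)).
Proof.
elim: N F => [//|N IH] F.
have -> : wsum N.+1 (wsplit F) = wsum N.+1 (F [::]) + \sum_i wsum N (wsplit (fun v w => F (i :: v) w)).
  by rewrite /=; under eq_bigr do rewrite SWD; rewrite big_split addrA.
rewrite [RHS]/=; congr (_ + _).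
by apply: eq_bigr => i _; rewrite IH.
Qed.

Lemma SW_spl N (F : W -> W -> C) :
  (forall v w, (N < size v + size w)%N -> F v w = 0) ->
  wsum N (wsplit F) = wsum N (fun v => wsum N (F v)).
Proof.
move=> h; rewrite SW_spl_sub; apply: eq_SW_in => v hv.
apply/esym/SW_supp; last exact: leq_subr.
by move=> w hw; apply: h; rewrite -ltn_subLR.
Qed.

Definition wconv (F G : W -> C) : W -> C := wsplit (fun v w => F v * G w).

Lemma cv_nil F G : wconv F G [::] = F [::] * G [::]. Proof. by []. Qed.

Lemma cv_cons F G i z :
  wconv F G (i :: z) = F [::] * G (i :: z) + wconv (fun w => F (i :: w)) G z.
Proof. by []. Qed.

Lemma cvDl F F' G z : wconv (fun w => F w + F' w) G z = wconv F G z + wconv F' G z.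
Proof. by rewrite -splD; apply: eq_spl => v w _; rewrite mulrDl. Qed.

Lemma cvZl a F G z : wconv (fun w => a * F w) G z = a * wconv F G z.
Proof. by rewrite -splZ; apply: eq_spl => v w _; rewrite mulrA. Qed.

Lemma cv_rev F G z : wconv F G (rev z) = wconv (fun w => G (rev w)) (fun w => F (rev w)) z.
Proof. by rewrite /wconv spl_rev; apply: eq_spl => a b _; rewrite mulrC. Qed.

Lemma sup_cv n m F G : wsupp n F -> wsupp m G -> wsupp (n + m) (wconv F G).
Proof.
move=> hF hG z hz; rewrite -[RHS](spl0 z).
apply: eq_spl => v w E; have [hv|hv] := ltnP n (size v); first by rewrite hF // mul0r.
rewrite (hG w) ?mulr0 //; move: hz; rewrite -E size_cat => hz.
by rewrite -(ltn_add2l n) (leq_trans hz) // leq_add2r.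
Qed.

Local Notation nsq z := (z * z^*).

Lemma nsqD_le (x y : C) : nsq (x + y) <= 2 * nsq x + 2 * nsq y.
Proof.
rewrite -subr_ge0.
have -> : 2 * nsq x + 2 * nsq y - nsq (x + y) = nsq (x - y).
  by rewrite !(rmorphD, rmorphN) /=; ring.
exact: mul_conjC_ge0.
Qed.

Lemma nsq_sum_le (J : finType) (x : J -> C) :
  nsq (\sum_j x j) <= #|J|%:R * \sum_j nsq (x j).
Proof.
have -> : nsq (\sum_j x j) = \sum_j \sum_k x j * (x k)^*.
  by rewrite rmorph_sum mulr_suml; apply: eq_bigr => j _; rewrite mulr_sumr.
have h j k : x j * (x k)^* + x k * (x j)^* <= nsq (x j) + nsq (x k).
  rewrite -subr_ge0.
  have -> : nsq (x j) + nsq (x k) - (x j * (x k)^* + x k * (x j)^*) = nsq (x j - x k).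
    by rewrite !(rmorphD, rmorphN) /=; ring.
  exact: mul_conjC_ge0.
rewrite -(ler_pM2l (ltr0n _ 2)) mulr_natl mulr2n {2}exchange_big -big_split /=.
have -> : 2%:R * (#|J|%:R * \sum_j nsq (x j)) = \sum_j \sum_k (nsq (x j) + nsq (x k)).
  rewrite [RHS](eq_bigr (fun j => nsq (x j) *+ #|J| + \sum_k nsq (x k))); last first.
    by move=> j _; rewrite big_split /= sumr_const.
  rewrite big_split /= sumr_const sumrMnl -[X in _ = X + _]mulr_natl -[X in _ = _ + X]mulr_natl.
  by ring.
apply: ler_sum => j _; rewrite -big_split; apply: ler_sum => k _; exact: h.
Qed.

(** Values of the product on words of length at most [N] only involve values of [G] on such words,
    so [c] need not depend on [N]. The induction strips the first letter of the words on which [F]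
    is supported. *)
Lemma cv_left_bound m F : wsupp m F -> exists2 c : C, 0 <= c &
  forall N G, wsum N (fun z => nsq (wconv F G z)) <= c * wsum N (fun z => nsq (G z)).
Proof.
elim: m F => [|m IH] F hF.
  exists (nsq (F [::])) => [|N G]; first exact: mul_conjC_ge0.
  rewrite le_eqVlt -SWZl; apply/orP; left; apply/eqP/eq_SW => z.
  have -> : wconv F G z = F [::] * G z.
    case: z => // i z; rewrite cv_cons.
    rewrite -[RHS]addr0; congr (_ + _); rewrite /wconv.
    rewrite -[RHS](spl0 z); apply: eq_spl => v w _.
    by rewrite hF // mul0r.
  by rewrite rmorphM /=; ring.
have h i : exists c : C, 0 <= c /\
   forall N G, wsum N (fun z => nsq (wconv (fun w => F (i :: w)) G z)) <= c * wsum N (fun z => nsq (G z)).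
  by have [|c c0 hc] := IH (fun w => F (i :: w)); [move=> w hw; exact: hF|exists c].
have [c hc] := boolp.choice h.
exists (2 * nsq (F [::]) + 2 * \sum_i c i).
  apply: addr_ge0; apply: mulr_ge0; rewrite ?ler0n ?mul_conjC_ge0 //.
  by apply: sumr_ge0 => i _; case: (hc i).
move=> N G.
have S0 : 0 <= wsum N (fun z => nsq (G z)) by apply: SW_ge0 => w; exact: mul_conjC_ge0.
case: N S0 => [|N] S0 /=.
  rewrite cv_nil rmorphM /= -subr_ge0.
  have -> : (2 * nsq (F [::]) + 2 * (\sum_i c i)) * nsq (G [::]) - F [::] * G [::] * ((F [::])^* * (G [::])^*)
    = (nsq (F [::]) + 2 * \sum_i c i) * nsq (G [::]) by ring.
  rewrite mulr_ge0 ?mul_conjC_ge0 // addr_ge0 ?mul_conjC_ge0 // mulr_ge0 ?ler0n //.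
  by apply: sumr_ge0 => i _; case: (hc i).
have le1 : \sum_i wsum N (fun w => nsq (wconv F G (i :: w))) <=
    2 * nsq (F [::]) * (\sum_i wsum N (fun w => nsq (G (i :: w))))
    + 2 * (\sum_i c i) * wsum N (fun z => nsq (G z)).
  rewrite -mulrA mulr_sumr -[2 * (\sum_i c i) * _]mulrA mulr_suml mulr_sumr mulr_sumr.
  rewrite -big_split /=; apply: ler_sum => i _.
  have [c0 hi] := hc i.
  apply: (@le_trans _ _ (wsum N (fun w => 2 * nsq (F [::] * G (i :: w)) + 2 * nsq (wconv (fun w => F (i :: w)) G w)))).
    by apply: SW_le => w; rewrite cv_cons; exact: nsqD_le.
  rewrite SWD; apply: lerD; last by rewrite SWZl ler_pM2l ?ltr0n.
  by rewrite SWZl -SWZl -!SWZl le_eqVlt; apply/orP; left; apply/eqP/eq_SW => w; rewrite rmorphM /=; ring.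
have le2 : wsum N (fun z => nsq (G z)) <= nsq (G [::]) + \sum_i wsum N (fun w => nsq (G (i :: w))).
  have -> : nsq (G [::]) + \sum_i wsum N (fun w => nsq (G (i :: w))) = wsum N.+1 (fun z => nsq (G z)) by [].
  have : forall H : W -> C, (forall w, 0 <= H w) -> wsum N H <= wsum N.+1 H.
    elim: (N) => [|N' IH'] H H0; first by rewrite /= lerDl sumr_ge0.
    rewrite [wsum N'.+1 H]/= [wsum N'.+2 H]/= lerD2l; apply: ler_sum => i _.
    by apply: IH' => w.
  by apply => w; exact: mul_conjC_ge0.
rewrite cv_nil rmorphM /=.
apply: le_trans (lerD (lexx _) le1) _.
have c0 : 0 <= \sum_i c i by apply: sumr_ge0 => i _; case: (hc i).
apply: le_trans (lerD (lexx _) (lerD (lexx _) (ler_wpM2l _ le2))) _.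
  by rewrite mulr_ge0 ?ler0n.
rewrite -subr_ge0; set X := \sum_i wsum _ _.
have -> : (2 * (F [::] * (F [::])^*) + 2 * (\sum_i c i)) * (G [::] * (G [::])^* + X) -
  (F [::] * G [::] * ((F [::])^* * (G [::])^*) + (2 * (F [::] * (F [::])^*) * X + 2 * (\sum_i c i) * (G [::] * (G [::])^* + X)))
  = nsq (F [::]) * nsq (G [::]) by ring.
by rewrite mulr_ge0 ?mul_conjC_ge0.
Qed.

Lemma cv_right_bound m F : wsupp m F -> exists2 c : C, 0 <= c &
  forall N G, wsum N (fun z => nsq (wconv G F z)) <= c * wsum N (fun z => nsq (G z)).
Proof.
move=> hF; have [|c c0 h] := @cv_left_bound m (fun w => F (rev w)).
  by move=> w hw; apply: hF; rewrite size_rev.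
exists c => // N G; have := h N (fun w => G (rev w)).
rewrite (SW_rev N (fun z => nsq (G z))) => /(le_trans _); apply.
rewrite -SW_rev le_eqVlt; apply/orP; left; apply/eqP/eq_SW => z.
by rewrite cv_rev.
Qed.

End Words.

(** * Commutation identities for multiplication by symmetric vectors *)

Section Fock.
Variables (C : numClosedFieldType) (I E : finType).
Local Notation W := (seq I).
Local Notation nsq z := (z * z^*).

Lemma spl_mull (g : W -> C) (F : W -> W -> C) z :
  g z * wsplit F z = wsplit (fun a b => g (a ++ b) * F a b) z.
Proof. by rewrite -splZ; apply: eq_spl => a b ->. Qed.

Lemma SW_spl_pull N (g : W -> C) (F : W -> W -> W -> C) x :
  wsum N (fun w => g w * wsplit (F w) x) = wsplit (fun a b => wsum N (fun w => g w * F w a b)) x.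
Proof. by rewrite -spl_SW; apply: eq_SW => w; rewrite splZ. Qed.

Lemma SW_SW_pull N M (g : W -> C) (F : W -> W -> C) :
  wsum N (fun w => g w * wsum M (F w)) = wsum M (fun u => wsum N (fun w => g w * F w u)).
Proof. by rewrite -SW_exch; apply: eq_SW => w; rewrite SWZl. Qed.

Variables (f : E -> W -> C) (m : nat).
Hypothesis fsup : forall e, wsupp m (f e).
Hypothesis fsym : forall e u v, perm_eq u v -> f e u = f e v.

Lemma f_catC e u v : f e (u ++ v) = f e (v ++ u).
Proof. by apply: fsym; rewrite perm_catC. Qed.

Lemma f_catCA e u v w : f e (u ++ v ++ w) = f e (v ++ u ++ w).
Proof. by apply: fsym; rewrite perm_catCA. Qed.

Lemma f_rev e u : f e (rev u) = f e u.
Proof. by apply: fsym; rewrite perm_rev. Qed.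

Section Depth.
Variable N : nat.

Definition wdot (F G : W -> C) := wsum N (fun w => F w * (G w)^*).

Lemma ip_ge0 F : 0 <= wdot F F.
Proof. by apply: SW_ge0 => w; exact: mul_conjC_ge0. Qed.

Lemma ipC F G : (wdot F G)^* = wdot G F.
Proof.
by rewrite /wdot SW_conj; apply: eq_SW => w; rewrite rmorphM /= conjCK mulrC.
Qed.

Lemma ip_expand a b (F G : W -> C) :
  wdot (fun w => a * F w + b * G w) (fun w => a * F w + b * G w) =
  a * a^* * wdot F F + a * b^* * wdot F G + a^* * b * (wdot F G)^* + b * b^* * wdot G G.
Proof.
rewrite ipC /wdot -!SWZl -!SWD; apply: eq_SW => w.
by rewrite rmorphD !rmorphM /=; ring.
Qed.

Lemma ip_amgm F G : wdot F G + wdot G F <= wdot F F + wdot G G.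
Proof.
rewrite -subr_ge0 (_ : _ - _ = wdot (fun w => F w - G w) (fun w => F w - G w)) ?ip_ge0 //.
rewrite /wdot -!SWD -SWB; apply: eq_SW => w; rewrite rmorphB /=; ring.
Qed.

Lemma ip_amgmN F G : - (wdot F F + wdot G G) <= wdot F G + wdot G F.
Proof.
rewrite -subr_ge0 (_ : _ - _ = wdot (fun w => F w + G w) (fun w => F w + G w)) ?ip_ge0 //.
rewrite opprK /wdot -!SWD; apply: eq_SW => w; rewrite rmorphD /=; ring.
Qed.

Definition mu x := \sum_e wsum N (fun w => (f e w)^* * f e (w ++ x)).

Lemma mu_nilC : (mu [::])^* = mu [::].
Proof.
rewrite /mu rmorph_sum; apply: eq_bigr => e _; rewrite /= SW_conj.
by apply: eq_SW => w; rewrite cats0 rmorphM /= conjCK mulrC.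
Qed.

(* [gram_op] is [sum_e R_e^* R_e], with [R_e] the right multiplication by [f e]
   (see [ip_cv]); since the [f e] are symmetric it is determined by its value
   [mu] at the empty word. *)
Definition gram_op (phi : W -> C) x := wsplit (fun a b => phi a * mu b) x
  + wsum N (fun w => (mu w)^* * phi (x ++ w)) - mu [::] * phi x.

Definition gram_opk k (phi : W -> C) x := gram_op phi x + k * phi x.

(** By [spl_cat], a cut of [phi] inside the [psi] part gives the convolution with [mu], a cut inside
    the [f e] part gives its adjoint, and the cut counted twice gives [mu [::]]. Symmetry of [f e]
    brings the shifts to the form of [mu]. The condition [n + m <= N] keeps all products inside the
    truncation. *)
Lemma ip_cv n (phi psi : W -> C) : (n + m <= N)%N -> wsupp n phi -> wsupp n psi ->
  \sum_e wdot (wconv phi (f e)) (wconv psi (f e)) = wdot (gram_op phi) psi.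
Proof.
move=> nmN hphi hpsi.
have step e : wdot (wconv phi (f e)) (wconv psi (f e)) =
  wsum N (fun v => (wsplit (fun a b => phi a * wsum N (fun w => (f e w)^* * f e (w ++ b))) v
   + wsum N (fun a => (wsum N (fun w => (f e w)^* * f e (w ++ a)))^* * phi (v ++ a))
   - wsum N (fun w => (f e w)^* * f e (w ++ [::])) * phi v) * (psi v)^*).
  transitivity (wsum N (wsplit (fun v w => wconv phi (f e) (v ++ w) * (psi v * f e w)^*))).
    by apply: eq_SW => z; rewrite [in (wconv psi _ z)^*]/wconv spl_conj spl_mull.
  rewrite SW_spl; last first.
    move=> v w hvw; have [hv|hv] := ltnP n (size v).
      by rewrite hpsi // mul0r conjC0 mulr0.
    by rewrite (@fsup e w) ?mulr0 ?conjC0 ?mulr0 //; lia.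
  apply: eq_SW => v.
  transitivity (wsum N (fun w => ((f e w)^* * wsplit (fun a b => phi a * f e (b ++ w)) v
     + wsplit (fun a b => (f e (a ++ b))^* * (phi (v ++ a) * f e b)) w
     - phi v * ((f e w)^* * f e w)) * (psi v)^*)).
    apply: eq_SW => w; rewrite /wconv spl_cat -(spl_mull (fun w => (f e w)^*)) rmorphM /=; ring.
  rewrite SWZr; congr (_ * _); rewrite SWB SWD; congr (_ + _ - _).
  - rewrite SW_spl_pull.
    apply: eq_spl => a b _; rewrite -SWZl; apply: eq_SW => w.
    by rewrite (f_catC e b w); ring.
  - rewrite SW_spl; last first.
      by move=> a b hab; rewrite fsup ?size_cat ?conjC0 ?mul0r //; lia.
    apply: eq_SW => a; rewrite SW_conj -SWZr; apply: eq_SW => b.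
    by rewrite rmorphM /= conjCK (f_catC e b a); ring.
  - by rewrite SWZl mulrC; congr (_ * _); apply: eq_SW => w; rewrite cats0.
rewrite (eq_bigr _ (fun e _ => step e)) -SW_sum; apply: eq_SW => v.
rewrite -mulr_suml; congr (_ * _); rewrite /gram_op !big_split /= sumrN -mulr_suml.
congr (_ + _ - _).
- rewrite spl_sum; apply: eq_spl => a b _; rewrite -mulr_sumr //.
- rewrite -SW_sum; apply: eq_SW => a; rewrite -mulr_suml; congr (_ * _).
  by rewrite /mu rmorph_sum.
Qed.

Lemma T0_cat (phi : W -> C) w x : gram_op phi (w ++ x) =
  gram_op (fun u => phi (w ++ u)) x + wsplit (fun a b => phi a * mu (b ++ x)) w - phi w * mu x.
Proof.
rewrite /gram_op spl_cat.
under [X in _ + X - _ = _]eq_SW do rewrite -catA.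
ring.
Qed.

(* With [L_psi] the left multiplication by [psi], [yb phi] is the complex
   conjugate of [sum_e L_(phi e)^* (f e)] and [AA phi] is
   [sum_e L_(f e)^* (phi e)]. *)
Definition yb (phi : E -> W -> C) x :=
  \sum_e wsum N (fun w => phi e w * (f e (w ++ x))^*).

Definition AA (phi : E -> W -> C) x :=
  \sum_e wsum N (fun w => (f e w)^* * phi e (w ++ x)).

Lemma AA_nil phi : AA phi [::] = yb phi [::].
Proof.
rewrite /AA /yb; apply: eq_bigr => e _; apply: eq_SW => w.
by rewrite !cats0 mulrC.
Qed.

(** Adjoint of [yb] applied to [yb phi], up to conjugation, so that [gram_opk k (phi e) - MM phi e]
    represents the form [DD] (see [DD_T]). In the same way [rho] is [AA] of the operator
    representing [DD]. *)
Definition MM (phi : E -> W -> C) e z := wsum N (fun v => yb phi v * f e (v ++ z)).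

Definition rho k (phi : E -> W -> C) x :=
  \sum_e wsum N (fun w => (f e w)^* * (gram_opk k (phi e) (w ++ x) - MM phi e (w ++ x))).

Lemma T0_AA (phi : E -> W -> C) x : gram_op (AA phi) x =
  \sum_e wsum N (fun w => (f e w)^* * gram_op (fun u => phi e (w ++ u)) x).
Proof.
rewrite /gram_op.
transitivity (\sum_e wsum N (fun w => (f e w)^* * wsplit (fun a b => phi e (w ++ a) * mu b) x)
   + \sum_e wsum N (fun w => (f e w)^* * wsum N (fun u => (mu u)^* * phi e (w ++ x ++ u)))
   - \sum_e wsum N (fun w => (f e w)^* * (mu [::] * phi e (w ++ x)))); last first.
  rewrite -sumrN -!big_split /=; apply: eq_bigr => e _.
  by rewrite -SWD -SWB; apply: eq_SW => w; ring.
congr (_ + _ - _).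
- under [RHS]eq_bigr => e _.
    rewrite SW_spl_pull.
    over.
  rewrite spl_sum; apply: eq_spl => a b _; rewrite /AA mulr_suml.
  by apply: eq_bigr => e _; rewrite -SWZr; apply: eq_SW => w; ring.
- under [RHS]eq_bigr => e _.
    rewrite SW_SW_pull.
    over.
  rewrite -SW_sum; apply: eq_SW => u; rewrite /AA mulr_sumr; apply: eq_bigr => e _.
  by rewrite -SWZl; apply: eq_SW => w; ring.
- rewrite /AA mulr_sumr; apply: eq_bigr => e _; rewrite -SWZl.
  by apply: eq_SW => w; ring.
Qed.

(** [AA] intertwines the operator representing [DD] with [gram_opk k], up to a multiple of [mu].
    Since [mu] is [gram_op] of the unit mass [delta] at the empty word, passing from [AA] to [AA']
    cancels this multiple. *)
Lemma T_AA k (phi : E -> W -> C) x : (m <= N)%N ->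
  gram_opk k (AA phi) x = rho k phi x + yb phi [::] * mu x.
Proof.
move=> mN; rewrite /gram_opk T0_AA /rho.
have E1 : \sum_e wsum N (fun w => (f e w)^* * wsplit (fun a b => phi e a * mu (b ++ x)) w)
   = wsum N (fun b => yb phi b * mu (b ++ x)).
  under eq_bigr => e _.
    rewrite (eq_SW _ (fun w => spl_mull (fun w => (f e w)^*) _ w)) SW_spl; last first.
      by move=> a b hab; rewrite fsup ?size_cat ?conjC0 ?mul0r //; lia.
    rewrite SW_exch.
    over.
  rewrite -SW_sum; apply: eq_SW => b; rewrite /yb mulr_suml; apply: eq_bigr => e _.
  by rewrite -SWZr; apply: eq_SW => a; ring.
have E2 : \sum_e wsum N (fun w => (f e w)^* * MM phi e (w ++ x))
   = wsum N (fun b => yb phi b * mu (b ++ x)).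
  under eq_bigr => e _.
    rewrite SW_SW_pull.
    over.
  rewrite -SW_sum; apply: eq_SW => v; rewrite /mu mulr_sumr; apply: eq_bigr => e _.
  by rewrite -SWZl; apply: eq_SW => w; rewrite f_catCA; ring.
have E3 : \sum_e wsum N (fun w => (f e w)^* * (phi e w * mu x)) = yb phi [::] * mu x.
  rewrite -AA_nil /AA mulr_suml; apply: eq_bigr => e _; rewrite -SWZr.
  by apply: eq_SW => w; rewrite cats0; ring.
have E4 : k * AA phi x = \sum_e wsum N (fun w => (f e w)^* * (k * phi e (w ++ x))).
  rewrite /AA mulr_sumr; apply: eq_bigr => e _; rewrite -SWZl.
  by apply: eq_SW => w; ring.
have E0 : \sum_e wsum N (fun w => (f e w)^* * gram_opk k (phi e) (w ++ x)) =
    \sum_e wsum N (fun w => (f e w)^* * gram_op (fun u => phi e (w ++ u)) x)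
    + \sum_e wsum N (fun w => (f e w)^* * wsplit (fun a b => phi e a * mu (b ++ x)) w)
    - \sum_e wsum N (fun w => (f e w)^* * (phi e w * mu x))
    + \sum_e wsum N (fun w => (f e w)^* * (k * phi e (w ++ x))).
  rewrite -sumrN -!big_split /=; apply: eq_bigr => e _.
  by rewrite -SWN -!SWD; apply: eq_SW => w; rewrite /gram_opk T0_cat; ring.
have -> : \sum_e wsum N (fun w => (f e w)^* * (gram_opk k (phi e) (w ++ x) - MM phi e (w ++ x))) =
    \sum_e wsum N (fun w => (f e w)^* * gram_opk k (phi e) (w ++ x))
    - \sum_e wsum N (fun w => (f e w)^* * MM phi e (w ++ x)).
  rewrite -sumrN -big_split /=; apply: eq_bigr => e _.
  by rewrite -SWB; apply: eq_SW => w; ring.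
rewrite E0 E1 E2 E3 -E4; ring.
Qed.

Definition delta (x : W) : C := (x == [::])%:R.

Lemma T_delta k c x : gram_opk k (fun x => c * delta x) x = c * mu x + k * (c * delta x).
Proof.
rewrite /gram_opk; congr (_ + _); rewrite /gram_op /delta.
have -> : wsplit (fun a b => c * (a == [::])%:R * mu b) x = c * mu x.
  case: x => [|i x] /=; first by rewrite mulr1.
  rewrite mulr1 -[RHS]addr0; congr (_ + _); rewrite -[RHS](spl0 _ x).
  by apply: eq_spl => a b _; rewrite mulr0 mul0r.
rewrite (@SW_delta _ _ _ _ (mu [::] * (c * (x == [::])%:R))); first by rewrite addrK.
  by rewrite cats0 mu_nilC.
by move=> w wn; case: x w wn => [|i x] [|j w] //= _; rewrite !mulr0.
Qed.

Definition AA' phi x := AA phi x - AA phi [::] * delta x.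

Lemma AA'_nil phi : AA' phi [::] = 0.
Proof. by rewrite /AA' /delta eqxx mulr1 subrr. Qed.

Lemma TB k (F G : W -> C) x : gram_opk k (fun x => F x - G x) x = gram_opk k F x - gram_opk k G x.
Proof.
rewrite /gram_opk /gram_op.
have -> : wsplit (fun a b => (F a - G a) * mu b) x =
    wsplit (fun a b => F a * mu b) x - wsplit (fun a b => G a * mu b) x.
  rewrite -mulN1r -splZ -splD; apply: eq_spl => a b _; ring.
have -> : wsum N (fun w => (mu w)^* * (F (x ++ w) - G (x ++ w))) =
   wsum N (fun w => (mu w)^* * F (x ++ w)) - wsum N (fun w => (mu w)^* * G (x ++ w)).
  by rewrite -SWB; apply: eq_SW => w; ring.
ring.
Qed.

Lemma T_AA' k phi x : (m <= N)%N ->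
  gram_opk k (AA' phi) x = rho k phi x - k * (AA phi [::] * delta x).
Proof.
move=> mN; rewrite TB T_AA // T_delta AA_nil; ring.
Qed.

(** The defect left in [T_AA'] sits at the empty word, where [AA'] vanishes. *)
Lemma ip_T_AA' k phi : (m <= N)%N -> wdot (gram_opk k (AA' phi)) (AA' phi) = wdot (rho k phi) (AA' phi).
Proof.
move=> mN; apply/eqP; rewrite -subr_eq0 /wdot -SWB; apply/eqP.
apply: SW_delta => [|w wn]; first by rewrite AA'_nil conjC0 !mulr0 subrr.
by rewrite T_AA' // /delta (negPf wn) !mulr0 subr0 subrr.
Qed.

(** The polarized difference of the two sides of the column-row inequality, regularized by [k]. *)
Definition DD k (phi psi : E -> W -> C) :=
  \sum_e (\sum_e' wdot (wconv (phi e) (f e')) (wconv (psi e) (f e')) + k * wdot (phi e) (psi e))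
  - wdot (yb phi) (yb psi).

Lemma sup_AA n phi : (forall e, wsupp n (phi e)) -> wsupp n (AA phi).
Proof.
move=> h x hx; rewrite /AA big1 // => e _; rewrite (@eq_SW _ _ _ _ (fun=> 0)) ?SW0 // => w.
by rewrite h ?mulr0 // size_cat; lia.
Qed.

Lemma sup_AA' n phi : (forall e, wsupp n (phi e)) -> wsupp n (AA' phi).
Proof.
move=> h x hx; rewrite /AA' (sup_AA h) // /delta.
by case: x hx => // i x _; rewrite mulr0 subrr.
Qed.

Lemma DD_T k n phi psi : (n + m <= N)%N -> (forall e, wsupp n (phi e)) ->
  (forall e, wsupp n (psi e)) ->
  DD k phi psi = \sum_e wdot (fun z => gram_opk k (phi e) z - MM phi e z) (psi e).
Proof.
move=> nmN hphi hpsi; rewrite /DD.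
have -> : wdot (yb phi) (yb psi) = \sum_e wdot (MM phi e) (psi e).
  rewrite /wdot -SW_sum.
  transitivity (wsum N (fun x => \sum_e wsum N (fun w => yb phi x * ((psi e w)^* * f e (w ++ x))))).
    apply: eq_SW => x; rewrite /yb rmorph_sum mulr_sumr; apply: eq_bigr => e _.
    rewrite /= SW_conj -SWZl; apply: eq_SW => w.
    by rewrite rmorphM /= conjCK.
  rewrite SW_sum SW_sum; apply: eq_bigr => e _; rewrite SW_exch.
  apply: eq_SW => w; rewrite /MM -SWZr; apply: eq_SW => v.
  by rewrite (f_catC e w v); ring.
rewrite -sumrN -big_split; apply: eq_bigr => e _ /=.
rewrite (ip_cv nmN) // /wdot -SWZl -SWD -SWB; apply: eq_SW => w.
rewrite /gram_opk; ring.
Qed.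

(** With [G = AA' phi] and [ip_T_AA'], the right-hand side becomes the form of [gram_opk k] at
    [AA' phi], hence is at least [k] times its squared norm. *)
Lemma DD_cv k n phi (G : W -> C) : (n + m + m <= N)%N -> (forall e, wsupp n (phi e)) ->
  wsupp n G -> DD k phi (fun e => wconv (f e) G) = wdot (rho k phi) G.
Proof.
move=> nmN hphi hG.
rewrite (@DD_T k (n + m)) //; last first.
- by move=> e; rewrite addnC; apply: sup_cv.
- by move=> e w hw; apply: hphi; lia.
transitivity (\sum_e wsum N (fun w => wsum N (fun x => (gram_opk k (phi e) (w ++ x) - MM phi e (w ++ x)) * (f e w * G x)^*))).
  apply: eq_bigr => e _; rewrite -SW_spl; last first.
    move=> a b hab; have [hb|hb] := ltnP n (size b); first by rewrite hG // mulr0 conjC0 mulr0.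
    by rewrite fsup ?mul0r ?conjC0 ?mulr0 //; lia.
  apply: eq_SW => z; rewrite [in (wconv _ _ z)^*]/wconv spl_conj.
  by rewrite (spl_mull (fun z => gram_opk k (phi e) z - MM phi e z)).
under eq_bigr do rewrite SW_exch.
rewrite -SW_sum; apply: eq_SW => x; rewrite /rho mulr_suml; apply: eq_bigr => e _.
by rewrite -SWZr; apply: eq_SW => w; rewrite rmorphM /=; ring.
Qed.

Lemma DD_expand k a b phi psi : k^* = k ->
  DD k (fun e w => a * phi e w + b * psi e w) (fun e w => a * phi e w + b * psi e w) =
  a * a^* * DD k phi phi + a * b^* * DD k phi psi + a^* * b * (DD k phi psi)^*
   + b * b^* * DD k psi psi.
Proof.
move=> kr.
have e1 : wdot (yb (fun e w => a * phi e w + b * psi e w)) (yb (fun e w => a * phi e w + b * psi e w))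
  = wdot (fun x => a * yb phi x + b * yb psi x) (fun x => a * yb phi x + b * yb psi x).
  have e2 x : yb (fun e w => a * phi e w + b * psi e w) x = a * yb phi x + b * yb psi x.
    rewrite /yb !mulr_sumr -big_split; apply: eq_bigr => e _ /=.
    by rewrite -!SWZl -SWD; apply: eq_SW => w; ring.
  by apply: eq_SW => x; rewrite e2.
have e3 e e' : wdot (wconv (fun w => a * phi e w + b * psi e w) (f e')) (wconv (fun w => a * phi e w + b * psi e w) (f e'))
  = wdot (fun x => a * wconv (phi e) (f e') x + b * wconv (psi e) (f e') x) (fun x => a * wconv (phi e) (f e') x + b * wconv (psi e) (f e') x).
  by apply: eq_SW => x; rewrite cvDl !cvZl.
rewrite /DD e1 ip_expand.
have -> : (\sum_e (\sum_e' wdot (wconv (phi e) (f e')) (wconv (psi e) (f e')) + k * wdot (phi e) (psi e))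
     - wdot (yb phi) (yb psi))^* =
    \sum_e (\sum_e' (wdot (wconv (phi e) (f e')) (wconv (psi e) (f e')))^* + k * (wdot (phi e) (psi e))^*)
     - (wdot (yb phi) (yb psi))^*.
  rewrite rmorphB rmorph_sum; congr (_ - _); apply: eq_bigr => e _.
  by rewrite rmorphD rmorph_sum rmorphM /= kr.
set Y1 := wdot (yb phi) (yb phi); set Y2 := wdot (yb phi) (yb psi); set Y3 := wdot (yb psi) (yb psi).
have -> : \sum_e (\sum_e' wdot (wconv (fun w => a * phi e w + b * psi e w) (f e')) (wconv (fun w => a * phi e w + b * psi e w) (f e'))
    + k * wdot (fun w => a * phi e w + b * psi e w) (fun w => a * phi e w + b * psi e w)) =
   a * a^* * \sum_e (\sum_e' wdot (wconv (phi e) (f e')) (wconv (phi e) (f e')) + k * wdot (phi e) (phi e))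
   + a * b^* * \sum_e (\sum_e' wdot (wconv (phi e) (f e')) (wconv (psi e) (f e')) + k * wdot (phi e) (psi e))
   + a^* * b * \sum_e (\sum_e' (wdot (wconv (phi e) (f e')) (wconv (psi e) (f e')))^* + k * (wdot (phi e) (psi e))^*)
   + b * b^* * \sum_e (\sum_e' wdot (wconv (psi e) (f e')) (wconv (psi e) (f e')) + k * wdot (psi e) (psi e)).
  rewrite !mulr_sumr -!big_split /=; apply: eq_bigr => e _.
  rewrite !mulrDr !mulr_sumr.
  under eq_bigr do rewrite e3 ip_expand.
  rewrite !big_split /= ip_expand; ring.
ring.
Qed.

(** The first product is cut either inside the [f e] factor of the second one, which yields [yb], or
    inside the reversed factor, which yields [AA]; coinciding cuts are counted twice and yield [AA
    phi [::]]. The reversal turns a right division by [f e'] into a left one, so that [AA] appears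
    on both sides. *)
Lemma ip_rev_cv n phi : (n + m <= N)%N -> (forall e, wsupp n (phi e)) ->
  \sum_e \sum_e' wdot (wconv (phi e) (f e')) (wconv (f e) (fun w => phi e' (rev w))) =
  wdot (AA phi) (fun x => AA phi (rev x)) + wdot (yb phi) (yb phi) - nsq (AA phi [::]).
Proof.
move=> nmN hphi.
pose X1 e e' := wsum N (fun d => wsum N (fun c => phi e c * (f e (c ++ d))^*) *
   wsum N (fun b => (phi e' (rev b))^* * f e' (d ++ b))).
pose X2 e e' := wsum N (fun c => wsum N (fun a => (f e a)^* * phi e (a ++ c)) *
   wsum N (fun d => (phi e' (rev (c ++ d)))^* * f e' d)).
pose X3 e e' := wsum N (fun a => (f e a)^* * phi e a) * wsum N (fun b => (phi e' (rev b))^* * f e' b).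
have step e e' : wdot (wconv (phi e) (f e')) (wconv (f e) (fun w => phi e' (rev w))) =
   X1 e e' + X2 e e' - X3 e e'.
  transitivity (wsum N (fun a => wsum N (fun b => wconv (phi e) (f e') (a ++ b) * (f e a * phi e' (rev b))^*))).
    rewrite -SW_spl; last first.
      move=> a b hab; have [hb|hb] := ltnP n (size b).
        by rewrite hphi ?size_rev // mulr0 conjC0 mulr0.
      by rewrite fsup ?mul0r ?conjC0 ?mulr0 //; lia.
    apply: eq_SW => z; rewrite [in (wconv (f e) _ z)^*]/wconv spl_conj.
    by rewrite (spl_mull (wconv (phi e) (f e'))).
  have t1 : X1 e e' = wsum N (fun a => wsum N (fun b => wsplit (fun c d => phi e c * f e' (d ++ b)) a * (f e a * phi e' (rev b))^*)).
    rewrite SW_exch.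
    transitivity (wsum N (fun b => wsum N (fun c => wsum N (fun d => (f e (c ++ d))^* * (phi e c * f e' (d ++ b)) * (phi e' (rev b))^*)))); last first.
      apply: eq_SW => b; rewrite -SW_spl; last first.
        by move=> c d hcd; rewrite fsup ?size_cat ?conjC0 ?mul0r //; lia.
      apply: eq_SW => a; rewrite rmorphM /=.
      rewrite [RHS](_ : _ = (phi e' (rev b))^* * ((f e a)^* * wsplit (fun c d => phi e c * f e' (d ++ b)) a)); last by ring.
      rewrite (spl_mull (fun a => (f e a)^*)) -splZ; apply: eq_spl => c d _; ring.
    under [RHS]eq_SW do rewrite SW_exch.
    rewrite [RHS]SW_exch; apply: eq_SW => d; rewrite -SWZl; apply: eq_SW => b.
    by rewrite -SWZr; apply: eq_SW => c; ring.
  have t2 : X2 e e' = wsum N (fun a => wsum N (fun b => wsplit (fun c d => phi e (a ++ c) * f e' d) b * (f e a * phi e' (rev b))^*)).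
    transitivity (wsum N (fun a => wsum N (fun c => wsum N (fun d => (phi e' (rev (c ++ d)))^* * (phi e (a ++ c) * f e' d) * (f e a)^*)))); last first.
      apply: eq_SW => a; rewrite -SW_spl; last first.
        move=> c d hcd; have [hc|hc] := ltnP n (size (rev (c ++ d))).
          by rewrite hphi // conjC0 !mul0r.
        by move: hc; rewrite size_rev size_cat; lia.
      apply: eq_SW => b; rewrite rmorphM /=.
      rewrite [RHS](_ : _ = (f e a)^* * ((phi e' (rev b))^* * wsplit (fun c d => phi e (a ++ c) * f e' d) b)); last by ring.
      rewrite (spl_mull (fun b => (phi e' (rev b))^*)) -splZ; apply: eq_spl => c d _; ring.
    rewrite [RHS]SW_exch; apply: eq_SW => c; rewrite -SWZr; apply: eq_SW => a.
    by rewrite -SWZl; apply: eq_SW => d; ring.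
  have t3 : X3 e e' = wsum N (fun a => wsum N (fun b => phi e a * f e' b * (f e a * phi e' (rev b))^*)).
    rewrite /X3 -SWZr; apply: eq_SW => a; rewrite -SWZl; apply: eq_SW => b.
    by rewrite rmorphM /=; ring.
  rewrite t1 t2 t3 -SWD -SWB; apply: eq_SW => a; rewrite -SWD -SWB; apply: eq_SW => b.
  by rewrite /wconv spl_cat; ring.
under eq_bigr do under eq_bigr do rewrite step.
have -> : \sum_e \sum_e' (X1 e e' + X2 e e' - X3 e e') =
   \sum_e \sum_e' X1 e e' + \sum_e \sum_e' X2 e e' - \sum_e \sum_e' X3 e e'.
  rewrite -sumrN -!big_split; apply: eq_bigr => e _ /=.
  by rewrite -sumrN -!big_split.
have pair (F : E -> W -> C) (G : E -> W -> C) :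
   \sum_e \sum_e' wsum N (fun d => F e d * G e' d) = wsum N (fun d => (\sum_e F e d) * (\sum_e G e d)).
  transitivity (wsum N (fun d => \sum_e \sum_e' F e d * G e' d)).
    by rewrite SW_sum; apply: eq_bigr => e _; rewrite SW_sum.
  by apply: eq_SW => d; rewrite mulr_suml; apply: eq_bigr => e _; rewrite mulr_sumr.
rewrite [X in _ = X - _]addrC; congr (_ + _ - _).
- rewrite /X1 pair; apply: eq_SW => d; congr (_ * _).
  rewrite /yb rmorph_sum; apply: eq_bigr => e _; rewrite /= SW_conj -SW_rev.
  apply: eq_SW => b; rewrite rmorphM /= conjCK revK; congr (_ * _).
  by apply: fsym; rewrite perm_catC perm_cat2r perm_rev.
- rewrite /X2 pair; apply: eq_SW => c; congr (_ * _).
  rewrite /AA rmorph_sum; apply: eq_bigr => e _; rewrite /= SW_conj -SW_rev.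
  apply: eq_SW => d; rewrite rmorphM /= conjCK rev_cat revK f_rev mulrC //.
- rewrite /X3.
  have -> : \sum_e \sum_e' wsum N (fun a => (f e a)^* * phi e a) * wsum N (fun b => (phi e' (rev b))^* * f e' b)
    = (\sum_e wsum N (fun a => (f e a)^* * phi e a)) * (\sum_e wsum N (fun b => (phi e (rev b))^* * f e b)).
    by rewrite mulr_suml; apply: eq_bigr => e _; rewrite mulr_sumr.
  congr (_ * _).
    by apply: eq_bigr => e _; apply: eq_SW => a; rewrite cats0.
  rewrite /AA rmorph_sum; apply: eq_bigr => e _; rewrite /= SW_conj -SW_rev.
  by apply: eq_SW => b; rewrite revK f_rev cats0 rmorphM /= conjCK mulrC.
Qed.

End Depth.
End Fock.

(** * The column-row inequality *)

Section KeyStep.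
Variables (C : numClosedFieldType) (I E : finType).
Local Notation W := (seq I).
Local Notation nsq z := (z * z^*).

Lemma ip_CS N (F G : W -> C) : nsq (wdot N F G) <= wdot N F F * wdot N G G.
Proof.
apply: psd2_det => a b; rewrite -ip_expand; exact: ip_ge0.
Qed.

Lemma ip_supp N M n (F G : W -> C) : (n <= N)%N -> (n <= M)%N -> wsupp n F ->
  wdot N F G = wdot M F G.
Proof.
move=> nN nM h; have h' : wsupp n (fun w => F w * (G w)^*).
  by move=> w hw; rewrite h // mul0r.
by rewrite /wdot (SW_supp h' nN) (SW_supp h' nM).
Qed.

Variables (f : E -> W -> C) (m : nat).
Hypothesis fsup : forall e, wsupp m (f e).
Hypothesis fsym : forall e u v, perm_eq u v -> f e u = f e v.

(** Reversal carries the product of [f e] and the reversed [phi e'] to the product of [phi e'] and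
    [f e], of the same norm, so AM-GM bounds the pairing of [ip_rev_cv] by the double sum. Besides
    [|yb|^2] this pairing contains [<A', rev A'>], which is at least [- |A'|^2]. *)
Lemma yb_ip_le N n phi : (n + m <= N)%N -> (forall e, wsupp n (phi e)) ->
  wdot N (yb f N phi) (yb f N phi) <=
    \sum_e \sum_e' wdot N (wconv (phi e) (f e')) (wconv (phi e) (f e'))
    + wdot N (AA' f N phi) (AA' f N phi).
Proof.
move=> nmN hphi.
set G := \sum_e _; set a := wdot N (AA' f N phi) _; set Y := wdot N _ _.
have := ip_rev_cv fsup fsym nmN hphi; rewrite -/Y.
set Q := \sum_e _ => EQ.
have QG : Q + Q^* <= G + G.
  have {2}-> : G = \sum_e \sum_e' wdot N (wconv (f e) (fun w => phi e' (rev w))) (wconv (f e) (fun w => phi e' (rev w))).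
    rewrite /G exchange_big; apply: eq_bigr => e _; apply: eq_bigr => e' _.
    rewrite /wdot -SW_rev; apply: eq_SW => z; rewrite cv_rev.
    by congr (nsq _); apply: eq_spl => v w _; rewrite (f_rev fsym).
  rewrite /Q /G rmorph_sum -!big_split; apply: ler_sum => e _ /=.
  rewrite rmorph_sum -!big_split; apply: ler_sum => e' _ /=.
  rewrite ipC; exact: ip_amgm.
pose A' := AA' f N phi.
have XA : wdot N (AA f N phi) (fun x => AA f N phi (rev x)) - nsq (AA f N phi [::]) =
    wdot N A' (fun x => A' (rev x)).
  apply/eqP; rewrite subr_eq addrC -subr_eq; apply/eqP; rewrite /wdot -SWB.
  apply: SW_delta => [|w wn]; first by rewrite /A' AA'_nil mul0r subr0.
  have rwn : rev w != [::] by rewrite -size_eq0 size_rev size_eq0.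
  by rewrite /A' /AA' /delta (negPf wn) (negPf rwn) !mulr0 !subr0 subrr.
have EQ' : Q = wdot N A' (fun x => A' (rev x)) + Y by rewrite EQ -XA; ring.
have Yr : Y^* = Y by rewrite /Y ipC.
have := ip_amgmN N A' (fun x => A' (rev x)).
have -> : wdot N (fun x => A' (rev x)) (fun x => A' (rev x)) = a.
  by rewrite /wdot (SW_rev N (fun x => nsq (A' x))).
rewrite -/a => h.
move: QG; rewrite EQ' rmorphD /= Yr ipC => h2.
rewrite -(ler_pM2l (ltr0n _ 2)) -subr_ge0.
rewrite -subr_ge0 in h; rewrite -subr_ge0 in h2.
have := addr_ge0 h h2; congr (0 <= _); rewrite /a -/A'; ring.
Qed.

(** Let [a = |A'|^2] and let [psi e] be the product of [f e] and [A']. Cauchy-Schwarz for the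
    nonnegative form gives [(k a)^2 <= D * (c a)], so the error [a] of [yb_ip_le] is at most
    [c D / k^2]. The constant depends neither on [N] nor on the support of [phi], as the descent in
    [k] requires. *)
Lemma DD_coercive (k : C) : 0 < k -> exists2 c : C, 0 <= c &
  forall N n phi, (n + m + m <= N)%N -> (forall e, wsupp n (phi e)) ->
    (forall psi, (forall e, wsupp (n + m) (psi e)) -> 0 <= DD f N k psi psi) ->
    k * k * (k * \sum_e wdot N (phi e) (phi e)) <= (k * k + c) * DD f N k phi phi.
Proof.
move=> k0; have kr : k^* = k by apply/CrealP/gtr0_real.
have /boolp.choice[cr hcr] : forall e, exists c : C, 0 <= c /\ forall N G,
    wdot N (wconv G (f e)) (wconv G (f e)) <= c * wdot N G G.
  by move=> e; have [c c0 h] := cv_right_bound (@fsup e); exists c.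
have /boolp.choice[cl hcl] : forall e, exists c : C, 0 <= c /\ forall N G,
    wdot N (wconv (f e) G) (wconv (f e) G) <= c * wdot N G G.
  by move=> e; have [c c0 h] := cv_left_bound (@fsup e); exists c.
exists (\sum_e (\sum_e' cr e' * cl e + k * cl e)).
  apply: sumr_ge0 => e _; have [cl0 _] := hcl e; apply: addr_ge0.
    by apply: sumr_ge0 => e' _; have [? _] := hcr e'; apply: mulr_ge0.
  by apply: mulr_ge0 => //; exact: ltW.
set c := \sum_e _ => N n phi nN hphi pos.
set A' := AA' f N phi; set a := wdot N A' A'.
have a0 : 0 <= a := ip_ge0 _ _.
have supA : wsupp n A' by apply: sup_AA'.
pose psi e := wconv (f e) A'.
have hpsi e : wsupp (n + m) (psi e) by rewrite addnC; apply: sup_cv.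
set D := DD f N k phi phi.
have D0 : 0 <= D by apply: pos => e w hw; apply: hphi; lia.
have Dpsi : DD f N k psi psi <= c * a.
  apply: (@le_trans _ _ (\sum_e (\sum_e' wdot N (wconv (psi e) (f e')) (wconv (psi e) (f e')) + k * wdot N (psi e) (psi e)))).
    by rewrite /DD lerBlDr lerDl ip_ge0.
  rewrite /c mulr_suml; apply: ler_sum => e _; rewrite mulrDl.
  have [cl0 hl] := hcl e.
  apply: lerD; last by rewrite -mulrA ler_pM2l //; exact: hl.
  rewrite mulr_suml; apply: ler_sum => e' _; have [cr0 hr] := hcr e'.
  apply: le_trans (hr _ _) _; rewrite -mulrA; apply: ler_wpM2l => //; exact: hl.
have dE : DD f N k phi psi = wdot N (gram_opk f N k A') A'.
  by rewrite (DD_cv fsup fsym k nN hphi supA) (ip_T_AA' fsup fsym) //; lia.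
have ka : k * a <= DD f N k phi psi.
  have -> : DD f N k phi psi = \sum_e wdot N (wconv A' (f e)) (wconv A' (f e)) + k * a.
    rewrite dE (@ip_cv _ _ _ _ _ fsup fsym N n) //; last by lia.
    by rewrite /a /wdot -SWZl -SWD; apply: eq_SW => w; rewrite /gram_opk; ring.
  by rewrite lerDr; apply: sumr_ge0 => e _; exact: ip_ge0.
have ka0 : 0 <= k * a by rewrite mulr_ge0 // ltW.
have d0 : 0 <= DD f N k phi psi := le_trans ka0 ka.
have CS : nsq (DD f N k phi psi) <= D * DD f N k psi psi.
  apply: psd2_det => x y; rewrite -DD_expand //; apply: pos => e w hw.
  by rewrite hpsi // (hphi e w) ?mulr0 ?addr0 //; lia.
have kka : k * k * a <= c * D.
  have [a00|an0] := eqVneq a 0.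
    rewrite a00 mulr0 mulr_ge0 //; apply: sumr_ge0 => e _; have [cl0 _] := hcl e.
    apply: addr_ge0; last by apply: mulr_ge0 => //; exact: ltW.
    by apply: sumr_ge0 => e' _; have [? _] := hcr e'; apply: mulr_ge0.
  have ap : 0 < a by rewrite lt0r an0.
  rewrite -(ler_pM2r ap).
  apply: (@le_trans _ _ (D * (c * a))); last by rewrite le_eqVlt; apply/orP; left; apply/eqP; ring.
  apply: le_trans (ler_wpM2l D0 Dpsi); apply: le_trans CS.
  have /CrealP -> : DD f N k phi psi \is Num.real by exact: ger0_real.
  have -> : k * k * a * a = (k * a) * (k * a) by ring.
  exact: ler_pM.
have low : k * \sum_e wdot N (phi e) (phi e) - a <= D.
  have nmN : (n + m <= N)%N by lia.
  have := yb_ip_le nmN hphi; rewrite -/A' -/a -subr_ge0 => h.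
  rewrite -subr_ge0; move: h; congr (0 <= _); rewrite /D /DD big_split /= mulr_sumr; ring.
rewrite mulrDl; apply: le_trans (lerD (lexx _) kka).
rewrite -lerBlDr -mulrBr; apply: ler_wpM2l low.
by rewrite mulr_ge0 // ltW.
Qed.

(** Coercivity is proved for truncations with room for two more factors; this brings it back to room
    for one. *)
Lemma DD_stable k n N M phi : (n + m <= N)%N -> (n + m <= M)%N ->
  (forall e, wsupp n (phi e)) -> DD f N k phi phi = DD f M k phi phi.
Proof.
move=> hN hM hphi; rewrite /DD; congr (_ - _).
  apply: eq_bigr => e _; congr (_ + _).
    by apply: eq_bigr => e' _; apply: (@ip_supp N M (n + m)%N) => //; apply: sup_cv.
  by congr (_ * _); apply: (@ip_supp N M n) => //; lia.
have ybE x : yb f N phi x = yb f M phi x.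
  apply: eq_bigr => e _; have s : wsupp n (fun w => phi e w * (f e (w ++ x))^*).
    by move=> w hw; rewrite hphi // mul0r.
  by rewrite !(SW_supp s) //; lia.
have syb : wsupp m (yb f M phi).
  move=> x hx; rewrite /yb big1 // => e _; rewrite -[RHS](SW0 _ I M).
  by apply: eq_SW => w; rewrite fsup ?conjC0 ?mulr0 // size_cat; lia.
rewrite -(@ip_supp N M m) //; try lia.
by apply: eq_SW => x; rewrite ybE.
Qed.

Lemma yb_bound : exists2 c : C, 0 <= c & forall N n phi, (n + m <= N)%N ->
  (forall e, wsupp n (phi e)) ->
  wdot N (yb f N phi) (yb f N phi) <= c * \sum_e wdot N (phi e) (phi e).
Proof.
pose q e := wsum m (fun x => wsum m (fun w => nsq (f e (w ++ x)))).
have q0 e : 0 <= q e by apply: SW_ge0 => x; apply: SW_ge0 => w; exact: mul_conjC_ge0.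
exists (#|E|%:R * \sum_e q e) => [|N n phi nN hphi].
  by rewrite mulr_ge0 ?ler0n // sumr_ge0.
have qN e : q e = wsum N (fun x => wdot N (fun w => f e (w ++ x)) (fun w => f e (w ++ x))).
  rewrite (@SW_supp _ _ m N); last by lia.
    apply: eq_SW => x; rewrite /wdot (@SW_supp _ _ m N) //; last by lia.
    by move=> w hw; rewrite fsup ?mul0r // size_cat; lia.
  move=> x hx; rewrite -[RHS](SW0 _ I N); apply: eq_SW => w.
  by rewrite fsup ?mul0r // size_cat; lia.
apply: (@le_trans _ _ (wsum N (fun x => #|E|%:R * \sum_e (wdot N (phi e) (phi e) * wdot N (fun w => f e (w ++ x)) (fun w => f e (w ++ x)))))).
  apply: SW_le => x; apply: le_trans (nsq_sum_le _) _.
  apply: ler_wpM2l; first exact: ler0n.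
  by apply: ler_sum => e _; exact: ip_CS.
rewrite SWZl SW_sum -mulrA; apply: ler_wpM2l; first exact: ler0n.
rewrite mulr_sumr; apply: ler_sum => e _; rewrite SWZl -qN mulrC.
apply: ler_wpM2r; first exact: ip_ge0.
by rewrite (bigD1 e) //= lerDl sumr_ge0.
Qed.

End KeyStep.

Section Key.
Variables (R : realType) (I E : finType).
Local Notation C := R[i].
Local Notation W := (seq I).
Local Notation "x %:C" := (real_complex R x).

Lemma ge0_limit (x B : C) : (forall d : R, 0 < d -> 0 <= x + d%:C * B) -> 0 <= B -> 0 <= x.
Proof.
move=> h B0; have xr : x \is Num.real.
  have -> : x = (x + 1%:C * B) - B by rewrite mul1r addrK.
  by rewrite rpredB // ger0_real // h.
have /complex_realP[x' xE] := xr; have /complex_realP[B' BE] := ger0_real B0.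
subst x B; move: B0; rewrite !ler0c => B0; rewrite leNgt; apply/negP => xn.
have := h (- x' / (2 * (B' + 1))).
rewrite -rmorphM -rmorphD ler0c.
have p : 0 < 2 * (B' + 1) by lra.
rewrite divr_gt0 ?oppr_gt0 // => /(_ isT).
rewrite -(ler_pM2r p) mul0r mulrDl mulrAC mulrVK ?unitfE ?gt_eqF //; nra.
Qed.

Variables (f : E -> W -> C) (m : nat).
Hypothesis fsup : forall e, wsupp m (f e).
Hypothesis fsym : forall e u v, perm_eq u v -> f e u = f e v.

Let P (k : R) := forall N n phi, (n + m <= N)%N -> (forall e, wsupp n (phi e)) ->
  0 <= DD f N k%:C phi phi.

Lemma DD_shift N (k d : C) phi : DD f N (k + d) phi phi =
  DD f N k phi phi + d * \sum_e wdot N (phi e) (phi e).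
Proof.
rewrite /DD !big_split /= -!mulr_sumr mulrDl; ring.
Qed.

Let nrm0 N (phi : E -> W -> C) : 0 <= \sum_e wdot N (phi e) (phi e).
Proof. by apply: sumr_ge0 => e _; exact: ip_ge0. Qed.

Let Pup k k' : P k -> k <= k' -> P k'.
Proof.
move=> h kk' N n phi nN hphi.
have -> : k'%:C = k%:C + (k' - k)%:C by rewrite -rmorphD /= addrC subrK.
rewrite DD_shift; apply: addr_ge0; first exact: (h N n).
by apply: mulr_ge0 => //; rewrite ler0c subr_ge0.
Qed.

Let Plim k : (forall d, 0 < d -> P (k + d)) -> P k.
Proof.
move=> h N n phi nN hphi; apply: (@ge0_limit _ (\sum_e wdot N (phi e) (phi e))) => // d d0.
by rewrite -DD_shift -rmorphD; apply: (h d d0 N n).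
Qed.

Let Pstep k : 0 < k -> P k -> exists2 k', 0 < k' < k & P k'.
Proof.
move=> k0 Pk; have kC0 : 0 < k%:C by rewrite ltcR.
have [c c0 hc] := DD_coercive fsup fsym kC0.
have cE : c = (complex.Re c)%:C by rewrite RRe_real // ger0_real.
move: c0 hc; rewrite cE ler0c; move: (complex.Re c) => {cE}c c0 hc.
have kc : 0 < k * k + c by rewrite ltr_wpDr // mulr_gt0.
(* Half the constant with which [DD] dominates [sum_e |phi e|^2]; that constant is at most [k], so
   the half gives [e < k]. *)
pose e := k * k * k / (k * k + c) / 2.
have e0 : 0 < e by rewrite /e !divr_gt0 ?mulr_gt0.
have ek : e < k.
  rewrite /e ltr_pdivrMr // ltr_pdivrMr //.
  have p1 : 0 < k * k * k by rewrite !mulr_gt0.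
  have p2 : 0 <= k * c by rewrite mulr_ge0 // ltW.
  have -> : k * 2 * (k * k + c) = 2 * (k * k * k) + 2 * (k * c) by ring.
  by lra.
exists (k - e); first by rewrite subr_gt0 ek /= ltrBlDr ltrDl.
move=> N n phi nN hphi.
rewrite (DD_stable fsup _ nN (_ : (n + m <= n + m + m)%N) hphi); last by lia.
set M := (n + m + m)%N; have := hc M n phi (leqnn _) hphi.
have -> : (k - e)%:C = k%:C + (- e)%:C by rewrite -rmorphD.
rewrite DD_shift; set S := \sum_e0 _; set D := DD _ _ _ _ _ => h.
have D0 : 0 <= D by apply: (Pk M n) => //; rewrite /M; lia.
have {}h : k%:C * k%:C * (k%:C * S) <= (k%:C * k%:C + c%:C) * D.
  by apply: h => psi hpsi; apply: (Pk M (n + m)%N).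
have S0 : 0 <= S := nrm0 _ _.
have /complex_realP[D' DE] := ger0_real D0; have /complex_realP[S' SE] := ger0_real S0.
move: h D0 S0; rewrite DE SE -!(rmorphM, rmorphD) /= lecR !ler0c.
move: D' S' {D DE S SE} => D S h D0 S0; rewrite mulNr subr_ge0 /e.
have q0 : 0 <= k * k * (k * S) / (k * k + c).
  by rewrite divr_ge0 ?mulr_ge0 // ltW.
have {h} : k * k * (k * S) / (k * k + c) <= D by rewrite ler_pdivrMr // [D * _]mulrC.
apply: le_trans.
have -> : k * k * k / (k * k + c) / 2 * S = k * k * (k * S) / (k * k + c) / 2 by ring.
by rewrite ler_pdivrMr // ler_peMr // ler1n.
Qed.

(* The form [DD f N k] is nonnegative for large [k]; if it is so for some
   [k > 0] it is even coercive, hence nonnegative for a smaller [k]. So the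
   infimum of the admissible [k] is [0]. *)
Lemma Fock_column_row N n (phi : E -> W -> C) : (n + m <= N)%N -> (forall e, wsupp n (phi e)) ->
  wdot N (yb f N phi) (yb f N phi) <=
  \sum_e \sum_e' wdot N (wconv (phi e) (f e')) (wconv (phi e) (f e')).
Proof.
move=> nN hphi.
suff : P 0.
  by move=> /(_ N n phi nN hphi); rewrite /DD rmorph0; under eq_bigr do rewrite mul0r addr0; rewrite subr_ge0.
pose S := [set k : R | 0 < k /\ P k]%classic.
have S0 : nonempty S.
  have [c c0 hc] := yb_bound fsup.
  exists (complex.Re c + 1).
  have c1 : 0 <= complex.Re c by rewrite -ler0c RRe_real // ger0_real.
  split; first by lra.
  move=> N' n' psi nN' hpsi; rewrite rmorphD /= (RRe_real (ger0_real c0)) /DD.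
  rewrite subr_ge0; apply: le_trans (hc N' n' psi nN' hpsi) _.
  rewrite mulr_sumr; apply: ler_sum => e _; rewrite rmorph1 mulrDl mul1r.
  rewrite addrCA lerDl; apply: addr_ge0; last exact: ip_ge0.
  by apply: sumr_ge0 => e' _; exact: ip_ge0.
have lb : has_lbound S by exists 0 => k [k0 _]; exact: ltW.
have i0 : 0 <= inf S by apply: lb_le_inf => // k [k0 _]; exact: ltW.
have Pi : P (inf S).
  apply: Plim => d d0.
  have [k [k0 Pk] kd] := @inf_adherent _ S d d0 (conj S0 lb).
  exact: Pup Pk (ltW kd).
have [<-//|ne] := eqVneq (inf S) 0.
have wdot : 0 < inf S by rewrite lt0r ne.
have [k' /andP[k'0 k'l] Pk'] := Pstep wdot Pi.
have h : inf S <= k' by apply: ge_inf.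
by case/negP: (lt_irreflexive k'); exact: lt_le_trans k'l h.
Qed.

End Key.

(** * Archimedean estimates *)

Section Archi.
Variable R : realType.

Lemma expr_small (x e : R) : 0 <= x -> x < 1 -> 0 < e ->
  exists m0, forall m, (m0 <= m)%N -> x ^+ m <= e.
Proof.
move=> x0 x1 e0; have [->|xn0] := eqVneq x 0.
  exists 1%N => -[|m] // _; rewrite expr0n /=; exact: ltW.
have xp : 0 < x by rewrite lt0r xn0.
pose h := x^-1 - 1.
have h0 : 0 < h by rewrite subr_gt0 invf_gt1.
have bern m : 1 + m%:R * h <= x^-1 ^+ m.
  elim: m => [|m IH]; first by rewrite mul0r addr0 expr0.
  rewrite exprS; apply: le_trans (ler_wpM2l _ IH); last by rewrite invr_ge0.
  have -> : x^-1 = 1 + h by rewrite /h addrC subrK.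
  rewrite -natr1 -subr_ge0.
  have -> : (1 + h) * (1 + m%:R * h) - (1 + (m%:R + 1) * h) = m%:R * (h * h) by ring.
  by rewrite mulr_ge0 ?ler0n // mulr_ge0 // ltW.
exists (Num.bound (e^-1 / h)) => m hm.
have lt1 : e^-1 / h < m%:R.
  apply: lt_le_trans (archi_boundP _) _; first by rewrite divr_ge0 ?invr_ge0 ?ltW.
  by rewrite ler_nat.
have : e^-1 <= x^-1 ^+ m.
  apply: le_trans (bern m); move: lt1; rewrite ltr_pdivrMr // => /ltW; lra.
by rewrite exprVn lef_pV2 // posrE exprn_gt0.
Qed.

(** Applied to the partial sums of a square summable function, it finds a block of lengths carrying
    little mass, where the function can be truncated. *)
Lemma small_increment (a : nat -> R) (e : R) : (forall n, 0 <= a n <= 1) -> 0 < e ->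
  exists n, a n.+1 - a n <= e.
Proof.
move=> ha e0; apply: contrapT => /forallNP h.
have h' n : a 0%N + n%:R * e <= a n.
  elim: n => [|n IH]; first by rewrite mul0r addr0.
  have /negP := h n; rewrite -ltNge => hn; rewrite -natr1; lra.
pose n := Num.bound (e^-1).
have : e^-1 < n%:R by apply: archi_boundP; rewrite invr_ge0 ltW.
rewrite -(ltr_pM2r e0) mulVf ?gt_eqF // => h1.
have := h' n; have /andP[] := ha n; have /andP[] := ha 0%N; lra.
Qed.
End Archi.

Lemma sum_pair (C : nmodType) (J E : finType) (F : J * E -> C) :
  \sum_p F p = \sum_n \sum_e F (n, e).
Proof. by rewrite pair_bigA; apply: eq_bigr => -[]. Qed.

(** * Realization of a contractive column by a transfer function *)

Section Realization.
Variables (C : numClosedFieldType) (I E J : finType).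
Local Notation W := (seq I).
Local Notation nsq z := (z * z^*).
Variables (beta : J -> I -> C) (u : J -> E -> C) (tau : J -> C).
Let B i j := \sum_k beta i k * (beta j k)^*.
Let g i j := \sum_e u i e * (u j e)^*.
Hypothesis B1 : forall i j, 1 - B i j != 0.
Let s i j := (1 - B i j)^-1.
(** The [n]-th multiplier of the column takes the value [tau n] at the point [n] and [0] at the
    other points of [J]. *)
Let tt (p : J * J) := tau p.1 * (p.1 == p.2)%:R.
Hypothesis col_psd : psd (fun p q : J * J =>
  (g p.1 q.1 * (p.2 == q.2)%:R - tt p * (tt q)^*) * s p.1 q.1).

Definition wpow j (w : W) : C := \prod_(k <- w) beta j k.

Lemma pw_cons j k w : wpow j (k :: w) = beta j k * wpow j w.
Proof. by rewrite /wpow big_cons. Qed.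

Lemma pw_cat j v w : wpow j (v ++ w) = wpow j v * wpow j w.
Proof. by rewrite /wpow big_cat. Qed.

Lemma SW_pw M i j : wsum M (fun w => wpow i w * (wpow j w)^*) = \sum_(l < M.+1) B i j ^+ l.
Proof.
elim: M => [|M IH]; first by rewrite /= /wpow !big_nil conjC1 mulr1 big_ord1 expr0.
rewrite big_ord_recl /= {1 2}/wpow !big_nil conjC1 mulr1 expr0; congr (_ + _).
under [RHS]eq_bigr do rewrite exprS.
rewrite -mulr_sumr -IH /B mulr_suml; apply: eq_bigr => k _.
by rewrite -SWZl; apply: eq_SW => w; rewrite !pw_cons rmorphM /=; ring.
Qed.

(* A lurking isometry argument: the identity of Gram matrices given by
   [col_psd] produces a contraction whose transfer function is [Om]. *)
Lemma realization : exists Om : J -> E -> W -> C,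
  (forall N q, \sum_n \sum_e wsum N (fun z => nsq (wconv (Om n e) q z)) <= wsum N (fun z => nsq (q z)))
  /\ exists2 K : C, 0 <= K & forall m j n,
   nsq (\sum_e u j e * wsum m (fun w => Om n e w * wpow j w) - tt (j, n)) <= K * B j j ^+ m.
Proof.
have [ga gaE] := psd_gram col_psd.
(* With [G] the matrix of [col_psd], the relation [G * (1 - B) = g delta - tt tt^*] rearranges to
   [g delta + B G = tt tt^* + G], whose two sides are the Gram matrices of [D] and [Rr]. *)
pose D (p : J * J) (a : (J * E) + (I * (J * J))) : C :=
  match a with inl ne => (p.2 == ne.1)%:R * u p.1 ne.2 | inr kr => beta p.1 kr.1 * ga p kr.2 end.
pose Rr (p : J * J) (b : option (J * J)) : C := if b is Some r then ga p r else tt p.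
have gram p q : \sum_a D p a * (D q a)^* = \sum_b Rr p b * (Rr q b)^*.
  rewrite big_sumType /= [RHS](bigD1 None) //=.
  have -> : \sum_(b | b != None) Rr p b * (Rr q b)^* = \sum_r ga p r * (ga q r)^*.
    rewrite (reindex_omap Some id) /=; last by case.
    by apply: eq_bigl => r; rewrite eqxx.
  have -> : \sum_(ne : J * E) (p.2 == ne.1)%:R * u p.1 ne.2 * ((q.2 == ne.1)%:R * u q.1 ne.2)^* =
     g p.1 q.1 * (p.2 == q.2)%:R.
    rewrite sum_pair /=.
    transitivity (\sum_n (n == p.2)%:R * (\sum_e u p.1 e * ((q.2 == n)%:R * u q.1 e)^*)).
      by apply: eq_bigr => n _; rewrite mulr_sumr; apply: eq_bigr => e _; rewrite eq_sym mulrA.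
    rewrite sum_delta /g mulr_suml; apply: eq_bigr => e _.
    by rewrite rmorphM /= conjC_nat [q.2 == _]eq_sym; ring.
  have -> : \sum_(kr : I * (J * J)) beta p.1 kr.1 * ga p kr.2 * (beta q.1 kr.1 * ga q kr.2)^* =
     B p.1 q.1 * \sum_r ga p r * (ga q r)^*.
    rewrite sum_pair /=.
    rewrite /B mulr_suml; apply: eq_bigr => k _; rewrite mulr_sumr; apply: eq_bigr => r _.
    by rewrite rmorphM /=; ring.
  rewrite -gaE; apply/eqP; rewrite -subr_eq0; apply/eqP; rewrite /s.
  set x := g _ _ * _; set y := tt p * _; set b := B _ _.
  have -> : x + b * ((x - y) * (1 - b)^-1) - (y + (x - y) * (1 - b)^-1) =
    (x - y) * (1 - (1 - b) * (1 - b)^-1) by ring.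
  by rewrite divff ?B1 // subrr mulr0.
have [V DV Vc] := gram_contraction gram.
(* The blocks of a linear system with states indexed by [J * J]: [a] and [c] give the output from
   the input and the state, [bt] and [dl] the next state along each letter. *)
pose a n e := V (inl (n, e)) None; pose c n e r := V (inl (n, e)) (Some r).
pose bt k r := V (inr (k, r)) None; pose dl k r r' := V (inr (k, r)) (Some r').
have eqN j n : \sum_e u j e * a n e + \sum_r ga (j, n) r * (\sum_k beta j k * bt k r) = tt (j, n).
  have := DV (j, n) None; rewrite big_sumType /= => <-; congr (_ + _).
    rewrite sum_pair /=.
    transitivity (\sum_n' (n' == n)%:R * (\sum_e u j e * V (inl (n', e)) None)).
      by rewrite sum_delta.
    by apply: eq_bigr => n' _; rewrite mulr_sumr; apply: eq_bigr => e _; rewrite eq_sym mulrA.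
  rewrite [RHS]sum_pair [RHS]exchange_big /=.
  by apply: eq_bigr => r _; rewrite mulr_sumr; apply: eq_bigr => k _; rewrite /bt; ring.
have eqS j n r' : \sum_e u j e * c n e r' + \sum_r ga (j, n) r * (\sum_k beta j k * dl k r r') = ga (j, n) r'.
  have := DV (j, n) (Some r'); rewrite big_sumType /= => <-; congr (_ + _).
    rewrite sum_pair /=.
    transitivity (\sum_n' (n' == n)%:R * (\sum_e u j e * V (inl (n', e)) (Some r'))).
      by rewrite sum_delta.
    by apply: eq_bigr => n' _; rewrite mulr_sumr; apply: eq_bigr => e _; rewrite eq_sym mulrA.
  rewrite [RHS]sum_pair [RHS]exchange_big /=.
  by apply: eq_bigr => r _; rewrite mulr_sumr; apply: eq_bigr => k _; rewrite /dl; ring.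
have sumO (F : option (J * J) -> C) : \sum_b F b = F None + \sum_r F (Some r).
  rewrite (bigD1 None) //=; congr (_ + _).
  rewrite (reindex_omap Some id) /=; last by case.
  by apply: eq_bigl => r; rewrite eqxx.
have contr (x0 : C) (x : J * J -> C) :
   \sum_n \sum_e nsq (a n e * x0 + \sum_r c n e r * x r)
   + \sum_k \sum_r nsq (bt k r * x0 + \sum_r' dl k r r' * x r') <= nsq x0 + \sum_r nsq (x r).
  have := Vc (fun b => if b is Some r then x r else x0).
  rewrite [X in _ <= X]sumO big_sumType /=.
  rewrite [X in X + _ <= _]sum_pair [X in _ + X <= _]sum_pair /=.
  under [X in X + _ <= _ -> _]eq_bigr do under eq_bigr do rewrite sumO.
  by under [X in _ + X <= _ -> _]eq_bigr do under eq_bigr do rewrite sumO.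
(* Impulse response of the state: a unit input at the empty word, then one update per prepended
   letter. [Om] is the corresponding output. *)
pose xi := fix xi (w : W) (r : J * J) {struct w} : C :=
  if w is k :: w' then \sum_r' dl k r r' * xi w' r' + bt k r * (w' == [::])%:R else 0.
pose Om n e w := a n e * (w == [::])%:R + \sum_r c n e r * xi w r.
exists Om; split.
  move=> N q; pose X z r := wconv (fun w => xi w r) q z.
  have cvd (b : C) z : wconv (fun w => b * (w == [::])%:R) q z = b * q z.
    rewrite cvZl; congr (_ * _); case: z => [|k z]; first by rewrite cv_nil eqxx mul1r.
    rewrite cv_cons eqxx mul1r -[RHS]addr0; congr (_ + _); rewrite -[RHS](spl0 _ z).
    by apply: eq_spl => v w _; rewrite mul0r.
  have cvs (K : finType) (h : K -> C) (F : K -> W -> C) z :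
     wconv (fun w => \sum_r h r * F r w) q z = \sum_r h r * wconv (F r) q z.
    rewrite /wconv -[RHS](eq_bigr _ (fun r _ => splZ _ _ _)) spl_sum.
    by apply: eq_spl => v w _; rewrite mulr_suml; apply: eq_bigr => r _; rewrite mulrA.
  have outE n e z : wconv (Om n e) q z = a n e * q z + \sum_r c n e r * X z r.
    by rewrite /Om cvDl cvd cvs.
  have X0 r : X [::] r = 0 by rewrite /X cv_nil mul0r.
  have XS k z r : X (k :: z) r = bt k r * q z + \sum_r' dl k r r' * X z r'.
    by rewrite /X cv_cons mul0r add0r /= cvDl cvs cvd addrC.
  pose h z := \sum_r nsq (X z r); pose o z := \sum_n \sum_e nsq (wconv (Om n e) q z).
  have h0 z : 0 <= h z by apply: sumr_ge0 => r _; exact: mul_conjC_ge0.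
  (* Energy balance: output and next states weigh at most input and present state. Summed over words
     the states drop out, because the state at the empty word is [0]. *)
  have step z : o z + \sum_k h (k :: z) <= nsq (q z) + h z.
    have := contr (q z) (X z); rewrite /o /h.
    under [X in X + _ <= _ -> _]eq_bigr do under eq_bigr do rewrite -outE.
    by under [X in _ + X <= _ -> _]eq_bigr do under eq_bigr do rewrite -XS.
  have -> : \sum_n \sum_e wsum N (fun z => nsq (wconv (Om n e) q z)) = wsum N o.
    by rewrite /o SW_sum; apply: eq_bigr => n _; rewrite SW_sum.
  have : wsum N o + wsum N (fun z => \sum_k h (k :: z)) <= wsum N (fun z => nsq (q z)) + wsum N h.
    by rewrite -!SWD; apply: SW_le.
  have : wsum N h <= wsum N (fun z => \sum_k h (k :: z)).
    have -> : wsum N (fun z => \sum_k h (k :: z)) = wsum N.+1 h.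
      have hn : h [::] = 0 by rewrite /h big1 // => r _; rewrite X0 mul0r.
      by rewrite SW_sum /= hn add0r.
    elim: N {o step} h h0 => [|N IH] H H0; first by rewrite /= lerDl sumr_ge0.
    rewrite [wsum N.+1 H]/= [wsum N.+2 H]/= lerD2l; apply: ler_sum => i _.
    by apply: IH => w.
  move=> h1 h2; rewrite -(lerD2r (wsum N h)); apply: le_trans h2.
  by rewrite lerD2l.
(* Evaluation of the states at the point [j], cut at length [m]. The increments [Dl] shrink by a
   factor [B j j] in squared norm at each step, and the interpolation error is a fixed combination
   of them. *)
pose Z m j r := wsum m (fun w => xi w r * wpow j w).
have Z0 j r : Z 0%N j r = 0 by rewrite /Z /= mul0r.
have ZS m j r : Z m.+1 j r = \sum_k beta j k * (bt k r + \sum_r' dl k r r' * Z m j r').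
  rewrite /Z /= mul0r add0r; apply: eq_bigr => k _.
  transitivity (wsum m (fun w => beta j k * (bt k r * ((w == [::])%:R * wpow j w)) +
     \sum_r' beta j k * (dl k r r' * (xi w r' * wpow j w)))).
    apply: eq_SW => w; rewrite pw_cons -mulr_sumr.
    under [in RHS]eq_bigr do rewrite mulrA.
    rewrite -mulr_suml; ring.
  rewrite SWD SW_sum mulrDr mulr_sumr; congr (_ + _).
    rewrite !SWZl (@SW_delta _ _ _ _ 1) ?mulr1 //; first by rewrite eqxx /wpow big_nil mulr1.
    by move=> w /negPf ->; rewrite mul0r.
  by apply: eq_bigr => r' _; rewrite !SWZl.
pose Dl m j r := Z m.+1 j r - Z m j r.
have DS m j r : Dl m.+1 j r = \sum_k beta j k * (\sum_r' dl k r r' * Dl m j r').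
  rewrite /Dl ZS (ZS m) -sumrB; apply: eq_bigr => k _; rewrite -mulrBr; congr (_ * _).
  rewrite opprD addrACA subrr add0r -sumrB; apply: eq_bigr => r' _; ring.
have CSk j (y : I -> C) : nsq (\sum_k beta j k * y k) <= B j j * \sum_k nsq (y k).
  apply: (@le_trans _ _ ((\sum_k beta j k * (beta j k)^*) * (\sum_k (y k)^* * ((y k)^*)^*))).
    have -> : \sum_k beta j k * y k = \sum_k beta j k * ((y k)^*)^*.
      by apply: eq_bigr => k _; rewrite conjCK.
    apply: psd2_det => x y'.
    have := (@sumr_ge0 C I (index_enum _) predT (fun k => nsq (x * beta j k + y' * (y k)^*)) (fun k _ => mul_conjC_ge0 _)).
    congr (0 <= _).
    rewrite rmorph_sum !mulr_sumr -!big_split; apply: eq_bigr => k _ /=.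
    by rewrite !(rmorphD, rmorphM) /= !conjCK; ring.
  rewrite le_eqVlt; apply/orP; left; apply/eqP; congr (_ * _).
  by apply: eq_bigr => k _; rewrite conjCK mulrC.
pose nD m j := \sum_r nsq (Dl m j r).
have B0 j : 0 <= B j j by apply: sumr_ge0 => k _; exact: mul_conjC_ge0.
have nDS m j : nD m.+1 j <= B j j * nD m j.
  apply: (@le_trans _ _ (\sum_r B j j * \sum_k nsq (\sum_r' dl k r r' * Dl m j r'))).
    by apply: ler_sum => r _; rewrite DS.
  rewrite -mulr_sumr; apply: ler_wpM2l => //.
  have := contr 0 (Dl m j); rewrite mul0r add0r; apply: le_trans.
  rewrite exchange_big /=.
  apply: (@le_trans _ _ (\sum_k \sum_r nsq (bt k r * 0 + \sum_r' dl k r r' * Dl m j r'))).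
    by apply: ler_sum => k _; apply: ler_sum => r _; rewrite mulr0 add0r.
  by rewrite lerDr; apply: sumr_ge0 => n _; apply: sumr_ge0 => e _; exact: mul_conjC_ge0.
have nDm m j : nD m j <= B j j ^+ m * nD 0%N j.
  elim: m => [|m IH]; first by rewrite expr0 mul1r.
  by apply: le_trans (nDS m j) _; rewrite exprS -mulrA; apply: ler_wpM2l.
have errE m j n : \sum_e u j e * wsum m (fun w => Om n e w * wpow j w) - tt (j, n) =
   - \sum_r ga (j, n) r * Dl m j r.
  have OmE e : wsum m (fun w => Om n e w * wpow j w) = a n e + \sum_r c n e r * Z m j r.
    transitivity (wsum m (fun w => a n e * ((w == [::])%:R * wpow j w) + \sum_r c n e r * (xi w r * wpow j w))).
      apply: eq_SW => w; rewrite /Om mulrDl mulr_suml; congr (_ + _); first by rewrite mulrA.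
      by apply: eq_bigr => r _; rewrite mulrA.
    rewrite SWD SW_sum SWZl (@SW_delta _ _ _ _ 1) ?mulr1 //.
    - by congr (_ + _); apply: eq_bigr => r _; rewrite SWZl.
    - by rewrite eqxx /wpow big_nil mulr1.
    - by move=> w /negPf ->; rewrite mul0r.
  rewrite -eqN; under eq_bigr do rewrite OmE mulrDr.
  rewrite big_split /=.
  have -> : \sum_e u j e * (\sum_r c n e r * Z m j r) = \sum_r (\sum_e u j e * c n e r) * Z m j r.
    under eq_bigr do rewrite mulr_sumr.
    rewrite exchange_big; apply: eq_bigr => r _; rewrite mulr_suml.
    by apply: eq_bigr => e _; rewrite mulrA.
  have -> : \sum_r (\sum_e u j e * c n e r) * Z m j r =
     \sum_r ga (j, n) r * Z m j r - \sum_r ga (j, n) r * (\sum_k beta j k * (\sum_r' dl k r r' * Z m j r')).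
    transitivity (\sum_r' (ga (j, n) r' - \sum_r ga (j, n) r * (\sum_k beta j k * dl k r r')) * Z m j r').
      by apply: eq_bigr => r' _; rewrite -{1}(eqS j n r') addrK.
    under eq_bigr do rewrite mulrBl.
    rewrite sumrB; congr (_ - _).
    under eq_bigr do rewrite mulr_suml.
    rewrite exchange_big; apply: eq_bigr => r _ /=.
    rewrite [in RHS]mulr_sumr; under [RHS]eq_bigr do rewrite !mulr_sumr.
    rewrite [RHS]exchange_big /=; apply: eq_bigr => r' _.
    rewrite -mulrA mulr_suml mulr_sumr; apply: eq_bigr => k _; ring.
  have -> : \sum_r ga (j, n) r * Dl m j r = \sum_r ga (j, n) r * (\sum_k beta j k * bt k r)
     + \sum_r ga (j, n) r * (\sum_k beta j k * (\sum_r' dl k r r' * Z m j r'))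
     - \sum_r ga (j, n) r * Z m j r.
    rewrite -big_split -sumrB; apply: eq_bigr => r _ /=; rewrite /Dl ZS.
    have -> : \sum_k beta j k * (bt k r + \sum_r' dl k r r' * Z m j r') =
      \sum_k beta j k * bt k r + \sum_k beta j k * (\sum_r' dl k r r' * Z m j r').
      by rewrite -big_split; apply: eq_bigr => k _; rewrite mulrDr.
    ring.
  ring.
pose K := \sum_(j : J) \sum_(n : J) (#|{: J * J}|%:R * \sum_r nsq (ga (j, n) r)) * nD 0%N j.
have nD0 m j : 0 <= nD m j by apply: sumr_ge0 => r _; exact: mul_conjC_ge0.
have gpos j n : 0 <= #|{: J * J}|%:R * \sum_r nsq (ga (j, n) r).
  by rewrite mulr_ge0 ?ler0n // sumr_ge0 // => r _; exact: mul_conjC_ge0.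
have Kpos j n : 0 <= (#|{: J * J}|%:R * \sum_r nsq (ga (j, n) r)) * nD 0%N j by exact: mulr_ge0.
exists K; first by apply: sumr_ge0 => j _; apply: sumr_ge0.
move=> m j n; rewrite errE rmorphN mulrNN.
apply: (@le_trans _ _ ((#|{: J * J}|%:R * \sum_r nsq (ga (j, n) r)) * nD m j)).
  apply: le_trans (nsq_sum_le _) _; rewrite -mulrA; apply: ler_wpM2l; first exact: ler0n.
  rewrite mulr_suml; apply: ler_sum => r _; rewrite rmorphM /=.
  have -> : ga (j, n) r * Dl m j r * ((ga (j, n) r)^* * (Dl m j r)^*) = nsq (ga (j, n) r) * nsq (Dl m j r) by ring.
  apply: ler_wpM2l; first exact: mul_conjC_ge0.
  by rewrite /nD (bigD1 r) //= lerDl sumr_ge0 // => r' _; exact: mul_conjC_ge0.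
apply: le_trans (ler_wpM2l (gpos j n) (nDm m j)) _.
rewrite mulrCA [in X in _ <= X]mulrC; apply: ler_wpM2l; first exact: exprn_ge0.
rewrite /K (bigD1 j) //= (bigD1 n) //= -addrA lerDl addr_ge0 //.
  by apply: sumr_ge0 => n' _.
by apply: sumr_ge0 => j' _; apply: sumr_ge0.
Qed.

End Realization.

Lemma psd1 (C : numClosedFieldType) (J : finType) : @psd C J (fun _ _ => 1).
Proof.
move=> c; rewrite (_ : \sum_i _ = (\sum_i c i) * (\sum_i c i)^*) ?mul_conjC_ge0 //.
rewrite mulrC rmorph_sum mulr_suml; apply: eq_bigr => i _; rewrite mulr_sumr.
by apply: eq_bigr => j _; rewrite mulr1.
Qed.

Lemma psdX (C : numClosedFieldType) (J : finType) (K : J -> J -> C) n :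
  psd K -> psd (fun i j => K i j ^+ n).
Proof.
move=> pK; elim: n => [|n IH] c.
  exact: (@psd1 C J c).
have := psdM pK IH c; congr (0 <= _); apply: eq_bigr => i _; apply: eq_bigr => j _.
by rewrite exprS.
Qed.

(** * From the Fock space inequality to kernels on a finite set *)

Section ColumnRow.
Variables (R : realType) (I E J : finType).
Local Notation C := R[i].
Local Notation W := (seq I).
Local Notation nsq z := (z * z^*).
Local Notation "x %:C" := (real_complex R x).
Variables (beta : J -> I -> C) (u : J -> E -> C) (tau : J -> C).
Let B i j := \sum_k beta i k * (beta j k)^*.
Let g i j := \sum_e u i e * (u j e)^*.
Hypothesis B1 : forall i j, 1 - B i j != 0.
Hypothesis Blt1 : forall j, B j j < 1.
Let s i j := (1 - B i j)^-1.
Hypothesis s_psd : psd s.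
Let tt (p : J * J) := tau p.1 * (p.1 == p.2)%:R.
Hypothesis col_psd : psd (fun p q : J * J =>
  (g p.1 q.1 * (p.2 == q.2)%:R - tt p * (tt q)^*) * s p.1 q.1).
Variable c : J -> C.
Let F := \sum_i \sum_j (c i)^* * c j * (g i j * s i j).
Local Notation pw := (wpow beta).

Let nsq0 (x : C) : 0 <= nsq x := mul_conjC_ge0 x.

Let Bge0 j : 0 <= B j j.
Proof. by apply: sumr_ge0 => k _; exact: mul_conjC_ge0. Qed.

Let sdiff M i j : s i j - \sum_(l < M.+1) B i j ^+ l = B i j ^+ M.+1 * s i j.
Proof.
have h : (1 - B i j) * \sum_(l < M.+1) B i j ^+ l = 1 - B i j ^+ M.+1.
  by rewrite -[LHS]opprK -mulNr opprB -subrX1 opprB.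
have -> : \sum_(l < M.+1) B i j ^+ l = s i j * (1 - B i j ^+ M.+1).
  by rewrite -h mulrA mulVf ?mul1r ?B1.
ring.
Qed.

(** Components of the combination, with coefficients [c], of the kernels of [g * s], realized in the
    Fock space tensored with the space of the vectors [u]. They are symmetric because [wpow] ignores
    the order of the letters. *)
Let f0 e w := \sum_j c j * (u j e)^* * (pw j w)^*.
Let ff M e w : C := f0 e w * (size w <= M)%:R.

Let ff_sup M e : wsupp M (ff M e).
Proof. by move=> w hw; rewrite /ff leqNgt hw mulr0. Qed.

Let ff_sym M e v w : perm_eq v w -> ff M e v = ff M e w.
Proof.
move=> vw; rewrite /ff (perm_size vw); congr (_ * _); apply: eq_bigr => j _.
by rewrite /wpow (perm_big _ vw).
Qed.

(** The missing tail is the form of [g * B ^+ M.+1 * s], nonnegative by the Schur product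
    theorem. *)
Let ff_norm M : \sum_e wsum M (fun w => nsq (ff M e w)) <= F.
Proof.
have -> : \sum_e wsum M (fun w => nsq (ff M e w)) =
   \sum_i \sum_j (c i)^* * c j * (g i j * \sum_(l < M.+1) B i j ^+ l).
  transitivity (\sum_e wsum M (fun w => \sum_i \sum_j ((c i)^* * c j * (u i e * (u j e)^*)) * (pw i w * (pw j w)^*))).
    apply: eq_bigr => e _; apply: eq_SW_in => w hw; rewrite /ff hw mulr1 /f0.
    rewrite mulrC rmorph_sum mulr_suml; apply: eq_bigr => i _; rewrite mulr_sumr.
    by apply: eq_bigr => j _; rewrite !rmorphM /= !conjCK; ring.
  under eq_bigr do rewrite SW_sum.
  rewrite exchange_big; apply: eq_bigr => i _ /=.
  under eq_bigr do rewrite SW_sum.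
  rewrite exchange_big; apply: eq_bigr => j _ /=.
  under eq_bigr do rewrite SWZl SW_pw.
  by rewrite -mulr_suml -mulr_sumr -/(g i j) mulrA.
rewrite -subr_ge0 /F -sumrB.
have := psdM (psdM (@gram_psd C J E u) (psdX M.+1 (@gram_psd C J I beta))) s_psd c.
congr (0 <= _); apply: eq_bigr => i _; rewrite -sumrB; apply: eq_bigr => j _.
rewrite -/(g i j) -/(B i j) -mulrBr -mulrBr sdiff; ring.
Qed.

Variable Om : J -> E -> W -> C.
Hypothesis Om_contr : forall N q,
  \sum_n \sum_e wsum N (fun z => nsq (wconv (Om n e) q z)) <= wsum N (fun z => nsq (q z)).

Let TT m j n := \sum_e u j e * wsum m (fun w => Om n e w * pw j w).
Let yy M n x := \sum_j (c j)^* * pw j x * TT (M - size x) j n.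

Let Om_sum N : \sum_n \sum_e wsum N (fun z => nsq (Om n e z)) <= 1.
Proof.
have := Om_contr N (@delta C I).
have -> : wsum N (fun z => nsq (@delta C I z)) = 1.
  apply: SW_delta => [|w /negPf wn]; first by rewrite /delta eqxx conjC1 mulr1.
  by rewrite /delta wn mul0r.
apply: le_trans; rewrite le_eqVlt; apply/orP; left; apply/eqP.
apply: eq_bigr => n _; apply: eq_bigr => e _; apply: eq_SW => z.
have -> : wconv (Om n e) (@delta C I) z = Om n e z; last by [].
elim: z (Om n e) => [|k z IH] G; first by rewrite cv_nil /delta eqxx mulr1.
by rewrite cv_cons {1}/delta /= mulr0 add0r IH.
Qed.

(** [Om] need not have finite support, and cutting it at length [L] destroys contractivity. As
    [ff M] lives on words of length at most [M], products on words longer than [L] only see the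
    coefficients of [Om] of length between [L0] and [L = L0 + M]; [L0] is chosen so that these carry
    little mass. *)
Let yy_le M (d : R) : 0 < d -> \sum_n wsum M (fun x => nsq (yy M n x)) <= F + d%:C.
Proof.
move=> d0.
have /boolp.choice[cr hcr] : forall e, exists k : C, 0 <= k /\ forall N G,
    wsum N (fun z => nsq (wconv G (ff M e) z)) <= k * wsum N (fun z => nsq (G z)).
  by move=> e; have [k k0 h] := cv_right_bound (@ff_sup M e); exists k.
pose Cr := \sum_e cr e.
have Cr0 : 0 <= Cr by apply: sumr_ge0 => e _; case: (hcr e).
have /complex_realP[cR CrE] := ger0_real Cr0.
have cR0 : 0 <= cR by move: Cr0; rewrite CrE ler0c.
pose S N : C := \sum_n \sum_e wsum N (fun z => nsq (Om n e z)).
have S0 N : 0 <= S N by apply: sumr_ge0 => n _; apply: sumr_ge0 => e _; apply: SW_ge0 => w.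
have SE N : S N = (complex.Re (S N))%:C by rewrite RRe_real // ger0_real.
have c1 : 0 < cR + 1 by lra.
have S01 n : 0 <= complex.Re (S (n * M)%N) <= 1.
  by rewrite -ler0c -SE S0 /= -lecR -SE rmorph1; exact: Om_sum.
have [k hk] := small_increment S01 (divr_gt0 d0 c1).
pose L0 := (k * M)%N; pose L := (k.+1 * M)%N; pose N := (L + M)%N.
have LE : L = (M + L0)%N by rewrite /L mulSn.
pose phi n e w : C := Om n e w * (size w <= L)%:R.
pose chi n e w : C := Om n e w * ((L0 < size w)%N && (size w <= L)%N)%:R.
have phisup n e : wsupp L (phi n e) by move=> w hw; rewrite /phi leqNgt hw mulr0.
have key n := @Fock_column_row R I E (ff M) M (@ff_sup M) (@ff_sym M) N L (phi n) (leqnn _) (phisup n).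
have ybE n x : (size x <= M)%N -> yb (ff M) N (phi n) x = yy M n x.
  move=> hx; rewrite /yb /yy.
  transitivity (\sum_e wsum (M - size x) (fun w => Om n e w * (f0 e (w ++ x))^*)).
    apply: eq_bigr => e _; rewrite (@SW_supp _ _ (M - size x) N); last by rewrite /N; lia.
      apply: eq_SW_in => w hw; rewrite /phi /ff size_cat.
      have -> : (size w <= L)%N by rewrite LE; lia.
      have -> : (size w + size x <= M)%N by lia.
      by rewrite !mulr1.
    move=> w hw; rewrite /ff size_cat (_ : (size w + size x <= M)%N = false) ?mulr0 ?conjC0 ?mulr0 //; lia.
  under eq_bigr => e _.
    rewrite (_ : wsum _ _ = wsum (M - size x) (fun w => \sum_j ((c j)^* * pw j x * u j e) * (Om n e w * pw j w))); last first.
      apply: eq_SW => w; rewrite /f0 rmorph_sum mulr_sumr; apply: eq_bigr => j _.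
      by rewrite !rmorphM /= !conjCK pw_cat; ring.
    rewrite SW_sum.
    over.
  rewrite exchange_big; apply: eq_bigr => j _; rewrite /TT mulr_sumr; apply: eq_bigr => e _.
  by rewrite SWZl; ring.
have lhs n : wsum M (fun x => nsq (yy M n x)) <= wdot N (yb (ff M) N (phi n)) (yb (ff M) N (phi n)).
  rewrite /wdot (@SW_supp _ _ M N); last by rewrite /N; lia.
    by rewrite le_eqVlt; apply/orP; left; apply/eqP/eq_SW_in => x hx; rewrite ybE.
  move=> x hx; rewrite /yb big1 ?mul0r // => e _; rewrite -[RHS](SW0 _ I N); apply: eq_SW => w.
  by rewrite (@ff_sup M e) ?conjC0 ?mulr0 // size_cat; lia.
have pt n e e' z : nsq (wconv (phi n e) (ff M e') z) <=
   (size z <= L)%:R * nsq (wconv (Om n e) (ff M e') z) + nsq (wconv (chi n e) (ff M e') z).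
  have [hz|hz] := leqP (size z) L.
    rewrite mul1r (_ : wconv (phi n e) _ z = wconv (Om n e) (ff M e') z) ?lerDl //.
    apply: eq_spl => v w E'; rewrite /phi (_ : (size v <= L)%N) ?mulr1 //.
    by move: hz; rewrite -E' size_cat; lia.
  rewrite mul0r add0r (_ : wconv (phi n e) _ z = wconv (chi n e) (ff M e') z) //.
  apply: eq_spl => v w E'; rewrite /phi /chi.
  have [hv|hv] := ltnP L0 (size v); first by [].
  rewrite (@ff_sup M e' w) ?mulr0 //; move: hz; rewrite -E' size_cat LE; lia.
have chiS : \sum_n \sum_e wsum N (fun z => nsq (chi n e z)) = S L - S L0.
  rewrite /S -sumrB; apply: eq_bigr => n _; rewrite -sumrB; apply: eq_bigr => e _.
  have cut K : (K <= N)%N -> wsum K (fun z => nsq (Om n e z)) = wsum N (fun z => nsq (Om n e z) * (size z <= K)%:R).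
    move=> KN; rewrite [RHS](@SW_supp _ _ K) //.
      by apply: eq_SW_in => w ->; rewrite mulr1.
    by move=> w hw; rewrite leqNgt hw mulr0.
  rewrite !cut ?/N; try lia.
  rewrite -SWB; apply: eq_SW => z; rewrite /chi rmorphM /= conjC_nat.
  case: (leqP (size z) L0) => h1; case: (leqP (size z) L) => h2 //=; rewrite ?mulr1 ?mulr0 ?subrr ?subr0 ?mul0r //.
  by move: h1 h2; rewrite LE; lia.
apply: (@le_trans _ _ (\sum_n \sum_e \sum_e' wdot N (wconv (phi n e) (ff M e')) (wconv (phi n e) (ff M e')))).
  by apply: ler_sum => n _; exact: le_trans (lhs n) (key n).
apply: (@le_trans _ _ (\sum_e' (wsum L (fun z => nsq (ff M e' z)) + cr e' * (S L - S L0)))).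
  under eq_bigr do rewrite exchange_big.
  rewrite exchange_big; apply: ler_sum => e' _ /=.
  apply: (@le_trans _ _ (\sum_n \sum_e (wsum L (fun z => nsq (wconv (Om n e) (ff M e') z)) + cr e' * wsum N (fun z => nsq (chi n e z))))).
    apply: ler_sum => n _; apply: ler_sum => e _.
    apply: le_trans (SW_le N (pt n e e')) _; rewrite SWD; apply: lerD; last by case: (hcr e').
    rewrite (@SW_supp _ _ L N); last by rewrite /N; lia.
      by rewrite le_eqVlt; apply/orP; left; apply/eqP/eq_SW_in => z ->; rewrite mul1r.
    by move=> z hz; rewrite leqNgt hz mul0r.
  under eq_bigr do rewrite big_split /= -mulr_sumr.
  by rewrite big_split /= -mulr_sumr chiS lerD2r; exact: Om_contr.
rewrite big_split /= -mulr_suml; apply: lerD.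
  apply: le_trans (ff_norm M); apply: ler_sum => e _.
  rewrite (@SW_supp _ _ M L) //; last by rewrite LE; lia.
  by move=> w hw; rewrite (@ff_sup M e w) // mul0r.
rewrite -/Cr CrE (SE L) (SE L0) -rmorphB -rmorphM lecR.
apply: le_trans (ler_wpM2l cR0 hk) _.
rewrite mulrCA -[X in _ <= X]mulr1 ler_pM2l // ler_pdivrMr ?mul1r; lra.
Qed.

Variable K : C.
Hypothesis K0 : 0 <= K.
Hypothesis Om_err : forall m j n, nsq (TT m j n - tt (j, n)) <= K * B j j ^+ m.

(** The limit of [yy M n x] as [M] grows, since [TT] tends to [tt]. *)
Let t n x := (c n)^* * tau n * pw n x.

Let pw_le1 j w : nsq (pw j w) <= 1.
Proof.
elim: w => [|k w IH]; first by rewrite /wpow big_nil conjC1 mulr1.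
rewrite pw_cons rmorphM /=.
have -> : beta j k * pw j w * ((beta j k)^* * (pw j w)^*) = nsq (beta j k) * nsq (pw j w) by ring.
rewrite -[1]mulr1; apply: ler_pM => //.
apply: le_trans (ltW (Blt1 j)); rewrite /B (bigD1 k) //= lerDl; apply: sumr_ge0 => i _.
exact: nsq0.
Qed.

Let BE j : exists b : R, [/\ B j j = b%:C, 0 <= b & b < 1].
Proof.
have /complex_realP[b bE] := ger0_real (Bge0 j); exists b; split => //.
  by move: (Bge0 j); rewrite bE ler0c.
by move: (Blt1 j); rewrite bE -[1]/(1%:C) ltcR.
Qed.

Let unif_small (e : R) : 0 < e -> exists m, forall j, B j j ^+ m <= e%:C.
Proof.
move=> e0.
have /boolp.choice[m0 hm0] : forall j, exists m0, forall m, (m0 <= m)%N -> B j j ^+ m <= e%:C.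
  move=> j; have [b [-> b0 b1]] := BE j; have [m0 h] := expr_small b0 b1 e0.
  by exists m0 => m hm; rewrite -rmorphXn lecR; exact: h.
exists (\max_j m0 j) => j; apply: hm0; exact: leq_bigmax.
Qed.

Let t_le D0 : \sum_n wsum D0 (fun x => nsq (t n x)) <= F.
Proof.
have F0 : 0 <= F.
  have := psdM (@gram_psd C J E u) s_psd c; congr (0 <= _).
rewrite -subr_ge0; apply: (@ge0_limit _ _ (F + 4)); last by rewrite addr_ge0 // ler0n.
move=> d d0.
(* Parameter of Young's inequality; the final error is [h * (F + 2 + 2 * h)], and [h <= 1] bounds it
   by [h * (F + 4)]. *)
pose h : R := Num.min d 1.
have h0 : 0 < h by rewrite lt_min d0 ltr01.
have h1 : h <= 1 by rewrite ge_min lexx orbT.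
have hd : h <= d by rewrite ge_min lexx.
suff : \sum_n wsum D0 (fun x => nsq (t n x)) <= F + h%:C * (F + 4).
  rewrite addrAC subr_ge0 => /le_trans; apply; rewrite lerD2l.
  by apply: ler_wpM2r; rewrite ?addr_ge0 ?ler0n // lecR.
pose Q := #|J|%:R * (wsum D0 (fun _ : W => 1) * (#|J|%:R * \sum_j nsq (c j) * K)).
have Q0 : 0 <= Q.
  apply: mulr_ge0; first exact: ler0n.
  apply: mulr_ge0; first by apply: SW_ge0 => w; exact: ler01.
  apply: mulr_ge0; first exact: ler0n.
  by apply: sumr_ge0 => j _; exact: mulr_ge0.
have /complex_realP[q QE] := ger0_real Q0.
have q0 : 0 <= q by move: Q0; rewrite QE ler0c.
(* The approximation error must be at most [h ^ 2], because Young's inequality multiplies it by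
   [1 + h^-1]. [Q] collects the number of indices and words and the size of the coefficients. *)
have [m hm] := @unif_small (h * h / (q + 1)) (divr_gt0 (mulr_gt0 h0 h0) (ltr_wpDl q0 ltr01)).
pose M := (m + D0)%N.
have err n x : (size x <= D0)%N -> nsq (yy M n x - t n x) <=
   (#|J|%:R * \sum_j nsq (c j) * K) * (h * h / (q + 1))%:C.
  move=> hx.
  have -> : yy M n x - t n x = \sum_j (c j)^* * pw j x * (TT (M - size x) j n - tt (j, n)).
    have -> : t n x = \sum_j (c j)^* * pw j x * tt (j, n).
      rewrite /t -(@sum_delta _ _ n (fun j => (c j)^* * tau j * pw j x)).
      by apply: eq_bigr => j _; rewrite /tt /=; ring.
    by rewrite /yy -sumrB; apply: eq_bigr => j _; ring.
  apply: le_trans (nsq_sum_le _) _; rewrite -[X in _ <= X]mulrA; apply: ler_wpM2l; first exact: ler0n.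
  rewrite mulr_suml; apply: ler_sum => j _.
  rewrite (_ : nsq _ = nsq (c j) * (nsq (pw j x) * nsq (TT (M - size x) j n - tt (j, n)))); last first.
    by rewrite !rmorphM /= conjCK; ring.
  rewrite -[X in _ <= X]mulrA; apply: ler_wpM2l => //.
  apply: (@le_trans _ _ (1 * (K * B j j ^+ m))).
    apply: ler_pM => //; apply: le_trans (Om_err _ _ _) _; apply: ler_wpM2l => //.
    rewrite (_ : (M - size x = m + (D0 - size x))%N); last by rewrite /M; lia.
    rewrite exprD -[X in _ <= X]mulr1; apply: ler_wpM2l; first exact: exprn_ge0.
    by apply: exprn_ile1 => //; exact: ltW.
  by rewrite mul1r; apply: ler_wpM2l.
pose hC := h%:C; have hC0 : 0 < hC by rewrite ltcR.
have hCr : hC^* = hC by apply/CrealP/gtr0_real.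
have young (a b : C) : nsq a <= (1 + hC) * nsq b + (1 + hC^-1) * nsq (b - a).
  have -> : (1 + hC) * nsq b + (1 + hC^-1) * nsq (b - a) = nsq a +
     hC^-1 * nsq ((1 + hC) * b - a).
    have hn : hC != 0 by rewrite gt_eqF.
    rewrite !(rmorphB, rmorphM, rmorphD) /= rmorph1 hCr.
    field.
    exact: hn.
  by rewrite lerDl mulr_ge0 // invr_ge0 ltW.
apply: (@le_trans _ _ ((1 + hC) * (\sum_n wsum D0 (fun x => nsq (yy M n x))) + (1 + hC^-1) * (\sum_n wsum D0 (fun x => nsq (yy M n x - t n x))))).
  rewrite !mulr_sumr -big_split; apply: ler_sum => n _ /=.
  by rewrite -!SWZl -SWD; apply: SW_le => x; exact: young.
have p1 : \sum_n wsum D0 (fun x => nsq (yy M n x)) <= F + hC.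
  apply: le_trans (yy_le M h0); apply: ler_sum => n _.
  have : forall H : W -> C, (forall w, 0 <= H w) -> wsum D0 H <= wsum (m + D0) H.
    elim: (D0) => [|D IH] H H0.
      rewrite addn0; case: (m) => //= m'; rewrite lerDl; apply: sumr_ge0 => i _.
      by apply: SW_ge0 => w.
    rewrite addnS /= lerD2l; apply: ler_sum => i _; exact: IH.
  by apply => w.
have p2 : \sum_n wsum D0 (fun x => nsq (yy M n x - t n x)) <= hC * hC.
  apply: (@le_trans _ _ (Q * (h * h / (q + 1))%:C)).
    apply: (@le_trans _ _ (\sum_(n : J) wsum D0 (fun _ : W => 1 * ((#|J|%:R * \sum_j nsq (c j) * K) * (h * h / (q + 1))%:C)))).
      apply: ler_sum => n _.
      rewrite (@eq_SW_in _ _ _ _ (fun x => nsq (yy M n x - t n x) * (size x <= D0)%:R)); last first.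
        by move=> w ->; rewrite mulr1.
      apply: SW_le => x; case: leqP => hx; first by rewrite mulr1 mul1r; exact: err.
      rewrite mulr0 mul1r; apply: mulr_ge0; last by rewrite ler0c divr_ge0 ?mulr_ge0 ?ltW // ltr_wpDl.
      apply: mulr_ge0; first exact: ler0n.
      by apply: sumr_ge0 => j _; exact: mulr_ge0.
    by rewrite sumr_const SWZr -[X in X <= _]mulr_natl le_eqVlt; apply/orP; left; apply/eqP; rewrite /Q; ring.
  rewrite QE -!rmorphM lecR mulrCA -[X in _ <= X]mulr1; apply: ler_wpM2l; first by rewrite mulr_ge0 // ltW.
  by rewrite ler_pdivrMr ?mul1r ?ltr_wpDl // lerDl ler01.
have hC1 : hC <= 1 by rewrite -[1]/(1%:C) lecR.
apply: (@le_trans _ _ ((1 + hC) * (F + hC) + (1 + hC^-1) * (hC * hC))).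
  apply: lerD; apply: ler_wpM2l => //; rewrite addr_ge0 ?ler01 ?invr_ge0 // ltW //.
have -> : (1 + hC) * (F + hC) + (1 + hC^-1) * (hC * hC) = F + hC * (F + 2 + 2 * hC).
  have hn : hC != 0 by rewrite gt_eqF.
  by field.
rewrite lerD2l; apply: ler_wpM2l; first exact: ltW.
rewrite -addrA lerD2l -subr_ge0 (_ : 4 - (2 + 2 * hC) = 2 * (1 - hC)); last by ring.
by rewrite mulr_ge0 ?ler0n // subr_ge0.
Qed.

Lemma column_row_aux : \sum_n nsq (c n) * nsq (tau n) * s n n <= F.
Proof.
pose Q := \sum_n nsq (c n) * nsq (tau n) * s n n.
have s0 n : 0 <= s n n := psd_diag_ge0 n s_psd.
have Q0 : 0 <= Q by apply: sumr_ge0 => n _; apply: mulr_ge0 => //; apply: mulr_ge0.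
rewrite -subr_ge0; apply: (@ge0_limit _ _ Q) => // d d0.
have [m hm] := unif_small d0.
rewrite addrAC subr_ge0 -lerBlDr; apply: le_trans (t_le m).
rewrite /Q mulr_sumr -sumrB; apply: ler_sum => n _.
have -> : wsum m (fun x => nsq (t n x)) = nsq (c n) * nsq (tau n) * (s n n - B n n ^+ m.+1 * s n n).
  rewrite -(sdiff m) opprB addrC subrK -SW_pw -SWZl; apply: eq_SW => x.
  by rewrite /t !rmorphM /= conjCK; ring.
have -> : nsq (c n) * nsq (tau n) * s n n - d%:C * (nsq (c n) * nsq (tau n) * s n n) =
  nsq (c n) * nsq (tau n) * (s n n - d%:C * s n n) by ring.
apply: ler_wpM2l; first exact: mulr_ge0.
rewrite lerD2l lerN2; apply: ler_wpM2r => //; apply: le_trans (hm n).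
rewrite exprS -[X in _ <= X]mul1r; apply: ler_wpM2r; first exact: exprn_ge0.
exact: ltW.
Qed.

End ColumnRow.

(** In terms of adjoints acting on kernel functions, the last hypothesis says that the column of
    multipliers with value [tau n] at [n] and [0] elsewhere is contractive, and the conclusion that
    the row is. A column sees one vector per index [n], a row the same vector for all indices. *)
Theorem column_row (R : realType) (I E J : finType) (beta : J -> I -> R[i])
    (u : J -> E -> R[i]) (tau : J -> R[i])
    (B := fun i j => \sum_k beta i k * (beta j k)^*)
    (g := fun i j => \sum_e u i e * (u j e)^*)
    (s := fun i j => (1 - B i j)^-1) :
  (forall i j, 1 - B i j != 0) -> (forall j, B j j < 1) -> psd s ->
  psd (fun p q : J * J => (g p.1 q.1 * (p.2 == q.2)%:R
     - tau p.1 * (p.1 == p.2)%:R * (tau q.1 * (q.1 == q.2)%:R)^*) * s p.1 q.1) ->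
  forall c : J -> R[i],
    \sum_n c n * (c n)^* * (tau n * (tau n)^*) * s n n <=
    \sum_i \sum_j (c i)^* * c j * (g i j * s i j).
Proof.
move=> B1 Blt1 s_psd col_psd c.
have [Om [Oc [K K0 Oe]]] := realization B1 col_psd.
exact: (column_row_aux B1 Blt1 s_psd c Oc K0 Oe).
Qed.

Section PSDmore.
Variable C : numClosedFieldType.
Local Notation nsq z := (z * z^*).

Lemma form_comp (I J : finType) (h : I -> J) (K : J -> J -> C) (c : I -> C) :
  \sum_i \sum_i' (c i)^* * c i' * K (h i) (h i') =
  \sum_j \sum_j' (\sum_(i | h i == j) c i)^* * (\sum_(i | h i == j') c i) * K j j'.
Proof.
rewrite [LHS](partition_big h predT) //=; apply: eq_bigr => j _.
rewrite [LHS](eq_bigr (fun i => \sum_j' \sum_(i' | h i' == j') (c i)^* * c i' * K j j')); last first.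
  move=> i /eqP hi; rewrite (partition_big h predT) //=; apply: eq_bigr => j' _.
  by apply: eq_bigr => i' /eqP hi'; rewrite hi hi'.
rewrite exchange_big; apply: eq_bigr => j' _ /=.
rewrite rmorph_sum !mulr_suml; apply: eq_bigr => i _.
by rewrite mulr_sumr mulr_suml.
Qed.

Lemma psd_comp (I J : finType) (h : I -> J) (K : J -> J -> C) :
  psd K -> psd (fun i i' => K (h i) (h i')).
Proof. by move=> pK c; rewrite form_comp; exact: pK. Qed.

Lemma psdD (I : finType) (K L : I -> I -> C) :
  psd K -> psd L -> psd (fun i j => K i j + L i j).
Proof.
move=> pK pL c; have := addr_ge0 (pK c) (pL c); congr (0 <= _).
rewrite -big_split; apply: eq_bigr => i _; rewrite -big_split; apply: eq_bigr => j _.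
by rewrite /= mulrDr.
Qed.

Lemma psdZ (I : finType) (a : C) (K : I -> I -> C) :
  0 <= a -> psd K -> psd (fun i j => a * K i j).
Proof.
move=> a0 pK c; have := mulr_ge0 a0 (pK c); congr (0 <= _).
rewrite mulr_sumr; apply: eq_bigr => i _; rewrite mulr_sumr; apply: eq_bigr => j _.
by rewrite mulrCA.
Qed.

Lemma psd_rank1 (I : finType) (v : I -> C) : psd (fun i j => v i * (v j)^*).
Proof.
move=> c; have := @gram_psd C I unit (fun i _ => v i) c; congr (0 <= _).
apply: eq_bigr => i _; apply: eq_bigr => j _; congr (_ * _).
by rewrite (big_pred1 Datatypes.tt) // => -[].
Qed.

Lemma eq_psd (I : finType) (K L : I -> I -> C) :
  (forall i j, K i j = L i j) -> psd K -> psd L.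
Proof.
move=> KL pK c; have := pK c; congr (0 <= _).
by apply: eq_bigr => i _; apply: eq_bigr => j _; rewrite KL.
Qed.

Lemma psd_CS (I J : finType) (T : Type) (k : T -> T -> C) (x : I -> T) (y : J -> T)
    (a : I -> C) (b : J -> C) :
  (forall (H : finType) (z : H -> T), psd (fun i j => k (z i) (z j))) ->
  nsq (\sum_i \sum_j (a i)^* * b j * k (x i) (y j)) <=
  (\sum_i \sum_j (a i)^* * a j * k (x i) (x j)) *
  (\sum_i \sum_j (b i)^* * b j * k (y i) (y j)).
Proof.
move=> pk; apply: psd2_det => t r.
pose z (i : I + J) := match i with inl i => x i | inr j => y j end.
have herm s s' : k s s' = (k s' s)^*.
  by have := psd_herm true false (pk bool (fun b => if b then s' else s)).
have := pk _ z (fun i => match i with inl i => t^* * a i | inr j => r^* * b j end).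
congr (0 <= _); rewrite big_sumType /= .
transitivity (\sum_i (t * t^* * (\sum_j (a i)^* * a j * k (x i) (x j)) + t * r^* * (\sum_j (a i)^* * b j * k (x i) (y j)))
  + \sum_i (t^* * r * (\sum_j ((a j)^* * b i * k (x j) (y i))^*) + r * r^* * (\sum_j (b i)^* * b j * k (y i) (y j)))).
  congr (_ + _); apply: eq_bigr => i _; rewrite big_sumType /=; congr (_ + _); rewrite mulr_sumr;
  apply: eq_bigr => j _; rewrite !rmorphM /= !conjCK; try by ring.
  by rewrite (herm (y i) (x j)); ring.
rewrite !big_split /= -!mulr_sumr -!addrA; congr (_ + (_ + (_ + _))).
rewrite exchange_big /= rmorph_sum; congr (_ * _); apply: eq_bigr => i _.
by rewrite rmorph_sum.
Qed.

End PSDmore.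

(** * Reproducing kernel spaces and complete Pick kernels *)

Section Rkhs.
Variables (R : realType) (X : Type).
Local Notation C := R[i].
Local Notation nsq z := (z * z^*).
Local Notation "x %:C" := (real_complex R x).
Implicit Types (k l : X -> X -> C).

(** [is_kernel] with arbitrary finite index types, so that products, sums and subsets of indices
    need no renumbering. *)
Definition fpsd k := forall (H : finType) (z : H -> X), psd (fun i j => k (z i) (z j)).

Lemma kernel_fpsd k : is_kernel k -> fpsd k.
Proof.
move=> hk H z c; have := hk _ (fun i : 'I_#|H| => z (enum_val i)) (fun i => c (enum_val i)).
congr (0 <= _); rewrite /kform [RHS]reindex_enum_val; apply: eq_bigr => i _.
by rewrite [RHS]reindex_enum_val.
Qed.

Lemma fpsd_kernel k : fpsd k -> is_kernel k.
Proof. by move=> hk n x c; exact: hk. Qed.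

Lemma fpsdM k l : fpsd k -> fpsd l -> fpsd (fun z w => k z w * l z w).
Proof. by move=> hk hl H z; exact: psdM (hk H z) (hl H z). Qed.

Lemma fpsd_ge0 k x : fpsd k -> 0 <= k x x.
Proof. by move=> hk; exact: (psd_diag_ge0 (Datatypes.tt) (hk unit (fun=> x))). Qed.

Lemma fpsd_herm k x y : fpsd k -> k y x = (k x y)^*.
Proof. by move=> hk; have := psd_herm true false (hk bool (fun b => if b then x else y)). Qed.

Lemma fpsd_CS1 k x y : fpsd k -> nsq (k x y) <= k x x * k y y.
Proof.
move=> hk; have := psd_CS (fun _ : unit => x) (fun _ : unit => y) (fun=> 1) (fun=> 1) hk.
have u1 (F : unit -> C) : \sum_i F i = F Datatypes.tt by rewrite (big_pred1 Datatypes.tt) // => -[].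
by rewrite !u1 !conjC1 !mul1r.
Qed.

Lemma realC_sq (r : R) : (r ^+ 2)%:C = r%:C * r%:C.
Proof. by rewrite expr2 rmorphM. Qed.

Lemma conjC_realC (r : R) : (r%:C)^* = r%:C.
Proof. exact: conjc_real. Qed.

Lemma normsqE (z : C) : `|z| ^+ 2 = nsq z. Proof. exact: normCK. Qed.

Lemma cabsE (z : C) : (cabs z)%:C = `|z|.
Proof. by rewrite /cabs normc_def. Qed.

Lemma cabs_sq (z : C) : ((cabs z) ^+ 2)%:C = nsq z.
Proof. by rewrite realC_sq cabsE -expr2 normCK. Qed.

Lemma cabs_ge0 (z : C) : 0 <= cabs z.
Proof. by rewrite -ler0c cabsE. Qed.

Lemma rkhs_bound_norm k f M : rkhs_bound k f M -> rkhs_bound k f `|M|.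
Proof. by move=> hb n x c; rewrite (real_normK (num_real M)); exact: hb. Qed.

Lemma rkhs_norm_ge0 k f : in_rkhs k f -> 0 <= rkhs_norm k f.
Proof.
move=> [M hM]; apply: lb_le_inf; last by move=> r [].
by exists `|M|; split; [exact: normr_ge0|exact: rkhs_bound_norm].
Qed.

Lemma rkhs_norm_le k f M : 0 <= M -> rkhs_bound k f M -> rkhs_norm k f <= M.
Proof. by move=> M0 hM; apply: ge_inf; [exists 0 => r []|]. Qed.

(** The bound is a closed condition on [M] and so passes to the infimum; where the form vanishes,
    any admissible bound makes the left-hand side vanish. *)
Lemma rkhs_norm_bound k f : fpsd k -> in_rkhs k f -> rkhs_bound k f (rkhs_norm k f).
Proof.
move=> hk [M0 hM0] n x c; rewrite normsqE.
set A := nsq _; set K := kform k x c.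
have A0 : 0 <= A := mul_conjC_ge0 _; have K0 : 0 <= K by exact: (fpsd_kernel hk).
have /complex_realP[a AE] := ger0_real A0; have /complex_realP[q KE] := ger0_real K0.
move: A0 K0; rewrite AE KE !ler0c => a0 q0.
have h M : rkhs_bound k f M -> a <= M ^+ 2 * q.
  by move=> /(_ n x c); rewrite normsqE -/A -/K AE KE -rmorphM lecR.
rewrite -rmorphM lecR.
have [q00|qn0] := eqVneq q 0; first by have := h _ hM0; rewrite q00 !mulr0.
have qp : 0 < q by rewrite lt0r qn0.
have aq0 : 0 <= a / q by rewrite divr_ge0.
rewrite -ler_pdivrMr // -[a / q]sqr_sqrtr // ler_sqr ?nnegrE ?sqrtr_ge0 //; last first.
  by apply: rkhs_norm_ge0; exists M0.
apply: lb_le_inf.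
  by exists `|M0|; split; [exact: normr_ge0|exact: rkhs_bound_norm].
move=> M [M_ge0 hM]; rewrite -[M]ger0_norm // -sqrtr_sqr ler_wsqrtr //.
by rewrite ler_pdivrMr //; exact: h.
Qed.

Definition comb k (n : nat) (x : 'I_n -> X) (c : 'I_n -> C) : X -> C :=
  fun z => \sum_j c j * k z (x j).

Lemma rkhs_comb k n (x : 'I_n -> X) c : fpsd k ->
  in_rkhs k (comb k x c) /\ ((rkhs_norm k (comb k x c)) ^+ 2)%:C = kform k x c.
Proof.
move=> hk; set K := kform k x c; have K0 : 0 <= K by exact: (fpsd_kernel hk).
have /complex_realP[q KE] := ger0_real K0.
have q0 : 0 <= q by move: K0; rewrite KE ler0c.
have combE n' (x' : 'I_n' -> X) (c' : 'I_n' -> C) : \sum_i (c' i)^* * comb k x c (x' i) =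
    \sum_i \sum_j (c' i)^* * c j * k (x' i) (x j).
  by apply: eq_bigr => i _; rewrite mulr_sumr; apply: eq_bigr => j _; rewrite mulrA.
have hb : rkhs_bound k (comb k x c) (Num.sqrt q).
  move=> n' x' c'; rewrite normsqE combE sqr_sqrtr // -KE [X in _ <= X]mulrC.
  exact: (psd_CS x' x c' c hk).
have hin : in_rkhs k (comb k x c) by exists (Num.sqrt q).
split => //; rewrite KE; congr (_%:C).
suff -> : rkhs_norm k (comb k x c) = Num.sqrt q by rewrite sqr_sqrtr.
apply/eqP; rewrite eq_le rkhs_norm_le ?sqrtr_ge0 //=.
have := rkhs_norm_bound hk hin x c; rewrite normsqE combE.
have -> : \sum_i \sum_j (c i)^* * c j * k (x i) (x j) = K by [].
rewrite -/K KE conjC_realC -!(rmorphM (real_complex R)) lecR => h.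
have N0 := rkhs_norm_ge0 hin.
rewrite -[rkhs_norm _ _]ger0_norm // -sqrtr_sqr ler_wsqrtr //.
have [->|qn0] := eqVneq q 0; first exact: sqr_ge0.
by move: h; rewrite ler_pM2r // lt0r qn0.
Qed.

Lemma knormE k w : fpsd k -> ((knorm k w) ^+ 2)%:C = k w w.
Proof.
move=> hk; have [_] := @rkhs_comb k 1 (fun=> w) (fun=> 1) hk.
have -> : comb k (fun _ : 'I_1 => w) (fun=> 1) = (fun z => k z w).
  by apply: funext => z; rewrite /comb big_ord1 mul1r.
by rewrite /kform !big_ord1 conjC1 !mul1r.
Qed.

Lemma knorm_ge0 k w : fpsd k -> 0 <= knorm k w.
Proof.
move=> hk; apply: rkhs_norm_ge0.
have [] := @rkhs_comb k 1 (fun=> w) (fun=> 1) hk.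
have -> : comb k (fun _ : 'I_1 => w) (fun=> 1) = (fun z => k z w).
  by apply: funext => z; rewrite /comb big_ord1 mul1r.
by [].
Qed.

Lemma kernel_multiplier k l (phi : X -> C) (M : R) : fpsd k -> 0 <= M ->
  (forall n (x : 'I_n -> X) c, kform k x (fun i => (phi (x i))^* * c i) <= (M ^+ 2)%:C * kform l x c) ->
  is_multiplier k l phi.
Proof.
move=> hk M0 h; exists M => f inf.
have N0 := rkhs_norm_ge0 inf; have hb := rkhs_norm_bound hk inf.
have hb' : rkhs_bound l (fun z => phi z * f z) (M * rkhs_norm k f).
  move=> n x c; have := hb n x (fun i => (phi (x i))^* * c i).
  have -> : \sum_i ((phi (x i))^* * c i)^* * f (x i) = \sum_i (c i)^* * (phi (x i) * f (x i)).
    by apply: eq_bigr => i _; rewrite rmorphM /= conjCK; ring.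
  move=> /le_trans; apply.
  apply: le_trans (ler_wpM2l _ (h n x c)) _; first by rewrite ler0c sqr_ge0.
  by rewrite mulrA -(rmorphM (real_complex R)) -exprMn [rkhs_norm _ _ * M]mulrC.
by split; [exists (M * rkhs_norm k f)|apply: rkhs_norm_le => //; exact: mulr_ge0].
Qed.

(** Tested on [f = comb k x c'], the pairing of [phi f] with the combination of kernels of [l] is
    the squared norm of [f]; dividing by it leaves the kernel inequality. *)
Lemma multiplier_kernel k l (phi : X -> C) : fpsd k -> fpsd l -> is_multiplier k l phi ->
  exists2 M : R, 0 <= M & forall n (x : 'I_n -> X) c,
    kform k x (fun i => (phi (x i))^* * c i) <= (M ^+ 2)%:C * kform l x c.
Proof.
move=> hk hl [M0 h]; exists `|M0|; first exact: normr_ge0.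
move=> n x c; set c' := fun i => _; set q := kform k x c'.
have [fin fq] := rkhs_comb x c' hk; have [pin pn] := h _ fin.
have N0 := rkhs_norm_ge0 fin; have P0 := rkhs_norm_ge0 pin.
have hb := rkhs_norm_bound hl pin x c.
have E : \sum_i (c i)^* * (phi (x i) * comb k x c' (x i)) = q.
  rewrite /q /kform; apply: eq_bigr => i _; rewrite mulrA mulr_sumr; apply: eq_bigr => j _.
  by rewrite /c' rmorphM /= conjCK; ring.
move: hb; rewrite E normsqE.
have q0 : 0 <= q by exact: (fpsd_kernel hk).
have L0 : 0 <= kform l x c by exact: (fpsd_kernel hl).
have /complex_realP[qr qE] := ger0_real q0; have /complex_realP[lr lE] := ger0_real L0.
move: fq q0 L0; rewrite -/q qE lE !ler0c conjC_realC => /complexI fq q0 L0.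
rewrite -!(rmorphM (real_complex R)) !lecR real_normK ?num_real // => h1.
have [->|qn0] := eqVneq qr 0; first by rewrite mulr_ge0 // sqr_ge0.
have qp : 0 < qr by rewrite lt0r qn0.
rewrite -(ler_pM2r qp); apply: le_trans h1 _; rewrite [X in _ <= X]mulrAC; apply: ler_wpM2r => //.
rewrite -fq -exprMn ler_sqr ?nnegrE //.
exact: le_trans P0 pn.
Qed.

End Rkhs.

Section Cnp.
Variables (R : realType) (X : Type).
Local Notation C := R[i].
Local Notation nsq z := (z * z^*).
Local Notation "x %:C" := (real_complex R x).
Implicit Types (k l : X -> X -> C).

Definition fform (H : finType) k (z : H -> X) (c : H -> C) : C :=
  \sum_i \sum_j (c i)^* * c j * k (z i) (z j).

Lemma realCM (x y : R) : (x * y)%:C = x%:C * y%:C.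
Proof. exact: rmorphM. Qed.

Lemma realCV (x : R) : (x^-1)%:C = (x%:C)^-1.
Proof. exact: fmorphV. Qed.

Lemma realC_sum (I : finType) (F : I -> R) : (\sum_i F i)%:C = \sum_i (F i)%:C.
Proof. exact: rmorph_sum. Qed.

Lemma realC_gt0 (r : R) : (0 < r%:C) = (0 < r).
Proof. exact: (ltcR 0 r). Qed.

Lemma ge0_conj (x : C) : 0 <= x -> x^* = x.
Proof. by move=> /ger0_real /CrealP. Qed.

Lemma eq_fform (H : finType) k (z : H -> X) (c d : H -> C) : c =1 d -> fform k z c = fform k z d.
Proof. by move=> /funext ->. Qed.

Lemma fformZ (H : finType) k (z : H -> X) a (c : H -> C) :
  fform k z (fun i => a * c i) = nsq a * fform k z c.
Proof.
rewrite mulr_sumr; apply: eq_bigr => i _; rewrite mulr_sumr; apply: eq_bigr => j _.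
by rewrite rmorphM /=; ring.
Qed.

Lemma fform_comp (I J : finType) (h : I -> J) k (z : J -> X) (c : I -> C) :
  fform k (fun i => z (h i)) c = fform k z (fun j => \sum_(i | h i == j) c i).
Proof. exact: (form_comp h (fun j j' => k (z j) (z j'))). Qed.

Lemma rank1_form (H : finType) (v c : H -> C) :
  \sum_i \sum_j (c i)^* * c j * (v i * (v j)^*) = nsq (\sum_i (c i)^* * v i).
Proof.
rewrite mulr_suml; apply: eq_bigr => i _.
rewrite rmorph_sum mulr_sumr; apply: eq_bigr => j _.
by rewrite rmorphM /= conjCK; ring.
Qed.

Lemma fpsd_schur k x : fpsd k -> k x x != 0 ->
  fpsd (fun z w => k z w - k z x * k x w / k x x).
Proof.
move=> hk kn0 H z c.
have kp : 0 < k x x by rewrite lt0r kn0 fpsd_ge0.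
have := psd_CS z (fun _ : unit => x) c (fun=> 1) hk.
have u1 (F : unit -> C) : \sum_i F i = F Datatypes.tt by rewrite (big_pred1 Datatypes.tt) // => -[].
rewrite !u1 conjC1 !mul1r -(pmulr_rge0 _ kp) -subr_ge0; congr (0 <= _).
have -> : \sum_i \sum_(j : unit) (c i)^* * 1 * k (z i) x = \sum_i (c i)^* * k (z i) x.
  by apply: eq_bigr => i _; rewrite u1 mulr1.
rewrite -rank1_form mulrC mulr_sumr -sumrB mulr_sumr; apply: eq_bigr => i _.
rewrite mulr_sumr -sumrB mulr_sumr; apply: eq_bigr => j _.
by rewrite -(fpsd_herm (z j) x hk); field.
Qed.

(** [B] is the kernel of inner products of the embedding [b]; on finite sets a finite-dimensional
    embedding is recovered from it by a Gram factorization. *)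
Definition cnp (s B : X -> X -> C) :=
  [/\ fpsd B, forall z, B z z < 1 & forall z w, s z w = (1 - B z w)^-1].

Lemma pick_cnp (s : X -> X -> C) : normalized_complete_pick s -> exists B, cnp s B.
Proof.
move=> [K [ip [b [[lin herm pos _] _ b1 _ sE]]]].
exists (fun z w => ip (b z) (b w)); split=> // H z c.
have ip0 y : ip 0 y = 0.
  have := lin 1 0 0 y; rewrite scaler0 addr0 mul1r => /eqP.
  by rewrite -subr_eq0 opprD addrA subrr add0r oppr_eq0 => /eqP.
have ipsum (a : H -> C) (y : H -> K) w : ip (\sum_i a i *: y i) w = \sum_i a i * ip (y i) w.
  by elim/big_rec2: _ => // i u v _ <-; rewrite lin.
have := pos (\sum_i (c i)^* *: b (z i)); rewrite ipsum; congr (0 <= _).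
apply: eq_bigr => i _; rewrite herm ipsum rmorph_sum mulr_sumr; apply: eq_bigr => j _.
by rewrite rmorphM /= conjCK -herm mulrA.
Qed.

Section Facts.
Variables (s B : X -> X -> C).
Hypothesis hs : cnp s B.

Let hB : fpsd B. Proof. by case: hs. Qed.
Let B1 z : B z z < 1. Proof. by case: hs. Qed.
Let sE z w : s z w = (1 - B z w)^-1. Proof. by case: hs. Qed.

Lemma cnp_neq1 z w : 1 - B z w != 0.
Proof.
rewrite subr_eq0; apply/eqP => E; have := fpsd_CS1 z w hB.
rewrite -E conjC1 mulr1 => h.
have : B z z * B w w < 1.
  apply: le_lt_trans (B1 w); rewrite ler_piMl ?fpsd_ge0 //; exact: ltW.
by move=> /(le_lt_trans h); rewrite ltxx.
Qed.

Lemma cnp_neq0 z w : s z w != 0.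
Proof. by rewrite sE invr_eq0 cnp_neq1. Qed.

Lemma cnp_gt0 z : 0 < s z z.
Proof. by rewrite sE invr_gt0 subr_gt0. Qed.

Lemma cnp_herm z w : s w z = (s z w)^*.
Proof. by rewrite !sE fmorphV rmorphB /= conjC1 -(fpsd_herm z w hB). Qed.

(* The kernel [<b(z), b(w)>] after moving [b(x)] to the origin by an
   automorphism of the ball. *)
Definition cnp_base x z w : C := 1 - s z x * s x w / (s x x * s z w).

Lemma cnp_base_fpsd x : fpsd (cnp_base x).
Proof.
(* The numerator of [cnp_base x] over [(1 - B z x) * (1 - B x w)]. It is a multiple of the Schur
   complement of [B] at [x] plus a rank one kernel, and equals [B] if [B x x = 0]. *)
pose N z w := (1 - B z x) * (1 - B x w) - (1 - B z w) * (1 - B x x).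
have hN : fpsd N.
  have [Bx0|Bx0] := eqVneq (B x x) 0.
    have Bzx z : B z x = 0.
      have := fpsd_CS1 z x hB; rewrite Bx0 mulr0 => h.
      have : nsq (B z x) == 0 by rewrite eq_le h mul_conjC_ge0.
      by rewrite mulf_eq0 conjC_eq0 orbb => /eqP.
    move=> H z; apply: eq_psd (hB z) => i j.
    by rewrite /N (fpsd_herm (z j) x hB) !Bzx conjC0; ring.
  move=> H z; apply: (@eq_psd _ _ (fun i j => (1 - B x x) * (B (z i) (z j) - B (z i) x * B x (z j) / B x x) +
     (B x x)^-1 * ((B x x - B (z i) x) * (B x x - B (z j) x)^*))).
    move=> i j; rewrite rmorphB /= -(fpsd_herm (z j) x hB).
    have -> : (B x x)^* = B x x by rewrite -(fpsd_herm x x hB).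
    by rewrite /N; field.
  apply: psdD; last by apply: psdZ (psd_rank1 _); rewrite invr_ge0 fpsd_ge0.
  apply: psdZ; last exact: (fpsd_schur hB Bx0 z).
  by rewrite subr_ge0 ltW.
move=> H z; apply: eq_psd (psdM (hN H z) (psd_rank1 (fun i => s (z i) x))) => i j.
rewrite -cnp_herm /cnp_base /N !sE.
by field; rewrite !cnp_neq1.
Qed.

Lemma cnp_base_self x w : cnp_base x x w = 0.
Proof. by rewrite /cnp_base divff ?subrr // mulf_neq0 ?cnp_neq0. Qed.

Lemma cnp_base_selfr x w : cnp_base x w x = 0.
Proof. by rewrite /cnp_base [s x x * _]mulrC divff ?subrr // mulf_neq0 ?cnp_neq0. Qed.

(** The complete Pick property in the form used below: removing from [s] its component along the
    kernel at [x] leaves the product of [s] with a positive kernel. *)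
Lemma cnp_split x z w : s z w = s z x * s x w / s x x + s z w * cnp_base x z w.
Proof.
rewrite /cnp_base.
by have h1 := cnp_neq0 z w; have h2 := cnp_neq0 x x; field; rewrite h1 h2.
Qed.

(** An induction on the number of points replaces the geometric series in [B]. In [cnp_split] at the
    first point, [cnp_base] vanishes on the row and column of that point, so the product term only
    involves the other points. *)
Lemma cnp_fpsd : fpsd s.
Proof.
apply: kernel_fpsd => n; elim: n => [|n IH] x c; first by rewrite /kform big_ord0.
pose x0 := x ord0.
have psx : psd (fun i j : 'I_n => s (x (lift ord0 i)) (x (lift ord0 j))).
  by move=> d; exact: (IH (fun i => x (lift ord0 i)) d).
have pr := psdM psx (cnp_base_fpsd x0 (fun i => x (lift ord0 i))).
rewrite /kform.
have -> : \sum_i \sum_j (c i)^* * c j * s (x i) (x j) =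
  (s x0 x0)^-1 * (\sum_i \sum_j (c i)^* * c j * (s (x i) x0 * (s (x j) x0)^*)) +
  \sum_i \sum_j (c i)^* * c j * (s (x i) (x j) * cnp_base x0 (x i) (x j)).
  rewrite mulr_sumr -big_split; apply: eq_bigr => i _; rewrite mulr_sumr -big_split; apply: eq_bigr => j _ /=.
  by rewrite -cnp_herm {1}(cnp_split x0 (x i) (x j)); ring.
apply: addr_ge0.
  by rewrite rank1_form mulr_ge0 ?mul_conjC_ge0 // invr_ge0 ltW ?cnp_gt0.
have := pr (fun i => c (lift ord0 i)); congr (0 <= _).
rewrite [RHS]big_ord_recl [X in _ = X + _]big1 ?add0r; last first.
  by move=> j _; rewrite cnp_base_self !mulr0.
apply: eq_bigr => i _; rewrite [RHS]big_ord_recl cnp_base_selfr !mulr0 add0r.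
by apply: eq_bigr.
Qed.

End Facts.

Lemma nonvanishing_gt0 l z : fpsd l -> (exists w, l w z != 0) -> 0 < l z z.
Proof.
move=> hl [w lw]; rewrite lt0r fpsd_ge0 // andbT; apply/eqP => l0.
have := fpsd_CS1 w z hl; rewrite l0 mulr0 => h.
have : nsq (l w z) == 0 by rewrite eq_le h mul_conjC_ge0.
by rewrite mulf_eq0 conjC_eq0 orbb (negPf lw).
Qed.

End Cnp.

(** * Carleson and separation conditions as inequalities between quadratic forms *)

Section Conditions.
Variables (R : realType) (X : Type).
Local Notation C := R[i].
Local Notation nsq z := (z * z^*).
Local Notation "x %:C" := (real_complex R x).
Variables (k : X -> X -> C) (lam : nat -> X).
Hypotheses (hk : fpsd k) (k0 : forall z, 0 < k z z).

(** Bessel bound for the normalized kernels, whose coefficients are [a i] times the norm of the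
    kernel at [lam i]. *)
Definition gram_bound (C0 : R) := forall N (a : 'I_N -> C),
  fform k (fun i : 'I_N => lam i) a <= C0%:C * \sum_i nsq (a i) * k (lam i) (lam i).

Lemma carleson_sumE (f : X -> C) N :
  (\sum_(i < N) cabs (f (lam i)) ^+ 2 / knorm k (lam i) ^+ 2)%:C =
  \sum_(i < N) nsq (f (lam i)) / k (lam i) (lam i).
Proof.
rewrite realC_sum; apply: eq_bigr => i _.
by rewrite realCM realCV cabs_sq knormE.
Qed.

Lemma amgm_weight (t a f : C) : 0 < t -> a^* * f + a * f^* <= t * nsq a + t^-1 * nsq f.
Proof.
move=> t0; have tn : t != 0 by rewrite gt_eqF.
have tr : t^* = t by apply/CrealP/ger0_real/ltW.
have : 0 <= t^-1 * nsq (t * a - f) by rewrite mulr_ge0 ?mul_conjC_ge0 // invr_ge0 ltW.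
rewrite -[_ <= t * _ + _]subr_ge0; congr (0 <= _); rewrite rmorphB rmorphM /= tr; field.
exact: tn.
Qed.

Lemma carleson_gram : carleson k lam -> exists2 C0 : R, 0 < C0 & gram_bound C0 /\
  forall N n, \sum_(i < N) nsq (k (lam i) (lam n)) / k (lam i) (lam i) <= C0%:C * k (lam n) (lam n).
Proof.
move=> [C0 [C0p h]]; exists C0 => //.
have C0c : 0 < C0%:C by rewrite realC_gt0.
have H N n (x : 'I_n -> X) a : \sum_(i < N) nsq (comb k x a (lam i)) / k (lam i) (lam i) <= C0%:C * fform k x a.
  have [fin fE] := rkhs_comb x a hk.
  rewrite -carleson_sumE -[fform k x a]/(kform k x a) -fE -(rmorphM (real_complex R)) lecR; exact: h.
split=> [N a|N n].
  set Q := fform _ _ _; set f := comb k (fun i : 'I_N => lam i) a.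
  have Q0 : 0 <= Q by exact: hk.
  have QE : Q = \sum_i (a i)^* * f (lam i).
    by apply: eq_bigr => i _; rewrite mulr_sumr; apply: eq_bigr => j _; rewrite mulrA.
  have QE' : Q = \sum_i a i * (f (lam i))^*.
    rewrite -[LHS](ge0_conj Q0) QE rmorph_sum; apply: eq_bigr => i _.
    by rewrite rmorphM /= conjCK.
  (* Duality by AM-GM: the Carleson condition for the combination itself gives back one of the two
     copies of [Q]. *)
  have : Q + Q <= C0%:C * (\sum_i nsq (a i) * k (lam i) (lam i)) + (C0%:C)^-1 * (C0%:C * Q).
    rewrite {1}QE {1}QE' -big_split /=.
    apply: (@le_trans _ _ (\sum_(i < N) (C0%:C * k (lam i) (lam i) * nsq (a i) + (C0%:C * k (lam i) (lam i))^-1 * nsq (f (lam i))))).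
      by apply: ler_sum => i _; apply: amgm_weight; rewrite mulr_gt0.
    rewrite big_split /= lerD //.
      by rewrite mulr_sumr ler_sum // => i _; rewrite mulrAC mulrA.
    have Ci : 0 <= (C0%:C)^-1 by rewrite invr_ge0 ltW.
    apply: le_trans (ler_wpM2l Ci (H N N (fun i : 'I_N => lam i) a)); rewrite mulr_sumr ler_sum // => i _.
    by rewrite invfM -/f le_eqVlt; apply/orP; left; apply/eqP; ring.
  by rewrite mulKf ?gt_eqF // lerD2r.
have := H N 1%N (fun=> lam n) (fun=> 1); rewrite /fform !big_ord1 conjC1 !mul1r.
apply: le_trans; apply: ler_sum => i _.
by rewrite /comb big_ord1 mul1r.
Qed.

Lemma gram_carleson C0 : 0 < C0 -> gram_bound C0 -> carleson k lam.
Proof.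
move=> C0p hg; exists C0; split=> // f fin N.
rewrite -lecR carleson_sumE realCM.
set T := \sum_(i < N) _; set n2 := (rkhs_norm k f ^+ 2)%:C.
have n0 : 0 <= n2 by rewrite ler0c sqr_ge0.
have kr i : (k (lam i) (lam i))^* = k (lam i) (lam i) by rewrite -fpsd_herm.
have T0 : 0 <= T by apply: sumr_ge0 => i _; rewrite mulr_ge0 ?mul_conjC_ge0 // invr_ge0 ltW.
(* For these coefficients both the pairing with [f] and the weighted square sum are the Carleson sum
   [T], whence [T * T <= n2 * (C0 * T)]. *)
pose c (i : 'I_N) := f (lam i) / k (lam i) (lam i).
have TE : \sum_i (c i)^* * f (lam i) = T.
  by apply: eq_bigr => i _; rewrite /c rmorphM fmorphV /= kr; ring.
have TE2 : \sum_i nsq (c i) * k (lam i) (lam i) = T.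
  apply: eq_bigr => i _; rewrite /c rmorphM fmorphV /= kr.
  by field; rewrite gt_eqF.
have := rkhs_norm_bound hk fin (fun i : 'I_N => lam i) c; rewrite normsqE TE.
have := hg N c; rewrite TE2 => h1 h2.
have Tr : T^* = T by exact: ge0_conj.
have h3 : T * T <= n2 * (C0%:C * T).
  by rewrite -{2}Tr; apply: le_trans h2 _; apply: ler_wpM2l.
have [->|Tn] := eqVneq T 0; first by rewrite mulr_ge0 // ler0c ltW.
have Tp : 0 < T by rewrite lt0r Tn.
by rewrite -(ler_pM2r Tp) [C0%:C * n2]mulrC -mulrA.
Qed.

(** [weakly_separated] without infimum and made homogeneous in the coefficients; [e] plays the role
    of a squared distance. *)
Definition separated_by n (e : R) := forall mu : 'I_n -> X, injective mu ->
  (forall i, exists m, mu i = lam m) -> forall (i0 : 'I_n) (c : 'I_n -> C),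
  e%:C * (nsq (c i0) * k (mu i0) (mu i0)) <= fform k mu c.

Lemma knorm_gt0 z : 0 < knorm k z.
Proof.
rewrite lt0r knorm_ge0 // andbT; apply/eqP => h.
by have := k0 z; rewrite -knormE // h expr0n ltxx.
Qed.

Lemma dist_comb n (mu : 'I_n -> X) i0 (c : 'I_n -> C) :
  (fun z => khat k (mu i0) z - \sum_(j < n | j != i0) c j * khat k (mu j) z) =
  comb k mu (fun j => (if j == i0 then 1 else - c j) / (knorm k (mu j))%:C).
Proof.
apply: funext => z; rewrite /comb [RHS](bigD1 i0) //= eqxx div1r /khat [_ / _]mulrC; congr (_ + _).
rewrite -sumrN; apply: eq_bigr => j /negPf ->.
by rewrite !mulNr [c j / _ * _]mulrAC mulrA.
Qed.

Lemma weakly_separatedP n : weakly_separated k lam n <-> exists2 e : R, 0 < e & separated_by n e.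
Proof.
split=> [[e [e0 h]]|[e e0 h]].
  exists (e ^+ 2) => [|mu imu rmu i0 c]; first by rewrite exprn_gt0.
  have := h mu imu rmu i0; set Sd := rkhs_dist _ _ _ _ => hd.
  have [c0|cn0] := eqVneq (c i0) 0; first by rewrite c0 mul0r mul0r mulr0; exact: hk.
  have kn j : (knorm k (mu j))%:C != 0 by rewrite gt_eqF // realC_gt0 knorm_gt0.
  pose d j := - (c j * (knorm k (mu j))%:C) / (c i0 * (knorm k (mu i0))%:C).
  have [din dE] := rkhs_comb mu (fun j => (if j == i0 then 1 else - d j) / (knorm k (mu j))%:C) hk.
  have : e <= rkhs_norm k (fun z => khat k (mu i0) z - \sum_(j < n | j != i0) d j * khat k (mu j) z).
    apply: le_trans hd _; apply: ge_inf; last by exists d.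
    by exists 0 => r [d' ->]; rewrite dist_comb; apply: rkhs_norm_ge0; case: (rkhs_comb mu (fun j => (if j == i0 then 1 else - d' j) / (knorm k (mu j))%:C) hk).
  rewrite dist_comb => he.
  have : (e ^+ 2)%:C <= kform k mu (fun j => (if j == i0 then 1 else - d j) / (knorm k (mu j))%:C).
    rewrite -dE lecR ler_sqr ?nnegrE ?(ltW e0) //; exact: le_trans (ltW e0) he.
  have -> : kform k mu (fun j => (if j == i0 then 1 else - d j) / (knorm k (mu j))%:C) =
     fform k mu (fun j => (c i0 * (knorm k (mu i0))%:C)^-1 * c j).
    apply: eq_fform => j; case: eqP => [->|_].
      by field; rewrite cn0 kn.
    by rewrite /d; field; rewrite cn0 !kn.
  rewrite fformZ.
  have kE : (knorm k (mu i0))%:C * (knorm k (mu i0))%:C = k (mu i0) (mu i0) by rewrite -realC_sq knormE.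
  have -> : nsq (c i0 * (knorm k (mu i0))%:C)^-1 = (nsq (c i0) * k (mu i0) (mu i0))^-1.
    by rewrite fmorphV rmorphM /= conjC_realC -kE -invfM; congr (_^-1); ring.
  rewrite mulrC ler_pdivlMr // mulr_gt0 // lt0r mul_conjC_ge0 andbT mulf_neq0 ?conjC_eq0 //.
exists (Num.sqrt e); split=> [|mu imu rmu i0]; first by rewrite sqrtr_gt0.
apply: lb_le_inf; first by eexists; exists (fun=> 0).
move=> r [c ->]; rewrite dist_comb.
set cc := fun j => _.
have [din dE] := rkhs_comb mu cc hk.
rewrite -[rkhs_norm _ _]ger0_norm ?rkhs_norm_ge0 // -sqrtr_sqr ler_wsqrtr //.
rewrite -lecR dE; apply: le_trans (h mu imu rmu i0 cc).
rewrite /cc eqxx div1r fmorphV /= conjC_realC.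
have kn : (knorm k (mu i0))%:C != 0 by rewrite gt_eqF // realC_gt0 knorm_gt0.
by rewrite -knormE // realC_sq -invfM mulVf ?mulr1 // mulf_neq0.
Qed.

End Conditions.

(** * Interpolating sequences: sufficiency *)

(** [1 - a >= exp (- 2 a)] on [[0, 1/2]], so [exp (- 2 K)] works for any number of factors. *)
Lemma prod_lower_bound (R : realType) (K : R) : exists2 k : R, 0 < k &
  forall (r : seq nat) (a : nat -> R), (forall j, j \in r -> 0 <= a j <= 1 / 2) ->
    \sum_(j <- r) a j <= K -> k <= \prod_(j <- r) (1 - a j).
Proof.
exists (sequences.expR (- (2 * K))); first exact: exp.expR_gt0.
move=> r a ha hK; apply: (@le_trans _ _ (sequences.expR (- (2 * \sum_(j <- r) a j)))).
  by rewrite exp.ler_expR lerN2 ler_pM2l.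
have {hK} h j : 0 <= a j <= 1 / 2 -> sequences.expR (- (2 * a j)) <= 1 - a j.
  move=> /andP[a0 a1]; rewrite exp.expRN invf_ple ?posrE ?exp.expR_gt0 //; last by lra.
  apply: le_trans (exp.expR_ge1Dx (2 * a j)).
  by rewrite -div1r ler_pdivrMr; [nra|lra].
elim: r ha => [|j r IH] ha; first by rewrite !big_nil mulr0 oppr0 exp.expR0.
rewrite !big_cons mulrDr opprD exp.expRD; apply: ler_pM; rewrite ?exp.expR_ge0 //.
  by apply/h/ha; rewrite mem_head.
by apply: IH => i ir; apply: ha; rewrite in_cons ir orbT.
Qed.

Section Strong.
Variables (R : realType) (X : Type).
Local Notation C := R[i].
Local Notation nsq z := (z * z^*).
Local Notation "x %:C" := (real_complex R x).
Variables (s B g : X -> X -> C) (lam : nat -> X).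
Hypotheses (hs : cnp s B) (hg : fpsd g) (lam_inj : injective lam).
Local Notation l := (fun z w => g z w * s z w).

Definition contractive (th : X -> C) := forall (H : finType) (z : H -> X) c,
  fform l z (fun i => (th (z i))^* * c i) <= fform l z c.

Lemma mult_fpsd : fpsd l.
Proof. exact: fpsdM hg (cnp_fpsd hs). Qed.

(* The multiplier is [cnp_base s x _ y], suitably normalized. *)
Lemma contractive_factor x y : exists2 th : X -> C,
  th x = 0 /\ nsq (th y) = cnp_base s x y y & contractive th.
Proof.
have hb := cnp_base_fpsd hs x.
have [b0|bn0] := eqVneq (cnp_base s x y y) 0.
  exists (fun=> 0); first by rewrite b0 mul0r.
  by move=> H z c; rewrite fformZ conjC0 !mul0r; exact: mult_fpsd.
set b := cnp_base s x y y in bn0 *.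
have b_ge0 : 0 <= b by exact: (fpsd_ge0 y hb).
pose r := sqrtC b; have rr : r * r = b by rewrite -expr2 sqrtCK.
have rc : r^* = r by apply: ge0_conj; rewrite sqrtC_ge0.
have rn0 : r != 0 by apply: contraNneq bn0 => r0; rewrite -rr r0 mul0r.
exists (fun z => cnp_base s x z y / r).
  split; first by rewrite (cnp_base_self hs) mul0r.
  by rewrite rmorphM fmorphV /= rc -/b (ge0_conj b_ge0) -rr; field.
move=> H z c.
(* By [cnp_split] at [x], the kernel is [g] times the sum of the rank one part of [s] at [x] and of
   [s] times the Schur complement of [cnp_base] at [y]. *)
have K : psd (fun i j => (1 - cnp_base s x (z i) y / r * (cnp_base s x (z j) y / r)^*) * l (z i) (z j)).
  have q0 : 0 <= (s x x)^-1 by rewrite invr_ge0 ltW // (cnp_gt0 hs).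
  apply: eq_psd (psdM (hg z) (psdD (psdZ q0 (psd_rank1 (fun i => s (z i) x)))
    (psdM (cnp_fpsd hs z) (fpsd_schur hb bn0 z)))) => i j.
  rewrite rmorphM fmorphV /= rc -(cnp_herm hs (z j) x) -(fpsd_herm (z j) y hb) -/b -rr.
  rewrite [in RHS](cnp_split hs x (z i) (z j)).
  have sn := cnp_neq0 hs x x; set u := cnp_base s x (z i) y; set v := cnp_base s x y (z j).
  set cb := cnp_base s x (z i) (z j); set sij := s (z i) (z j).
  have sE : s (z i) x * s x (z j) / s x x = sij - sij * cb.
    by rewrite {1}/sij (cnp_split hs x (z i) (z j)) addrK.
  have -> : (s x x)^-1 * (s (z i) x * s x (z j)) = sij - sij * cb by rewrite mulrC -sE.
  by rewrite sE; field.
rewrite -subr_ge0; have := K c; congr (0 <= _).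
rewrite /fform -sumrB; apply: eq_bigr => i _; rewrite -sumrB; apply: eq_bigr => j _.
by rewrite [(_^* * c i)^*]rmorphM /= conjCK; ring.
Qed.

Lemma contractive_product y (r : seq nat) : exists2 th : X -> C,
  (forall j, j \in r -> th (lam j) = 0) /\
  nsq (th y) = \prod_(j <- r) cnp_base s (lam j) y y & contractive th.
Proof.
elim: r => [|j r [th [th0 thy] thc]].
  exists (fun=> 1); first by split=> //; rewrite big_nil conjC1 mulr1.
  by move=> H z c; rewrite fformZ conjC1 rmorph1 !mul1r.
have [th1 [th1j th1y] th1c] := contractive_factor (lam j) y.
exists (fun z => th1 z * th z).
  split=> [i|]; last by rewrite big_cons -th1y -thy rmorphM /=; ring.
  by rewrite in_cons => /orP[/eqP ->|/th0 ->]; rewrite ?th1j ?mul0r ?mulr0.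
move=> H z c; apply: le_trans (th1c H z c).
apply: le_trans (thc H z _); rewrite le_eqVlt; apply/orP; left; apply/eqP.
by apply: eq_fform => i; rewrite rmorphM /=; ring.
Qed.

Hypothesis l0 : forall z, 0 < l z z.

Lemma separated_by_le n (e e' : R) : e <= e' -> separated_by l lam n e' -> separated_by l lam n e.
Proof.
move=> ee h mu imu rmu i0 c; apply: le_trans (h mu imu rmu i0 c).
by apply: ler_wpM2r; [rewrite mulr_ge0 ?mul_conjC_ge0 // ltW|rewrite lecR].
Qed.

(** The number of points near a given one is bounded but varies, so one constant must serve all
    sizes up to [M]. Size [0] is vacuous and size [1] holds with constant [1]. *)
Lemma separated_uniform : (forall n, (2 <= n)%N -> exists2 e : R, 0 < e & separated_by l lam n e) ->
  forall M, exists2 e : R, 0 < e & forall m, (m <= M)%N -> separated_by l lam m e.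
Proof.
move=> h; elim=> [|M [e e0 he]].
  by exists 1 => // m; rewrite leqn0 => /eqP -> mu _ _ [].
have [e' e'0 he'] : exists2 e : R, 0 < e & separated_by l lam M.+1 e.
  case: M {he} => [|M]; last exact: h.
  exists 1 => // mu _ _ i0 c; rewrite /fform !big_ord1 !ord1 [(c _)^* * _]mulrC.
  by rewrite rmorph1 mul1r.
exists (Num.min e e'); first by rewrite lt_min e0.
move=> m; rewrite leq_eqVlt => /orP[/eqP ->|mM].
  by apply: separated_by_le he'; rewrite ge_min lexx orbT.
by apply: separated_by_le (he _ mM); rewrite ge_min lexx.
Qed.

(* The points far from [lam n] are zeros of a product of contractive
   multipliers that stays bounded below at [lam n], and the Carleson condition
   bounds the number of the remaining points. *)
Lemma strong_separation (C0 : R) : 0 < C0 ->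
  (forall N n, \sum_(i < N) nsq (s (lam i) (lam n)) / s (lam i) (lam i) <= C0%:C * s (lam n) (lam n)) ->
  (forall n, (2 <= n)%N -> exists2 e : R, 0 < e & separated_by l lam n e) ->
  exists2 k : R, 0 < k & forall N (n : 'I_N) (c : 'I_N -> C),
    k%:C * (nsq (c n) * l (lam n) (lam n)) <= fform l (fun i : 'I_N => lam i) c.
Proof.
move=> C0p hC hsep.
have [k1 k1p hk1] := prod_lower_bound C0.
have hM : 2 * C0 < (Num.bound (2 * C0))%:R by apply: archi_boundP; rewrite mulr_ge0 // ltW.
set M := Num.bound _ in hM.
have [e ep he] := separated_uniform hsep M.
exists (e * k1); first exact: mulr_gt0.
move=> N n c.
(* Squared cosine of the angle between the kernels of [s] at [lam j] and [lam n]; [cnp_base] is one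
   minus it. The cosines sum to at most [C0], so fewer than [M] points have [al j > 1 / 2]. *)
pose al j := complex.Re (nsq (s (lam j) (lam n)) / s (lam j) (lam j) / s (lam n) (lam n)).
have ratio_ge0 j : 0 <= nsq (s (lam j) (lam n)) / s (lam j) (lam j) / s (lam n) (lam n).
  apply: divr_ge0; [apply: divr_ge0; [exact: mul_conjC_ge0|]|]; exact/ltW/(cnp_gt0 hs).
have alE j : (al j)%:C = nsq (s (lam j) (lam n)) / s (lam j) (lam j) / s (lam n) (lam n).
  exact/RRe_real/ger0_real/ratio_ge0.
have al0 j : 0 <= al j.
  by rewrite -ler0c alE ratio_ge0.
have aln : al n = 1.
  apply: complexI; rewrite alE -(cnp_herm hs) rmorph1.
  by rewrite mulfK ?divff ?(cnp_neq0 hs).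
have albase j : cnp_base s (lam j) (lam n) (lam n) = (1 - al j)%:C.
  rewrite rmorphB rmorph1 /= alE /cnp_base (cnp_herm hs (lam j) (lam n)).
  by have h1 := cnp_neq0 hs (lam j) (lam j); have h2 := cnp_neq0 hs (lam n) (lam n); field; rewrite h1 h2.
have alsum : \sum_(i < N) al i <= C0.
  rewrite -lecR realC_sum; have := hC N n.
  rewrite -(ler_pdivrMr _ _ (cnp_gt0 hs (lam n))) mulr_suml; apply: le_trans.
  by apply: ler_sum => i _; rewrite alE.
pose r := [seq j <- iota 0 N | al j <= 1 / 2].
have [th [th0 thn] thc] := contractive_product (lam n) r.
have sumr : \sum_(j <- r) al j <= C0.
  apply: le_trans alsum; rewrite big_filter -(big_mkord predT al) /index_iota subn0.
  by rewrite [X in _ <= X](bigID (fun j => al j <= 1 / 2)) /= lerDl sumr_ge0.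
have thk : k1%:C <= nsq (th (lam n)).
  rewrite thn (eq_bigr (fun j => (1 - al j)%:C)); last by move=> j _; exact: albase.
  have -> : \prod_(j <- r) (1 - al j)%:C = (\prod_(j <- r) (1 - al j))%:C by rewrite rmorph_prod.
  rewrite lecR; apply: hk1 sumr => j; rewrite mem_filter => /andP[-> _].
  by rewrite al0.
pose S := [set j : 'I_N | 1 / 2 < al j].
(* The adjoint of multiplication by [th], acting on combinations of kernels: it deletes the far
   points. *)
pose c' (i : 'I_N) := (th (lam i))^* * c i.
have c'0 i : i \notin S -> c' i = 0.
  rewrite inE -leNgt => ai; rewrite /c' th0 ?conjC0 ?mul0r // mem_filter ai mem_iota.
  by rewrite add0n ltn_ord.
have nS : n \in S by rewrite inE aln; lra.
have cardS : (#|S| <= M)%N.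
  suff : #|S|%:R <= 2 * C0 by move=> /le_lt_trans /(_ hM); rewrite ltr_nat => /ltnW.
  have : \sum_(j in S) (1 / 2 : R) <= \sum_(j in S) al j by apply: ler_sum => j; rewrite inE => /ltW.
  rewrite sumr_const -mulr_natr => h.
  have : \sum_(j in S) al j <= C0.
    by apply: le_trans alsum; rewrite [X in _ <= X](bigID (mem S)) /= lerDl sumr_ge0.
  by move=> /(le_trans h); lra.
apply: le_trans (thc _ (fun i : 'I_N => lam i) c).
rewrite -/c'.
pose mu (i : 'I_#|S|) := lam (enum_val i).
have imu : injective mu by move=> i j /lam_inj /val_inj /enum_val_inj.
have rmu i : exists m, mu i = lam m by exists (enum_val i).
have := he _ cardS mu imu rmu (enum_rank_in nS n) (fun i => c' (enum_val i)).
rewrite /mu enum_rankK_in //.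
rewrite (fform_comp (@enum_val _ (mem S)) l (fun i : 'I_N => lam i)) (@eq_fform _ _ _ _ _ _ c'); last first.
  move=> j; have [jS|jS] := boolP (j \in S).
    rewrite (big_pred1 (enum_rank_in nS j)) ?enum_rankK_in // => i.
    by apply/eqP/eqP => [<-|->]; rewrite ?enum_valK_in ?enum_rankK_in.
  by rewrite c'0 // big1 // => i /eqP ij; rewrite ij c'0.
apply: le_trans; rewrite realCM -!mulrA ler_wpM2l ?ler0c ?(ltW ep) //.
rewrite !mulrA; apply: ler_wpM2r; first exact: ltW (cnp_gt0 hs _).
apply: ler_wpM2r; first by have := l0 (lam n); rewrite pmulr_lgt0 ?(cnp_gt0 hs) // => /ltW.
have -> : c' n * (c' n)^* = nsq (th (lam n)) * (c n * (c n)^*).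
  by rewrite /c' rmorphM /= conjCK; ring.
by rewrite -mulrA ler_wpM2r ?mul_conjC_ge0.
Qed.

End Strong.

Section Riesz.
Variables (R : realType) (X : Type).
Local Notation C := R[i].
Local Notation nsq z := (z * z^*).
Local Notation "x %:C" := (real_complex R x).
Variables (s B g : X -> X -> C) (lam : nat -> X).
Hypotheses (hs : cnp s B) (hg : fpsd g).
Local Notation l := (fun z w => g z w * s z w).
Hypothesis l0 : forall z, 0 < l z z.

(** [tau] is chosen so that [|tau n|^2 * s = (k / C0) * l] at [lam n]. The Bessel bound, followed by
    strong separation applied to a separate coefficient vector for each index, is the column
    hypothesis of [column_row]; the claim is the row conclusion. *)
Lemma riesz_lower_bound (C0 k : R) : 0 < C0 -> 0 < k -> gram_bound s lam C0 ->
  (forall N (n : 'I_N) (c : 'I_N -> C),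
    k%:C * (nsq (c n) * l (lam n) (lam n)) <= fform l (fun i : 'I_N => lam i) c) ->
  forall N (c : 'I_N -> C), (k / C0)%:C * (\sum_(i < N) nsq (c i) * l (lam i) (lam i)) <=
    fform l (fun i : 'I_N => lam i) c.
Proof.
move=> C0p kp hgram hstrong N c.
have [hB B1 sE] := hs.
have [beta bE] := psd_gram (hB _ (fun i : 'I_N => lam i)).
have [u uE] := psd_gram (hg (fun i : 'I_N => lam i)).
have sp i : 0 < s (lam i) (lam i) := cnp_gt0 hs _.
have t2_ge0 (n : 'I_N) : 0 <= (k / C0)%:C * l (lam n) (lam n) / s (lam n) (lam n).
  apply: divr_ge0; last exact: ltW.
  by apply: mulr_ge0; [rewrite ler0c divr_ge0 ?ltW|exact/ltW/l0].
pose tau (n : 'I_N) := sqrtC ((k / C0)%:C * l (lam n) (lam n) / s (lam n) (lam n)).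
have tauc n : (tau n)^* = tau n by apply: ge0_conj; rewrite sqrtC_ge0 t2_ge0.
have tau2 n : tau n * tau n = (k / C0)%:C * l (lam n) (lam n) / s (lam n) (lam n) by rewrite -expr2 sqrtCK.
have sE' i j : (1 - \sum_r beta i r * (beta j r)^*)^-1 = s (lam i) (lam j) by rewrite -bE sE.
have H1 (i j : 'I_N) : 1 - \sum_r beta i r * (beta j r)^* != 0 by rewrite -bE (cnp_neq1 hs).
have H2 (j : 'I_N) : \sum_r beta j r * (beta j r)^* < 1 by rewrite -bE B1.
have H3 : psd (fun i j : 'I_N => (1 - \sum_r beta i r * (beta j r)^*)^-1).
  by apply: eq_psd (cnp_fpsd hs (fun i : 'I_N => lam i)) => i j; rewrite sE'.
have H4 : psd (fun p q : 'I_N * 'I_N => ((\sum_e u p.1 e * (u q.1 e)^*) * (p.2 == q.2)%:R -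
    tau p.1 * (p.1 == p.2)%:R * (tau q.1 * (q.1 == q.2)%:R)^*) *
    (1 - \sum_r beta p.1 r * (beta q.1 r)^*)^-1).
  move=> d.
  have -> : \sum_p \sum_q (d p)^* * d q * (((\sum_e u p.1 e * (u q.1 e)^*) * (p.2 == q.2)%:R -
      tau p.1 * (p.1 == p.2)%:R * (tau q.1 * (q.1 == q.2)%:R)^*) *
      (1 - \sum_r beta p.1 r * (beta q.1 r)^*)^-1) =
    \sum_m fform l (fun i : 'I_N => lam i) (fun i => d (i, m)) -
    fform s (fun i : 'I_N => lam i) (fun i => tau i * d (i, i)).
    transitivity (\sum_i \sum_j (\sum_m (d (i, m))^* * d (j, m) * l (lam i) (lam j) -
      (tau i * d (i, i))^* * (tau j * d (j, j)) * s (lam i) (lam j))).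
      rewrite [LHS]sum_pair; apply: eq_bigr => i _.
      rewrite (eq_bigr (fun m => \sum_j \sum_n (d (i, m))^* * d (j, n) * ((g (lam i) (lam j) * (m == n)%:R -
         tau i * (i == m)%:R * (tau j * (j == n)%:R)^*) * s (lam i) (lam j)))); last first.
        move=> m _; rewrite [LHS]sum_pair; apply: eq_bigr => j _; apply: eq_bigr => n _ /=.
        by rewrite sE' -uE.
      rewrite exchange_big /=; apply: eq_bigr => j _.
      transitivity (\sum_m ((d (i, m))^* * d (j, m) * l (lam i) (lam j) -
         (m == i)%:R * ((d (i, m))^* * d (j, j) * (tau i * tau j) * s (lam i) (lam j)))).
        apply: eq_bigr => m _.
        rewrite -[X in _ = X - _](sum_delta m (fun n => (d (i, m))^* * d (j, n) * l (lam i) (lam j))).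
        rewrite -[X in _ = _ - _ * X](sum_delta j (fun n => (d (i, m))^* * d (j, n) * (tau i * tau j) * s (lam i) (lam j))).
        rewrite mulr_sumr -sumrB; apply: eq_bigr => n _.
        rewrite [(tau j * _)^*]rmorphM /= conjC_nat tauc [m == n]eq_sym [i == m]eq_sym [j == n]eq_sym; ring.
      rewrite sumrB sum_delta; congr (_ - _); rewrite rmorphM /= tauc; ring.
    rewrite /fform [in RHS]exchange_big -sumrB; apply: eq_bigr => i _ /=.
    by rewrite [in RHS]exchange_big -sumrB.
  rewrite subr_ge0; apply: le_trans (hgram N _) _.
  rewrite mulr_sumr; apply: ler_sum => i _.
  apply: le_trans (hstrong N i (fun j => d (j, i))).
  rewrite le_eqVlt; apply/orP; left; apply/eqP.
  rewrite rmorphM /= tauc.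
  have -> : tau i * d (i, i) * (tau i * (d (i, i))^*) = tau i * tau i * nsq (d (i, i)) by ring.
  rewrite tau2 realCM realCV.
  have c0 : C0%:C != 0 by rewrite gt_eqF // realC_gt0.
  by field; rewrite c0 gt_eqF.
have := column_row H1 H2 H3 H4 c.
rewrite mulr_sumr; congr (_ <= _).
  apply: eq_bigr => n _; rewrite sE' tauc tau2.
  by field; rewrite !gt_eqF ?realC_gt0.
by apply: eq_bigr => i _; apply: eq_bigr => j _; rewrite sE' -uE.
Qed.

(** The Bessel bound for [s] removes the off-diagonal terms, the diagonal is multiplied by at most
    [W ^+ 2], and the Riesz bound for [l] restores a form. The ratio of norms matches the two
    diagonals. *)
Lemma pick_matrix_bound (C0 k : R) : 0 < C0 -> 0 < k -> gram_bound s lam C0 ->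
  (forall N (c : 'I_N -> C), k%:C * (\sum_(i < N) nsq (c i) * l (lam i) (lam i)) <=
    fform l (fun i : 'I_N => lam i) c) ->
  forall (w : nat -> C) (W : R), (forall i, cabs (w i) <= W) ->
  forall N (c : 'I_N -> C),
   fform s (fun i : 'I_N => lam i) (fun i => (w i * (knorm l (lam i) / knorm s (lam i))%:C)^* * c i) <=
   (C0 * W ^+ 2 / k)%:C * fform l (fun i : 'I_N => lam i) c.
Proof.
move=> C0p kp hgram hr w W hW N c; apply: le_trans (hgram N _) _.
have hl : fpsd l := fpsdM hg (cnp_fpsd hs).
have hss : fpsd s := cnp_fpsd hs.
have W0 : 0 <= W := le_trans (cabs_ge0 _) (hW 0%N).
have wW i : nsq (w i) <= (W ^+ 2)%:C by rewrite -cabs_sq lecR ler_sqr ?nnegrE ?cabs_ge0.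
have kc : 0 < k%:C by rewrite realC_gt0.
have -> : (C0 * W ^+ 2 / k)%:C = C0%:C * ((W ^+ 2)%:C / k%:C) by rewrite realCM realCV [(C0 * _)%:C]realCM mulrA.
rewrite -mulrA; apply: ler_wpM2l; first by rewrite ler0c ltW.
apply: (@le_trans _ _ ((W ^+ 2)%:C * \sum_(i < N) nsq (c i) * l (lam i) (lam i))); last first.
  rewrite -mulrA; apply: ler_wpM2l; first by rewrite ler0c sqr_ge0.
  by rewrite mulrC ler_pdivlMr // mulrC; exact: hr.
rewrite mulr_sumr; apply: ler_sum => i _.
have E : nsq (((w i * (knorm l (lam i) / knorm s (lam i))%:C)^* * c i)) * s (lam i) (lam i) =
   nsq (w i) * (nsq (c i) * l (lam i) (lam i)).
  rewrite -(knormE (lam i) hl) -[s (lam i) (lam i)](knormE (lam i) hss) !realC_sq.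
  rewrite [(knorm l _ / _)%:C]realCM realCV.
  rewrite ![(_ * c i)^*]rmorphM /= !conjCK ![(w i * _)^*]rmorphM /= [((_)%:C / _)^*]rmorphM fmorphV /= !conjC_realC.
  by field; rewrite gt_eqF // realC_gt0 knorm_gt0 // => z; exact: (cnp_gt0 hs).
by rewrite E; apply: ler_wpM2r => //; apply: mulr_ge0; [exact: mul_conjC_ge0|exact/ltW/l0].
Qed.

End Riesz.

(** * Extension of Pick data to the whole set *)

Lemma hahn_banach_step (R : realType) (V : Type) (v0 : V) (add : V -> V -> V)
    (scale : R -> V -> V) (f : V -> R) (P : V -> R -> R) :
  (forall u v, f (add u v) = f u + f v) ->
  (forall r u, f (scale r u) = r * f u) ->
  (forall u, f u <= P u 0) ->
  (forall u v a b, P (add u v) (a + b) <= P u a + P v b) ->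
  (forall r u a, 0 < r -> P (scale r u) (r * a) <= r * P u a) ->
  exists a, forall u t, f u + t * a <= P u t.
Proof.
move=> fD fZ fP PD PZ.
(* The slopes [a] allowed at [t = -1] are those above [E]; subadditivity makes them compatible with
   [t = 1], and homogeneity covers every other [t]. *)
pose E := [set x : R | exists u, x = f u - P u (- 1)]%classic.
have sep u v : f u - P u (- 1) <= P v 1 - f v.
  have := fP (add u v); rewrite fD -[X in P _ X](addNr 1) => /le_trans /(_ (PD _ _ _ _)).
  lra.
have E0 : (E !=set0)%classic by exists (f v0 - P v0 (- 1)), v0.
have supE v : sup E <= P v 1 - f v by apply: ge_sup => // x [u ->]; exact: sep.
have Esup u : f u - P u (- 1) <= sup E.
  by apply: ub_le_sup; [exists (P v0 1 - f v0) => x [w ->]; exact: sep|exists u].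
exists (sup E) => u t.
have [t0|t0|->] := ltgtP t 0; last by rewrite mul0r addr0.
  have n0 : 0 < - t by rewrite oppr_gt0.
  have i0 : 0 < (- t)^-1 by rewrite invr_gt0.
  have := Esup (scale (- t)^-1 u); rewrite fZ.
  have -> : - 1 = (- t)^-1 * t by rewrite invrN mulNr mulVf // lt_eqF.
  move=> h; have := PZ _ u t i0; set y := P (scale _ _) _ in h *.
  move=> h2; have : (- t)^-1 * f u - (- t)^-1 * P u t <= sup E by lra.
  by rewrite -mulrBr ler_pdivrMl // mulNr; lra.
have i0 : 0 < t^-1 by rewrite invr_gt0.
have := supE (scale t^-1 u); rewrite fZ.
have -> : 1 = t^-1 * t by rewrite mulVf // gt_eqF.
move=> h; have := PZ _ u t i0; set y := P (scale _ _) _ in h *.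
move=> h2; have : sup E <= t^-1 * (P u t - f u) by rewrite mulrBr; lra.
by rewrite ler_pdivlMl //; lra.
Qed.

Section ListForm.
Variables (R : realType) (T : Type).
Local Notation C := R[i].
Local Notation nsq z := (z * z^*).
Local Notation "x %:C" := (real_complex R x).
Variable A : T -> T -> C.

(** Formal combinations are kept as lists, with [lform_ext] in place of equality modulo null
    vectors; accordingly [hahn_banach_step] only takes operations on a type. *)
Definition lform (u v : seq (C * T)) : C :=
  \sum_(p <- u) \sum_(q <- v) (p.1)^* * q.1 * A p.2 q.2.

Definition lscale (a : C) (u : seq (C * T)) := [seq (a * p.1, p.2) | p <- u].

Lemma lform_catl u v w : lform (u ++ v) w = lform u w + lform v w.
Proof. by rewrite /lform big_cat. Qed.

Lemma lform_catr u v w : lform w (u ++ v) = lform w u + lform w v.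
Proof. by rewrite /lform -big_split /=; apply: eq_bigr => p _; rewrite big_cat. Qed.

Lemma lform_cons p u w : lform (p :: u) w = lform [:: p] w + lform u w.
Proof. by rewrite -cat1s lform_catl. Qed.

Lemma lform_scale a b u v : lform (lscale a u) (lscale b v) = a^* * b * lform u v.
Proof.
rewrite /lform big_map mulr_sumr; apply: eq_bigr => p _.
rewrite big_map mulr_sumr; apply: eq_bigr => q _ /=.
by rewrite rmorphM /=; ring.
Qed.

Lemma lform_fform u : lform u u =
  fform A (fun i => (tnth (in_tuple u) i).2) (fun i => (tnth (in_tuple u) i).1).
Proof.
rewrite /lform [LHS]big_tnth; apply: eq_bigr => i _.
by rewrite [LHS]big_tnth.
Qed.

Hypothesis hA : fpsd A.

Lemma lform_ge0 u : 0 <= lform u u.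
Proof. by rewrite lform_fform; exact: hA. Qed.

Lemma lform_herm u v : lform v u = (lform u v)^*.
Proof.
rewrite /lform exchange_big rmorph_sum; apply: eq_bigr => p _.
rewrite rmorph_sum; apply: eq_bigr => q _.
by rewrite (fpsd_herm p.2 q.2 hA) !rmorphM /= conjCK; ring.
Qed.

Lemma lform_CS u v : nsq (lform u v) <= lform u u * lform v v.
Proof.
have := psd_CS (fun i => (tnth (in_tuple u) i).2) (fun i => (tnth (in_tuple v) i).2)
  (fun i => (tnth (in_tuple u) i).1) (fun i => (tnth (in_tuple v) i).1) hA.
rewrite 2!lform_fform; suff -> : lform u v = \sum_i \sum_j ((tnth (in_tuple u) i).1)^* *
  (tnth (in_tuple v) j).1 * A (tnth (in_tuple u) i).2 (tnth (in_tuple v) j).2 by [].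
rewrite /lform [LHS]big_tnth; apply: eq_bigr => i _.
by rewrite [LHS]big_tnth.
Qed.

Lemma lform_ext u v : (forall w, lform u w = lform v w) -> lform u u = lform v v.
Proof. by move=> E; rewrite E (lform_herm u v) E -(lform_herm v v). Qed.

Definition lnorm u : R := Num.sqrt (complex.Re (lform u u)).

Lemma lnorm_ge0 u : 0 <= lnorm u. Proof. exact: sqrtr_ge0. Qed.

Lemma lnorm_sq u : ((lnorm u) ^+ 2)%:C = lform u u.
Proof.
have h := RRe_real (ger0_real (lform_ge0 u)).
by rewrite sqr_sqrtr -?ler0c h // lform_ge0.
Qed.

Lemma eq_lnorm u v : lform u u = lform v v -> lnorm u = lnorm v.
Proof. by rewrite /lnorm => ->. Qed.

Lemma Re_le_cabs (z : C) : complex.Re z <= cabs z.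
Proof. by rewrite -lecR cabsE; apply: le_trans (normc_ge_Re z); rewrite lecR ler_norm. Qed.

Lemma lnorm_cat u v : lnorm (u ++ v) <= lnorm u + lnorm v.
Proof.
rewrite -ler_sqr ?nnegrE ?addr_ge0 ?lnorm_ge0 // -lecR lnorm_sq.
rewrite lform_catl !lform_catr (lform_herm u v).
set z := lform u v.
have -> : lform u u + z + (z^* + lform v v) = lform u u + lform v v + (z + z^*) by ring.
have -> : z + z^* = (2 * complex.Re z)%:C by rewrite (addcJ z) realCM rmorph_nat.
rewrite -!lnorm_sq -!(rmorphD (real_complex R)) lecR.
have : cabs z <= lnorm u * lnorm v.
  rewrite -ler_sqr ?nnegrE ?cabs_ge0 ?mulr_ge0 ?lnorm_ge0 // -lecR cabs_sq exprMn realCM.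
  by rewrite !lnorm_sq; exact: lform_CS.
by have := Re_le_cabs z; rewrite sqrrD; lra.
Qed.

Lemma lnorm_scale a u : lnorm (lscale a u) = cabs a * lnorm u.
Proof.
apply/eqP; rewrite -(eqrXn2 (n := 2)) ?mulr_ge0 ?lnorm_ge0 ?cabs_ge0 //; apply/eqP/complexI.
by rewrite lnorm_sq lform_scale exprMn realCM cabs_sq lnorm_sq [a^* * a]mulrC.
Qed.

End ListForm.

Section OnePoint.
Variables (R : realType) (T0 : Type).
Local Notation C := R[i].
Local Notation nsq z := (z * z^*).
Local Notation "x %:C" := (real_complex R x).
Variables (A : option T0 -> option T0 -> C) (om : T0 -> C).
Hypothesis hA : fpsd A.

Let some (u : seq (C * T0)) : seq (C * option T0) := [seq (p.1, Some p.2) | p <- u].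
Let omb (u : seq (C * T0)) : C := \sum_(p <- u) (p.1)^* * om p.2.
Hypothesis om_bound : forall u, nsq (omb u) <= lform A (some u) (some u).

Definition om_ext (t : C) (o : option T0) : C := if o is Some p then om p else t.

Let ext (u : seq (C * T0)) (z : C) := (z, None) :: some u.

Let omb_cat u v : omb (u ++ v) = omb u + omb v.
Proof. by rewrite /omb big_cat. Qed.

Let omb_scale a u : omb (lscale a u) = a^* * omb u.
Proof.
rewrite /omb big_map mulr_sumr; apply: eq_bigr => p _ /=.
by rewrite rmorphM /= mulrA.
Qed.

Let lform1 (x y z : C) : lform A [:: (x + y, None)] =1
  (fun w => lform A [:: (x, None)] w + lform A [:: (y, None)] w).
Proof.
move=> w; rewrite /lform !big_seq1 -big_split /=; apply: eq_bigr => q _.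
by rewrite rmorphD /=; ring.
Qed.

Let ext_cat u v a b w : lform A (ext (u ++ v) (a + b)) w = lform A (ext u a ++ ext v b) w.
Proof.
rewrite lform_catl /ext lform_cons [X in _ = X + _]lform_cons [X in _ = _ + X]lform_cons.
by rewrite lform1 // /some map_cat lform_catl; ring.
Qed.

Let ext_scale a u z : ext (lscale a u) (a * z) = lscale a (ext u z).
Proof. by rewrite /ext /some /lscale /= -!map_comp. Qed.

Let P u z := lnorm A (ext u z).

Let P_cat u v a b : P (u ++ v) (a + b) <= P u a + P v b.
Proof.
apply: le_trans (lnorm_cat hA _ _); rewrite /P le_eqVlt; apply/orP; left; apply/eqP.
by apply/eq_lnorm/lform_ext => // w; exact: ext_cat.
Qed.

Let P_scale a u z : P (lscale a u) (a * z) = cabs a * P u z.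
Proof. by rewrite /P ext_scale lnorm_scale. Qed.

Let f u := complex.Re (omb u).

Lemma cabs_real (r : R) : 0 <= r -> cabs r%:C = r.
Proof. by move=> r0; apply: complexI; rewrite cabsE ger0_norm // ler0c. Qed.

Let f_le u : f u <= P u 0.
Proof.
apply: le_trans (Re_le_cabs _) _.
rewrite -ler_sqr ?nnegrE ?cabs_ge0 ?lnorm_ge0 // -lecR cabs_sq lnorm_sq //.
apply: le_trans (om_bound u) _; rewrite le_eqVlt; apply/orP; left; apply/eqP.
have E w : lform A (ext u 0) w = lform A (some u) w.
  rewrite /ext lform_cons [X in X + _](_ : _ = 0) ?add0r //.
  by rewrite /lform big_seq1 big1 // => q _; rewrite conjC0 !mul0r.
exact/esym/lform_ext.
Qed.

Lemma Re_decomp (x y : R) : complex.Re (x%:C + 'i * y%:C) = x.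
Proof. by rewrite raddfD /= !(mul0r, mulr0, mul1r, subrr, addr0). Qed.

Lemma Re_realM (r : R) (z : C) : complex.Re (r%:C * z) = r * complex.Re z.
Proof. by case: z => x y /=; rewrite mul0r subr0. Qed.

(** Two real extensions, along [1] and ['i] in the coefficient of the new vector, bound the real
    part of the extended functional. Scaling the vector by the value [w] of the functional there
    turns this into a bound on the modulus. *)
Lemma one_point_bound : exists t : C, forall w : seq (C * option T0),
  nsq (\sum_(p <- w) (p.1)^* * om_ext t p.2) <= lform A w w.
Proof.
have fD u v : f (u ++ v) = f u + f v by rewrite /f omb_cat raddfD.
have fZ (r : R) u : f (lscale r%:C u) = r * f u by rewrite /f omb_scale conjC_realC Re_realM.
have [a1 h1] : exists a, forall u t, f u + t * a <= P u t%:C.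
  apply: (hahn_banach_step [::] (add := cat) (scale := fun r => lscale r%:C) (P := fun u t => P u t%:C)) => //.
    - by move=> u v a b; rewrite rmorphD; exact: P_cat.
  by move=> r u a r0; rewrite realCM P_scale cabs_real // ltW.
have [a2 h2] : exists a, forall (u : seq (C * T0) * R) t, f u.1 + u.2 * a1 + t * a <= P u.1 (u.2%:C + 'i * t%:C).
  apply: (hahn_banach_step ([::], 0) (f := fun u : seq (C * T0) * R => f u.1 + u.2 * a1) (add := fun u v => (u.1 ++ v.1, u.2 + v.2))
    (scale := fun r u => (lscale r%:C u.1, r * u.2)) (P := fun u t => P u.1 (u.2%:C + 'i * t%:C))).
  - by move=> u v /=; rewrite fD; ring.
  - by move=> r u /=; rewrite fZ; ring.
  - by move=> u; rewrite rmorph0 mulr0 addr0; exact: h1.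
  - move=> u v a b /=; apply: le_trans (P_cat _ _ _ _); rewrite le_eqVlt; apply/orP; left; apply/eqP.
    by congr (P _ _); rewrite !rmorphD /=; ring.
  - move=> r u a r0 /=; rewrite -[X in _ <= X * _]cabs_real ?(ltW r0) // -P_scale le_eqVlt; apply/orP; left; apply/eqP.
    by congr (P _ _); rewrite !realCM; ring.
pose t := a1%:C + 'i * a2%:C.
have h3 u z : complex.Re (omb u + z^* * t) <= P u z.
  have := h2 (u, complex.Re z) (complex.Im z).
  have zE : z = (complex.Re z)%:C + 'i * (complex.Im z)%:C by rewrite {1}[z]complexE.
  rewrite /= -zE; congr (_ <= _).
  rewrite raddfD /= -addrA; congr (_ + _).
  have -> : z^* = (complex.Re z)%:C + - 'i * (complex.Im z)%:C.
    by rewrite {1}zE rmorphD rmorphM /= conjCi !conjC_realC.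
  have -> : ((complex.Re z)%:C + - 'i * (complex.Im z)%:C) * t =
    (complex.Re z * a1)%:C + - ('i * 'i) * (complex.Im z * a2)%:C +
    'i * (complex.Re z * a2 - complex.Im z * a1)%:C.
    by rewrite rmorphB !realCM /t /=; ring.
  have -> : 'i * 'i = -1 :> C by rewrite -expr2 sqrCi.
  by rewrite opprK mul1r -(rmorphD (real_complex R)) Re_decomp.
have h4 u z : nsq (omb u + z^* * t) <= lform A (ext u z) (ext u z).
  rewrite -lnorm_sq // -/(P u z); set w := omb u + _; rewrite -cabs_sq lecR.
  rewrite ler_sqr ?nnegrE ?cabs_ge0 ?lnorm_ge0 //.
  have := h3 (lscale w u) (w * z); rewrite omb_scale rmorphM /= -mulrA -mulrDr -/w P_scale.
  have -> : w^* * w = ((cabs w) ^+ 2)%:C by rewrite cabs_sq mulrC.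
  rewrite /= => h.
  have [w0|wn0] := eqVneq (cabs w) 0; first by rewrite w0 lnorm_ge0.
  by move: h; rewrite expr2 ler_pM2l // lt0r wn0 cabs_ge0.
have extE u z w' : lform A (ext u z) w' = lform A [:: (z, None)] w' + lform A (some u) w'.
  exact: lform_cons.
exists t => w.
have [u [z [E1 E2]]] : exists u z, (\sum_(p <- w) (p.1)^* * om_ext t p.2 = omb u + z^* * t) /\
    forall w', lform A w w' = lform A (ext u z) w'.
  elim: w => [|[a [p|]] w [u [z [E1 E2]]]].
  - exists [::], 0; split; first by rewrite /omb !big_nil conjC0 mul0r addr0.
    move=> w'; rewrite /ext /some /= /lform big_nil big_seq1 big1 // => q _.
    by rewrite conjC0 !mul0r.
  - exists ((a, p) :: u), z; split; first by rewrite big_cons E1 /omb big_cons /= addrA.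
    move=> w'; have -> : lform A (ext ((a, p) :: u) z) w' =
      lform A [:: (z, None)] w' + (lform A [:: (a, Some p)] w' + lform A (some u) w') by rewrite -!lform_cons.
    by rewrite lform_cons E2 extE; ring.
  - exists u, (a + z); split; first by rewrite big_cons E1 /= rmorphD mulrDl /=; ring.
    by move=> w'; rewrite lform_cons E2 !extE lform1 //; ring.
by rewrite E1 (lform_ext hA E2); exact: h4.
Qed.

End OnePoint.

Section PickExtension.
Variables (R : realType) (X : Type).
Local Notation C := R[i].
Local Notation nsq z := (z * z^*).
Local Notation "x %:C" := (real_complex R x).
Variables (s B g : X -> X -> C) (M : C).
Hypotheses (hs : cnp s B) (hg : fpsd g) (M0 : 0 <= M).
Local Notation l := (fun z w => g z w * s z w).
Local Open Scope classical_set_scope.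

Definition pick_kernel (p q : X * C) : C := M * l p.1 q.1 - p.2 * (q.2)^* * s p.1 q.1.

(** Partial solutions are sets of pairs, ordered by inclusion for Zorn's lemma; that they are graphs
    is a consequence ([pick_set_functional]). *)
Definition pick_set (G : set (X * C)) := forall (H : finType) (z : H -> X * C),
  (forall h, G (z h)) -> psd (fun i j => pick_kernel (z i) (z j)).

Section Extend.
Variables (G : set (X * C)) (x0 : X).
Hypothesis hG : pick_set G.
Let GT := {p : X * C | G p}.
Variable d : GT.

Let pt (o : option GT) : X := if o is Some p then (sval p).1 else x0.
Let va (o : option GT) : C := if o is Some p then (sval p).2 else 0.
Let A (o o' : option GT) : C := M * l (pt o) (pt o') -
  va o * (va o')^* * (s (pt o) (pt o') - s (pt o) x0 * s x0 (pt o') / s x0 x0).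
Let r0 := sqrtC (s x0 x0).
Let om (p : GT) : C := (sval p).2 * s (sval p).1 x0 / r0.

Let s00 : 0 < s x0 x0. Proof. exact: cnp_gt0 hs x0. Qed.
Let r0r0 : s x0 x0 = r0 * r0. Proof. by rewrite -expr2 sqrtCK. Qed.
Let r0c : r0^* = r0. Proof. by apply: ge0_conj; rewrite sqrtC_ge0 ltW. Qed.
Let r0n : r0 != 0.
Proof. by apply: contraTneq s00 => r00; rewrite r0r0 r00 mul0r ltxx. Qed.

(** By [cnp_split] at [x0], [A] is [M * g] times the rank one part of [s] plus [cnp_base] times the
    Pick kernel of [G]. Since [cnp_base] vanishes at [x0], the new point needs no value, and [d] is
    a dummy there. *)
Let A_psd : fpsd A.
Proof.
move=> H z.
pose z' i : X * C := sval (if z i is Some p then p else d).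
pose ep i : C := if z i is Some _ then 1 else 0.
have q0 : 0 <= M * (s x0 x0)^-1 by rewrite mulr_ge0 // invr_ge0 ltW.
have pD : psd (fun i j => pick_kernel (z' i) (z' j)).
  by apply: hG => i; rewrite /z'; case: (z i) => [p|]; exact: svalP.
apply: eq_psd (psdD (psdZ q0 (psdM (hg (fun i => pt (z i))) (psd_rank1 (fun i => s (pt (z i)) x0))))
  (psdM (cnp_base_fpsd hs x0 (fun i => pt (z i))) (psdM (psd_rank1 ep) pD))) => i j.
rewrite -(cnp_herm hs) /A.
have sn : s x0 x0 != 0 by rewrite gt_eqF.
rewrite /ep /z' /pick_kernel; case: (z i) => [p|] /=; last first.
  rewrite (cnp_base_self hs) !mul0r subr0 addr0.
  by rewrite [s x0 x0 * _]mulrC; field.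
case: (z j) => [q|] /=; last first.
  by rewrite (cnp_base_selfr hs) conjC0 !(mulr0, mul0r, subr0, addr0); field.
rewrite conjC1 !mul1r [in RHS](cnp_split hs x0 (sval p).1 (sval q).1).
set cb := cnp_base _ _ _ _; set sij := s (sval p).1 (sval q).1.
have sE : s (sval p).1 x0 * s x0 (sval q).1 / s x0 x0 = sij - sij * cb.
  by rewrite {1}/sij (cnp_split hs x0 (sval p).1 (sval q).1) addrK.
have -> : M / s x0 x0 * (g (sval p).1 (sval q).1 * (s (sval p).1 x0 * s x0 (sval q).1)) =
  M * g (sval p).1 (sval q).1 * (sij - sij * cb) by rewrite -sE; ring.
by rewrite sE; ring.
Qed.

Let A_om (p q : GT) : A (Some p) (Some q) - om p * (om q)^* = pick_kernel (sval p) (sval q).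
Proof.
rewrite /A /om /pick_kernel /= !rmorphM fmorphV /= r0c -(cnp_herm hs) r0r0.
by field.
Qed.

Let om_le u : nsq (\sum_(p <- u) (p.1)^* * om p.2) <=
  lform A [seq (p.1, Some p.2) | p <- u] [seq (p.1, Some p.2) | p <- u].
Proof.
rewrite -subr_ge0.
have := @hG _ (fun i => sval (tnth (in_tuple u) i).2) (fun i => svalP _) (fun i => (tnth (in_tuple u) i).1).
congr (0 <= _); rewrite [X in nsq X]big_tnth -rank1_form /lform big_map [X in _ = X - _]big_tnth -sumrB.
apply: eq_bigr => i _; rewrite big_map [X in _ = X - _]big_tnth -sumrB; apply: eq_bigr => j _.
by rewrite -A_om /=; ring.
Qed.

(* The form [A] does not depend on the value to be assigned at [x0]: this value
   only has to extend the contractive functional [om] to one more vector. *)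
Lemma pick_set_extend : exists t, pick_set (G `|` [set (x0, t)]).
Proof.
have [t ht] := one_point_bound A_psd om_le.
(* At a pair [(x0, v)] the formula of [om] gives [v * s x0 x0 / r0 = v * r0], to be equal to [t]. *)
exists (t / r0) => H z hz c.
have oP h : exists o : option GT, if o is Some p then z h = sval p else z h = (x0, t / r0).
  by have [Gh|->] := hz h; [exists (Some (exist _ _ Gh))|exists None].
have [o ho] := choice oP.
pose w := [seq (c h, o h) | h <- index_enum H].
have := ht w; rewrite -subr_ge0; congr (0 <= _).
rewrite /w /lform !big_map /= -rank1_form -sumrB; apply: eq_bigr => i _.
rewrite big_map -sumrB; apply: eq_bigr => j _ /=.
rewrite -mulrBr; congr (_ * _).
have om0 : t = t / r0 * s x0 x0 / r0 by rewrite r0r0; field.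
have := ho j; have := ho i; case: (o i) => [p|] -> ; case: (o j) => [q|] -> //=.
- rewrite /A /om /pick_kernel /= conjC0 mulr0 mul0r subr0 {1}om0 !rmorphM !fmorphV /= r0c.
  by rewrite (ge0_conj (ltW s00)) r0r0; field.
- rewrite /A /om /pick_kernel /= !mul0r subr0 !rmorphM fmorphV /= r0c -(cnp_herm hs).
  by field.
- rewrite /A /pick_kernel /= !mul0r subr0 rmorphM fmorphV /= r0c r0r0.
  by field.
Qed.

End Extend.

(** At coefficients [1] and [-1], two pairs over [x] give the form the value
    [- |a - b|^2 * s x x]. *)
Lemma pick_set_functional G x a b : pick_set G -> G (x, a) -> G (x, b) -> a = b.
Proof.
move=> hG Ga Gb.
have hz (i : bool) : G (if i then (x, a) else (x, b)) by case: i.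
have h : 0 <= - (nsq (a - b) * s x x).
  have := psd_pair true false 1 (-1) (@hG bool _ hz); rewrite /pick_kernel /= rmorphN rmorphB /= !conjC1.
  by congr (0 <= _); ring.
have s0 := cnp_gt0 hs x.
move: h; rewrite oppr_ge0 pmulr_lle0 // => h.
have : nsq (a - b) == 0 by rewrite eq_le h mul_conjC_ge0.
by rewrite mulf_eq0 conjC_eq0 orbb subr_eq0 => /eqP.
Qed.

Theorem pick_extension (lam : nat -> X) (v : nat -> C) :
  (forall N (c : 'I_N -> C), fform s (fun i : 'I_N => lam i) (fun i => (v i)^* * c i) <=
     M * fform l (fun i : 'I_N => lam i) c) ->
  exists phi : X -> C, (forall i, phi (lam i) = v i) /\
    forall n (x : 'I_n -> X) c, kform s x (fun i => (phi (x i))^* * c i) <= M * kform l x c.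
Proof.
move=> hv.
have formE (H : finType) (z : H -> X * C) c :
  \sum_i \sum_j (c i)^* * c j * pick_kernel (z i) (z j) =
  M * fform l (fun i => (z i).1) c - fform s (fun i => (z i).1) (fun i => ((z i).2)^* * c i).
  rewrite mulr_sumr -sumrB; apply: eq_bigr => i _; rewrite mulr_sumr -sumrB; apply: eq_bigr => j _.
  by rewrite /pick_kernel rmorphM /= conjCK; ring.
pose G0 : set (X * C) := [set p | exists i, p = (lam i, v i)].
have h0 : pick_set G0.
  move=> H z hz.
  have [m hm] := choice hz.
  pose N := (\max_h m h).+1.
  have mN h : (m h < N)%N by rewrite ltnS; exact: leq_bigmax.
  have pN : psd (fun i j : 'I_N => pick_kernel (lam i, v i) (lam j, v j)).
    by move=> c; rewrite (formE _ (fun i : 'I_N => (lam i, v i))) subr_ge0; exact: hv.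
  by apply: eq_psd (psd_comp (fun h => Ordinal (mN h)) pN) => i j /=; rewrite !hm.
(* Zorn's lemma is applied to what is added to [G0], so that the empty chain is covered by [h0]. *)
have [Gm [hGm maxG]] : exists A, pick_set (G0 `|` A) /\ forall B, A `<` B -> ~ pick_set (G0 `|` B).
  apply: (@Zorn_bigcup _ (fun A => pick_set (G0 `|` A))) => F FP Ftot H z hz.
  have fin (r : seq H) : (forall h, h \in r -> G0 (z h)) \/
      exists2 Y, F Y & forall h, h \in r -> (G0 `|` Y) (z h).
    elim: r => [|h r IH]; first by left.
    have [Gh|[Y FY Yh]] := hz h.
      case: IH => [IH|[Y FY IH]]; [left|right; exists Y => //] => h';
        rewrite in_cons => /orP[/eqP ->|/IH //]; by [|left].
    right; case: IH => [IH|[Z FZ IH]].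
      exists Y => // h'; rewrite in_cons => /orP[/eqP ->|/IH ?]; by [right|left].
    have [YZ|ZY] := Ftot _ _ FY FZ.
      by exists Z => // h'; rewrite in_cons => /orP[/eqP ->|/IH //]; right; exact: YZ.
    exists Y => // h'; rewrite in_cons => /orP[/eqP ->|/IH [?|?]]; [by right|by left|right; exact: ZY].
  have [h|[Y FY h]] := fin (enum H).
    by apply: h0 => i; apply: h; rewrite mem_enum.
  by apply: (FP _ FY) => i; apply: h; rewrite mem_enum.
have tot x : exists t, (G0 `|` Gm) (x, t).
  have d : {p | (G0 `|` Gm) p} by exists (lam 0%N, v 0%N); left; exists 0%N.
  have [t ht] := pick_set_extend x hGm d; exists t; apply: contrapT => nG.
  apply: (maxG (Gm `|` [set (x, t)])); last by rewrite setUA.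
  split; first by move=> y; left.
  by move=> /(_ (x, t)) hh; apply: nG; right; apply: hh; right.
have [phi hphi] := choice tot.
exists phi; split=> [i|n x c].
  apply: (pick_set_functional hGm (hphi (lam i))); left; by exists i.
rewrite -subr_ge0; have := hGm _ (fun i => (x i, phi (x i))) (fun i => hphi (x i)) c.
by rewrite formE.
Qed.

End PickExtension.

(** * Interpolating sequences: necessity *)

Section Signs.
Variables (R : realType) (X : Type).
Local Notation C := R[i].
Local Notation nsq z := (z * z^*).
Local Notation "x %:C" := (real_complex R x).
Variables (k : X -> X -> C).
Hypothesis hk : fpsd k.

Lemma fform_recr N (z : 'I_N.+1 -> X) (c : 'I_N.+1 -> C)
    (w := fun i : 'I_N => widen_ord (leqnSn N) i) :
  fform k z c = fform k (fun i => z (w i)) (fun i => c (w i)) +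
    ((\sum_i (c (w i))^* * k (z (w i)) (z ord_max)) * c ord_max +
     ((\sum_i (c (w i))^* * k (z (w i)) (z ord_max)) * c ord_max)^*) +
    nsq (c ord_max) * k (z ord_max) (z ord_max).
Proof.
rewrite /fform big_ord_recr /= (eq_bigr (fun i : 'I_N => \sum_(j < N) (c (w i))^* * c (w j) * k (z (w i)) (z (w j)) +
  (c (w i))^* * k (z (w i)) (z ord_max) * c ord_max)); last first.
  by move=> i _; rewrite big_ord_recr /=; congr (_ + _); rewrite /w; ring.
rewrite big_split /= -mulr_suml big_ord_recr /= -!addrA; congr (_ + (_ + (_ + _))); last by rewrite [nsq _]mulrC.
rewrite rmorphM rmorph_sum /= mulr_suml; apply: eq_bigr => i _.
by rewrite rmorphM /= conjCK -(fpsd_herm (z (w i)) _ hk) /w; ring.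
Qed.

Lemma fformD_le (H : finType) (z : H -> X) a b :
  fform k z (fun i => a i + b i) <= 2 * fform k z a + 2 * fform k z b.
Proof.
rewrite -subr_ge0; have := hk z (fun i => a i - b i); congr (0 <= _).
rewrite !mulr_sumr -big_split -sumrB /=; apply: eq_bigr => i _.
rewrite !mulr_sumr -big_split -sumrB /=; apply: eq_bigr => j _.
by rewrite rmorphB rmorphD /=; ring.
Qed.

(** Signs are fixed one at a time, each giving the cross term of its vector with the earlier ones
    the wanted sign. *)
Lemma signs N (z : 'I_N -> X) (c : 'I_N -> C) (up : bool) : exists e : nat -> C,
  (forall i, e i = 1 \/ e i = -1) /\
  if up then \sum_i nsq (c i) * k (z i) (z i) <= fform k z (fun i => e i * c i)
  else fform k z (fun i => e i * c i) <= \sum_i nsq (c i) * k (z i) (z i).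
Proof.
elim: N z c => [|N IH] z c.
  by exists (fun=> 1); split=> [i|]; [left|rewrite /fform !big_ord0; case: up].
pose w (i : 'I_N) := widen_ord (leqnSn N) i.
have [e [e1 he]] := IH (fun i => z (w i)) (fun i => c (w i)).
pose Y := (\sum_(i < N) (e i * c (w i))^* * k (z (w i)) (z ord_max)) * c ord_max.
have Yr : Y + Y^* \is Num.real by apply/CrealP; rewrite rmorphD /= conjCK addrC.
have [sg [sg1 hsg]] : exists sg : C, (sg = 1 \/ sg = -1) /\
    if up then 0 <= sg * (Y + Y^*) else sg * (Y + Y^*) <= 0.
  have /orP[h|h] := real_leVge (rpred0 _) Yr; case: (up).
  - by exists 1; rewrite mul1r; split; [left|].
  - by exists (-1); rewrite mulN1r oppr_le0; split; [right|].
  - by exists (-1); rewrite mulN1r oppr_ge0; split; [right|].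
  - by exists 1; rewrite mul1r; split; [left|].
have sgc : sg^* = sg by case: sg1 => ->; rewrite ?rmorphN /= conjC1.
have sg2 : sg * sg = 1 by case: sg1 => ->; ring.
pose e' (i : nat) := if i == N then sg else e i.
exists e'; split; first by move=> i; rewrite /e'; case: eqP.
have eN : e' N = sg by rewrite /e' eqxx.
have ew (i : 'I_N) : e' i = e i by rewrite /e' ltn_eqF.
rewrite fform_recr /=.
have -> : fform k (fun i : 'I_N => z (widen_ord (leqnSn N) i)) (fun i : 'I_N => e' i * c (widen_ord (leqnSn N) i)) =
   fform k (fun i => z (w i)) (fun i => e i * c (w i)) by apply: eq_fform => i; rewrite ew.
have -> : \sum_(i < N) (e' i * c (widen_ord (leqnSn N) i))^* * k (z (widen_ord (leqnSn N) i)) (z ord_max) =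
   \sum_(i < N) (e i * c (w i))^* * k (z (w i)) (z ord_max) by apply: eq_bigr => i _; rewrite ew.
rewrite eN big_ord_recr /=.
set F := fform _ _ _; set Q := \sum_(i < N) (e i * _)^* * _; set D := \sum_(i < N) _ * _.
have -> : Q * (sg * c ord_max) + (Q * (sg * c ord_max))^* = sg * (Y + Y^*).
  by rewrite /Y -/Q !rmorphM /= sgc; ring.
have -> : sg * c ord_max * (sg * c ord_max)^* = c ord_max * (c ord_max)^*.
  rewrite rmorphM /= sgc.
  have -> : sg * c ord_max * (sg * (c ord_max)^*) = sg * sg * (nsq (c ord_max)) by ring.
  by rewrite sg2 mul1r.
case: (up) he hsg => he hsg; rewrite lerD2r.
  by apply: le_trans he _; rewrite lerDl.
by apply: le_trans he; rewrite gerDl.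
Qed.

End Signs.

Section Necessity.
Variables (R : realType) (X : Type).
Local Notation C := R[i].
Local Notation nsq z := (z * z^*).
Local Notation "x %:C" := (real_complex R x).
Variables (s l : X -> X -> C) (lam : nat -> X).
Hypotheses (hs : fpsd s) (hl : fpsd l) (s0 : forall z, 0 < s z z) (l0 : forall z, 0 < l z z).
Hypothesis hint : interpolating s l lam.

Let r (i : nat) : C := (knorm l (lam i) / knorm s (lam i))%:C.
(** For a multiplier with value [w i * r i] at [lam i], the squared norm of its adjoint at the
    combination of kernels of [l] with coefficients [c]. *)
Let S (w : nat -> C) N (c : 'I_N -> C) :=
  fform s (fun i : 'I_N => lam i) (fun i => (w i)^* * (r i * c i)).
Let L N (c : 'I_N -> C) := fform l (fun i : 'I_N => lam i) c.

Let cabs0 : cabs (0 : C) = 0. Proof. by apply: complexI; rewrite cabsE normr0. Qed.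
Let cabs1 : cabs (1 : C) = 1. Proof. by apply: complexI; rewrite cabsE normr1. Qed.

Let realCD (x y : R) : (x + y)%:C = x%:C + y%:C.
Proof. exact: rmorphD. Qed.

Let realC_nat n : (n%:R : R)%:C = n%:R.
Proof. exact: rmorph_nat. Qed.

Let L_ge0 N (c : 'I_N -> C) : 0 <= L c. Proof. exact: hl. Qed.
Let S_ge0 w N (c : 'I_N -> C) : 0 <= S w c. Proof. exact: hs. Qed.

Let S_bound (w : nat -> C) : (exists W : R, forall i, cabs (w i) <= W) ->
  exists2 M : R, 0 <= M & forall N (c : 'I_N -> C), S w c <= M%:C * L c.
Proof.
move=> /hint[phi [phim phiE]]; have [M M0 hM] := multiplier_kernel hs hl phim.
exists (M ^+ 2); first exact: sqr_ge0.
move=> N c; apply: le_trans (hM N (fun i : 'I_N => lam i) c).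
rewrite le_eqVlt; apply/orP; left; apply/eqP; apply: eq_fform => i.
by rewrite phiE rmorphM /= conjC_realC mulrA.
Qed.

Let S_ext w w' N (c : 'I_N -> C) : (forall i, (i < N)%N -> w i = w' i) -> S w c = S w' c.
Proof. by move=> h; apply: eq_fform => i; rewrite h. Qed.

Let SD w w' N (c : 'I_N -> C) : S (fun i => w i + w' i) c <= 2 * S w c + 2 * S w' c.
Proof.
apply: le_trans (fformD_le hs _ _ _); rewrite le_eqVlt; apply/orP; left; apply/eqP.
by apply: eq_fform => i; rewrite rmorphD mulrDl.
Qed.

Let SZ a w N (c : 'I_N -> C) : S (fun i => a * w i) c = nsq a * S w c.
Proof.
have -> : nsq a = nsq a^* by rewrite conjCK mulrC.
rewrite /S -fformZ; apply: eq_fform => i.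
by rewrite [(a * w i)^*]rmorphM /= -mulrA.
Qed.

Let cabs_le1 (a : C) : cabs a <= 1 -> nsq a <= 1.
Proof. by move=> h; rewrite -cabs_sq (_ : 1 = 1%:C) // lecR expr_le1 // cabs_ge0. Qed.

Let S_initial N0 : exists2 K : R, 0 <= K & forall w, (forall i, cabs (w i) <= 1) ->
  (forall i, (N0 <= i)%N -> w i = 0) -> forall N (c : 'I_N -> C), S w c <= K%:C * L c.
Proof.
elim: N0 => [|N0 [K K0 IH]].
  exists 0 => // w _ w0 N c; rewrite mul0r le_eqVlt; apply/orP; left; apply/eqP.
  by rewrite /S /fform big1 // => i _; rewrite big1 // => j _; rewrite w0 // conjC0 !mul0r conjC0 !mul0r.
have [M M0 hM] : exists2 M : R, 0 <= M & forall N (c : 'I_N -> C), S (fun i => (i == N0)%:R) c <= M%:C * L c.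
  apply: S_bound; exists 1 => i; by case: (i == N0); rewrite /= ?mulr1n ?mulr0n ?cabs1 ?cabs0.
exists (2 * K + 2 * M); first by lra.
move=> w w1 w0 N c.
rewrite (@S_ext w (fun i => (if (i < N0)%N then w i else 0) + w N0 * (i == N0)%:R)); last first.
  move=> i _; have [->|iN] := eqVneq i N0; first by rewrite ltnn add0r mulr1.
  by case: ltnP => iN0; rewrite mulr0 addr0 // w0 // ltn_neqAle eq_sym iN.
apply: le_trans (SD _ _ _) _; 
have -> : (2 * K + 2 * M)%:C * L c = 2 * (K%:C * L c) + 2 * (M%:C * L c).
  by rewrite realCD !realCM !realC_nat; ring.
apply: lerD; rewrite ler_pM2l //.
  apply: IH => i; last by move=> h; rewrite ltnNge h.
  by case: ltnP => _; rewrite ?cabs0.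
by rewrite SZ; apply: le_trans (hM _ _); rewrite ler_piMl // cabs_le1.
Qed.

(** The failure is witnessed by the first [N] terms of [W], so changing later terms does not repair
    it. *)
Let bad (W : nat -> C) (N k : nat) := exists c : 'I_N -> C, ~ (S W c <= (k%:R)%:C * L c).

(* Gliding hump: otherwise a bounded sequence could be assembled from blocks
   that violate larger and larger bounds. *)
Lemma uniform_bound : exists2 M : R, 0 < M &
  forall w : nat -> C, (forall i, cabs (w i) <= 1) -> forall N (c : 'I_N -> C),
    fform s (fun i : 'I_N => lam i) (fun i : 'I_N => (w i)^* * (r i * c i)) <=
    M%:C * fform l (fun i : 'I_N => lam i) c.
Proof.
apply: contrapT => nM.
have step (p : nat * nat) : exists q : nat * (nat -> C), (forall i, cabs (q.2 i) <= 1) /\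
    forall W, (forall i, cabs (W i) <= 1) -> (forall i, (p.1 <= i)%N -> (i < q.1)%N -> W i = q.2 i) ->
    bad W q.1 p.2.
  case: p => N0 k /=; have [K K0 hK] := S_initial N0.
  (* On the relevant indices [w = W + 2 d], with [d] bounded by [1] and supported below [N0]; a
     bound [k] for [W] would give [2 k + 8 K] for [w]. *)
  pose M : R := 2 * k%:R + 8 * K + 1.
  have Mp : 0 < M by rewrite /M; have := ler0n R k; lra.
  have [w [w1 [N [c hc]]]] : exists w, (forall i, cabs (w i) <= 1) /\ exists N, exists c : 'I_N -> C, ~ (S w c <= M%:C * L c).
    apply: contrapT => h; apply: nM; exists M => // w w1 N c; apply: contrapT => hc.
    by apply: h; exists w; split=> //; exists N, c.
  exists (N, w); split=> // W W1 Ww; exists c => hW; apply: hc.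
  pose d i : C := if (i < N0)%N then (w i - W i) / 2 else 0.
  rewrite (@S_ext w (fun i => W i + 2 * d i)); last first.
    move=> i iN; rewrite /d; case: ltnP => iN0; last by rewrite mulr0 addr0 Ww.
    by rewrite mulrC divfK ?pnatr_eq0 // addrC subrK.
  apply: le_trans (SD _ _ _) _; rewrite SZ.
  have hd : S d c <= K%:C * L c.
    apply: hK => i; rewrite /d; last by move=> h; rewrite ltnNge h.
    case: ifP => _; rewrite ?cabs0 //; rewrite -lecR cabsE normrM normfV normr_nat.
    rewrite ler_pdivrMr ?ltr0n // mul1r; apply: le_trans (ler_normB _ _) _.
    by rewrite -!cabsE -(rmorphD (real_complex R)) -(rmorph_nat (real_complex R)) lecR; have := w1 i; have := W1 i; lra.
  have -> : M%:C * L c = 2 * ((k%:R)%:C * L c) + 8 * (K%:C * L c) + L c.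
    by rewrite /M !realCD !realCM !realC_nat; ring.
  rewrite conjC_nat -[X in X <= _]addr0; apply: lerD => //; apply: lerD.
    by rewrite ler_pM2l ?ltr0n.
  have -> : 2 * (2 * 2 * S d c) = 8 * S d c by ring.
  by rewrite ler_pM2l ?ltr0n.
have [nx hnx] := choice step.
(* The [k]-th block runs from [Nq k] to [Nq k.+1], excluded; there [W] copies a sequence violating
   the bound [k]. Indices in no block get the value [0]. *)
pose Nq k := iteri k (fun k n => maxn n (nx (n, k)).1) 0%N.
have NqS k : Nq k.+1 = maxn (Nq k) (nx (Nq k, k)).1 by [].
have Nq_mono : {homo Nq : m n / (m <= n)%N}.
  by apply: homo_leq; [exact: leqnn|exact: leq_trans|move=> k; rewrite NqS leq_maxl].
have WP i : exists y : C, cabs y <= 1 /\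
    forall k, (Nq k <= i)%N -> (i < Nq k.+1)%N -> y = (nx (Nq k, k)).2 i.
  have [[k [k1 k2]]|nk] := pselect (exists k, (Nq k <= i)%N /\ (i < Nq k.+1)%N); last first.
    exists 0; split; first by rewrite cabs0.
    by move=> k h1 h2; case: nk; exists k.
  exists ((nx (Nq k, k)).2 i); split; first exact: (hnx _).1.
  move=> k' h1 h2; suff -> : k' = k by [].
  have aux a b : (Nq a <= i)%N -> (i < Nq b.+1)%N -> (a <= b)%N.
    move=> ha hb; rewrite leqNgt; apply/negP => ba.
    by have := leq_trans hb (leq_trans (Nq_mono _ _ ba) ha); rewrite ltnn.
  by apply/eqP; rewrite eqn_leq (aux _ _ h1 k2) (aux _ _ k1 h2).
have [W hW] := choice WP.
have [M M0 hM] : exists2 M : R, 0 <= M & forall N (c : 'I_N -> C), S W c <= M%:C * L c.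
  by apply: S_bound; exists 1 => i; exact: (hW i).1.
pose k := Num.bound M.
have [c hc] : bad W (nx (Nq k, k)).1 k.
  apply: (hnx (Nq k, k)).2; first by move=> i; exact: (hW i).1.
  by move=> i h1 h2; apply: (hW i).2 => //; rewrite NqS leq_max h2 orbT.
apply: hc; apply: le_trans (hM _ c) _; apply: ler_wpM2r => //.
by rewrite lecR ltW // archi_boundP.
Qed.

Let sign_cabs (e : nat -> C) : (forall i, e i = 1 \/ e i = -1) ->
  (forall i, cabs (e i) <= 1) /\ forall i, (e i)^* = e i /\ e i * e i = 1.
Proof.
move=> he; split=> i; case: (he i) => ->.
- by rewrite cabs1.
- by rewrite -lecR cabsE normrN -cabsE cabs1.
- by rewrite conjC1 mulr1.
- by rewrite rmorphN /= conjC1 mulrNN mulr1.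
Qed.

Let r_sq i : nsq (r i) * s (lam i) (lam i) = l (lam i) (lam i).
Proof.
rewrite /r conjC_realC -(knormE (lam i) hl) -[s (lam i) (lam i)](knormE (lam i) hs) !realC_sq realCM realCV.
by field; rewrite gt_eqF // realC_gt0 knorm_gt0.
Qed.

(** Signs making the combination of kernels of [s] large are used as interpolation data; [r_sq]
    converts the weights of [s] into those of [l]. *)
Lemma interpolating_riesz : exists2 M : R, 0 < M & forall N (c : 'I_N -> C),
  \sum_i nsq (c i) * l (lam i) (lam i) <= M%:C * fform l (fun i : 'I_N => lam i) c.
Proof.
have [M M0 hM] := uniform_bound; exists M => // N c.
have [e [/sign_cabs [e1 e2] he]] := signs hs (fun i : 'I_N => lam i) (fun i => r i * c i) true.
apply: le_trans (hM e e1 N c); move: he => /=; congr (_ <= _).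
  by apply: eq_bigr => i _; rewrite rmorphM /= -r_sq; ring.
by apply: eq_fform => i; rewrite (e2 i).1.
Qed.

(** Here the signs make the combination of kernels of [l] small. They enter once as data and once in
    the coefficients, so they cancel on the side of [s]. *)
Lemma interpolating_carleson : carleson s lam.
Proof.
have [M M0 hM] := uniform_bound; apply: (@gram_carleson _ _ _ _ hs s0 M) => // N a.
have rn i : r i != 0 by rewrite /r gt_eqF // realC_gt0 divr_gt0 // knorm_gt0.
have [e [/sign_cabs [e1 e2] he]] := signs hl (fun i : 'I_N => lam i) (fun i => a i / r i) false.
have -> : fform s (fun i : 'I_N => lam i) a = S e (fun i : 'I_N => e i * (a i / r i)).
  apply: eq_fform => i; rewrite (e2 i).1.
  have -> : e i * (r i * (e i * (a i / r i))) = e i * e i * (a i / r i * r i) by ring.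
  by rewrite (e2 i).2 mul1r divfK.
apply: le_trans (hM e e1 N _) _; rewrite ler_pM2l ?realC_gt0 //.
apply: le_trans he _; rewrite le_eqVlt; apply/orP; left; apply/eqP; apply: eq_bigr => i _.
rewrite -r_sq rmorphM fmorphV /=; move: (r i) (rn i) => ri rin.
by field; rewrite conjC_eq0 rin.
Qed.

(** The Riesz bound controls each single coefficient with a constant independent of the other
    points, hence of [n]. *)
Lemma interpolating_separated n : weakly_separated l lam n.
Proof.
have [M M0 hM] := interpolating_riesz.
apply/(weakly_separatedP _ hl l0); exists M^-1; first by rewrite invr_gt0.
move=> mu imu rmu i0 c.
have [m hm] := choice rmu.
pose N := (\max_h m h).+1.
have mN h : (m h < N)%N by rewrite ltnS; exact: leq_bigmax.
pose h i := Ordinal (mN i).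
have muE : mu = (fun i => lam (h i)) by apply: funext => i; rewrite hm.
rewrite realCV ler_pdivrMl ?realC_gt0 //.
have -> : fform l mu c = fform l (fun j : 'I_N => lam j) (fun j => \sum_(i | h i == j) c i).
  by rewrite muE (fform_comp h l (fun j : 'I_N => lam j)).
apply: le_trans (hM _ _).
rewrite (bigD1 (h i0)) //= (big_pred1 i0); last first.
  move=> i; apply/eqP/eqP => [hi|->//]; apply: imu; rewrite !muE hi; done.
rewrite -[lam (m i0)]hm lerDl; apply: sumr_ge0 => j _.
by apply: mulr_ge0; [exact: mul_conjC_ge0|exact/ltW/l0].
Qed.

End Necessity.

Theorem theorem1p4 (R : realType) (X : Type) (x0 : X)
    (s g : X -> X -> R[i]) (lam : nat -> X) :
  normalized_complete_pick s ->
  is_kernel g ->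
  (forall z : X, exists w : X, g w z * s w z != 0) ->
  injective lam ->
  (interpolating s (fun z w => g z w * s z w) lam <->
   carleson s lam /\
   (forall n : nat, (2 <= n)%N ->
      weakly_separated (fun z w => g z w * s z w) lam n)).
Proof.
move=> /pick_cnp[B hB] /kernel_fpsd hg hnz lam_inj.
have hs := cnp_fpsd hB; have hl := fpsdM hg hs.
have s0 := cnp_gt0 hB; have l0 z := nonvanishing_gt0 hl (hnz z).
split=> [hint|[hc hw] w [W hW]].
  split; first exact: (interpolating_carleson hs hl s0 l0 hint).
  by move=> n _; exact: (interpolating_separated hs hl s0 l0 hint).
have [C0 C0p [hgram hsum]] := carleson_gram hs s0 hc.
have [k kp hk] := strong_separation hB hg lam_inj l0 C0p hsum
  (fun n n2 => (weakly_separatedP lam hl l0 n).1 (hw n n2)).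
have kC0 : 0 < k / C0 by rewrite divr_gt0.
have hr := riesz_lower_bound hB hg l0 C0p kp hgram hk.
have hp := pick_matrix_bound hB hg l0 C0p kC0 hgram hr hW.
set M := C0 * W ^+ 2 / (k / C0) in hp.
have M0 : 0 <= M by apply: divr_ge0; [apply: mulr_ge0; [exact: ltW|exact: sqr_ge0]|exact: ltW].
have M0c : 0 <= real_complex R M by rewrite ler0c.
have [phi [phi_lam hphi]] := @pick_extension _ _ _ _ _ _ hB hg M0c lam
  (fun i => w i * real_complex R (knorm (fun z w => g z w * s z w) (lam i) / knorm s (lam i))) hp.
exists phi; split=> //.
apply: (kernel_multiplier hs (sqrtr_ge0 M)) => n x c.
by rewrite sqr_sqrtr //; exact: hphi.
Qed.
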